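(* The SCSS$_3$ problem on $n$-vertex digraphs reduces in $O(n^2)$ time to Minimum Bipartite Edge Cover. That is, there is an $O(n^2)$-time procedure that, given a strongly connected digraph $G=(V,E)$ with $|V|=n$ and with no directed cycle of more than three edges, produces an instance of Minimum Edge Cover on a bipartite graph, such that from any minimum edge cover of that instance a minimum-size strongly connected spanning subgraph of $G$ is obtained.
   Context: For a strongly connected digraph $G=(V,E)$, a strongly connected spanning subgraph (SCSS) is a subset $S\subseteq E$ such that $(V,S)$ is strongly connected; the SCSS problem asks for an SCSS of minimum size. SCSS$_3$ denotes the SCSS problem restricted to digraphs in which every directed cycle has at most three edges. An edge cover of an undirected graph is a set of edges such that every vertex is incident to at least one edge of the set; Minimum Bipartite Edge Cover asks for a minimum-size edge cover of a given bipartite graph. *)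

(* Defs.v *)
From mathcomp Require Import all_boot.

Set Implicit Arguments.
Unset Strict Implicit.
Unset Printing Implicit Defensive.

Definition digraph (n : nat) : Type := {set 'I_n * 'I_n}.

Definition edge_rel n (E : digraph n) : rel 'I_n := fun u v => (u, v) \in E.

Definition strongly_connected n (E : digraph n) : Prop :=
  forall u v : 'I_n, connect (edge_rel E) u v.

(* A directed cycle is given by its sequence of distinct vertices, so its     *)
(* number of edges is the size of the sequence.                               *)
Definition cycles_at_most (k n : nat) (E : digraph n) : Prop :=
  forall p : seq 'I_n, ucycle (edge_rel E) p -> size p <= k.

Definition scss n (E S : digraph n) : Prop :=
  S \subset E /\ strongly_connected S.

Definition min_scss n (E S : digraph n) : Prop :=
  scss E S /\ forall S' : digraph n, scss E S' -> #|S| <= #|S'|.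

(* Vertex set 'I_nleft + 'I_nright; (i, j) is the undirected edge joining     *)
(* the left vertex i to the right vertex j.                                   *)
Record bigraph := Bigraph {
  nleft : nat;
  nright : nat;
  bedges : {set 'I_nleft * 'I_nright} }.

Definition incident (H : bigraph) (x : 'I_(nleft H) + 'I_(nright H))
    (e : 'I_(nleft H) * 'I_(nright H)) : bool :=
  match x with inl i => e.1 == i | inr j => e.2 == j end.

Definition edge_cover (H : bigraph) (C : {set 'I_(nleft H) * 'I_(nright H)})
    : Prop :=
  C \subset bedges H /\ forall x, exists2 e, e \in C & incident x e.

Definition min_edge_cover (H : bigraph)
    (C : {set 'I_(nleft H) * 'I_(nright H)}) : Prop :=
  edge_cover C /\
  forall C' : {set 'I_(nleft H) * 'I_(nright H)},
    edge_cover C' -> #|C| <= #|C'|.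

(* Running time is measured on a word RAM with structured control flow. A     *)
(* program is fixed text, hence uses finitely many registers and arrays.      *)

Record state := State {
  reg : nat -> nat;
  arr : nat -> nat -> nat }.

Definition upd (A : Type) (f : nat -> A) (x : nat) (v : A) : nat -> A :=
  fun y => if y == x then v else f y.

Definition set_reg (s : state) (x v : nat) : state :=
  State (upd (reg s) x v) (arr s).

Definition set_cell (s : state) (a i v : nat) : state :=
  State (reg s) (upd (arr s) a (upd (arr s a) i v)).

(* The arguments x, y, z are register names, a is an array name. *)
Inductive rhs : Type :=
  | Const of nat
  | Add (y z : nat)
  | Sub (y z : nat)
  | Mul (y z : nat)
  | Read (a y : nat).

Definition value (s : state) (e : rhs) : nat :=
  match e with
  | Const k => k
  | Add y z => reg s y + reg s z
  | Sub y z => reg s y - reg s z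
  | Mul y z => reg s y * reg s z
  | Read a y => arr s a (reg s y)
  end.

Inductive cmd : Type :=
  | Skip
  | Assign (x : nat) (e : rhs)
  | Write (a y z : nat)
  | Seq (c d : cmd)
  | IfLt (y z : nat) (c d : cmd)
  | WhileLt (y z : nat) (c : cmd).

(* exec W c s t s' : started in s, the program c halts in s' after t steps;   *)
(* elementary instructions and tests cost one step each. The machine words    *)
(* are 0, ..., W, and no rule applies to an assignment that overflows, so     *)
(* such a run does not count as halting. Unit-cost multiplication is          *)
(* legitimate when W is polynomial in the input size.                         *)
Inductive exec (W : nat) : cmd -> state -> nat -> state -> Prop :=
  | ExecSkip s : exec W Skip s 1 s
  | ExecAssign x e s :
      value s e <= W -> exec W (Assign x e) s 1 (set_reg s x (value s e))
  | ExecWrite a y z s :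
      exec W (Write a y z) s 1 (set_cell s a (reg s y) (reg s z))
  | ExecSeq c d s t s' t' s'' :
      exec W c s t s' -> exec W d s' t' s'' ->
      exec W (Seq c d) s (t + t') s''
  | ExecIfTrue y z c d s t s' :
      reg s y < reg s z -> exec W c s t s' -> exec W (IfLt y z c d) s t.+1 s'
  | ExecIfFalse y z c d s t s' :
      reg s z <= reg s y -> exec W d s t s' -> exec W (IfLt y z c d) s t.+1 s'
  | ExecWhileTrue y z c s t s' t' s'' :
      reg s y < reg s z -> exec W c s t s' ->
      exec W (WhileLt y z c) s' t' s'' ->
      exec W (WhileLt y z c) s (t + t').+1 s''
  | ExecWhileFalse y z c s :
      reg s z <= reg s y -> exec W (WhileLt y z c) s 1 s.

Definition bigO (f g : nat -> nat) : Prop :=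
  exists c n0 : nat, forall n : nat, n0 <= n -> f n <= c * g n.

(* Memory layout of the inputs and outputs. Digraphs are stored as row-major  *)
(* 0/1 adjacency matrices, bipartite graphs and edge covers as lists of edges *)
(* (left endpoints in one array, right endpoints in another).                 *)
Definition reg_n := 0.
Definition reg_nleft := 1.
Definition reg_nright := 2.
Definition reg_nedges := 3.
Definition reg_ncover := 4.
Definition arr_input := 0.
Definition arr_edge_left := 1.
Definition arr_edge_right := 2.
Definition arr_cover_left := 3.
Definition arr_cover_right := 4.
Definition arr_output := 5.

Definition adj_matrix n (E : digraph n) (i : nat) : nat :=
  [exists u : 'I_n, exists v : 'I_n, (i == u * n + v) && ((u, v) \in E)].

Definition init_state n (E : digraph n) : state :=
  State (upd (fun=> 0) reg_n n)
        (upd (fun=> (fun=> 0)) arr_input (adj_matrix E)).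

Definition holds_bigraph (s : state) (H : bigraph) : Prop :=
  [/\ reg s reg_nleft = nleft H,
      reg s reg_nright = nright H &
      exists es : seq ('I_(nleft H) * 'I_(nright H)),
        [/\ uniq es, es =i bedges H, reg s reg_nedges = size es,
            (forall k e, onth es k = Some e -> arr s arr_edge_left k = e.1) &
            (forall k e, onth es k = Some e -> arr s arr_edge_right k = e.2)]].

Definition load_cover a b (cs : seq ('I_a * 'I_b)) (s : state) : state :=
  State (upd (reg s) reg_ncover (size cs))
        (upd (upd (arr s)
           arr_cover_left (nth 0 [seq nat_of_ord e.1 | e <- cs]))
           arr_cover_right (nth 0 [seq nat_of_ord e.2 | e <- cs])).

Definition holds_output n (s : state) (S : digraph n) : Prop :=
  forall u v : 'I_n, arr s arr_output (u * n + v) = ((u, v) \in S).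

(* Main.v *)
(* In a strongly connected digraph whose cycles have at most three edges, every
   edge of an SCSS has a return path of length at most two in that SCSS. Loops
   can be dropped, and so can the reversals of the edges of a triangle: an SCSS
   using such a reversal can be rerouted along the triangle at no cost. After
   that, call an edge redundant if its end points remain connected without it,
   and necessary otherwise. A triangle has at most one redundant edge, and a
   redundant edge (u, v) lies in a unique triangle u -> v -> z -> u. Hence a set
   S containing all necessary edges is an SCSS iff every necessary edge lies on
   a cycle of S of length at most three. The necessary edges for which this is
   not automatic are called stars here; a redundant edge (u, v) serves only the
   stars among (v, z) and (z, u), so a minimum SCSS consists of the necessary
   edges together with a minimum edge cover of the graph whose vertices are the
   stars and whose edges are the redundant edges.

   That graph is bipartite: give a star weight 1, any other necessary edge
   weight 0, and a redundant edge the weight of its return path. All cycles have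
   weight 0 modulo 2, so the weight is the coboundary of a function phi, and the
   two stars (v, z) and (z, u) of a redundant edge satisfy phi z = phi v + 1.

   For the quadratic running time, a breadth-first tree and the return paths of
   its edges give 3n edges that form an SCSS; they contain all necessary edges,
   it suffices to inspect the triangles through them, and O(n) time is available
   for each of them. *)

Require Import Defs.
From mathcomp Require Import all_boot.
From mathcomp Require Import zify.

Set Implicit Arguments.
Unset Strict Implicit.
Unset Printing Implicit Defensive.

(** The instance uses a fixed layout: a star (u, v) keeps the number [cell u v] of its matrix cell,
    and both sides have n^2 + 2 vertices. An index that carries no star on its side gets a single
    edge, to a dummy vertex n^2 of the other side; the index n^2 + 1 never carries a star, so its
    edges also cover the dummies. These pendant edges lie in every cover and add a constant to its
    size, and a redundant edge that serves one star only becomes an edge to the dummy. Several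
    redundant edges may give the same edge of the instance; recording any one of them is enough,
    because they serve the same stars. The record is a table over pairs of instance vertices, whose
    roughly n^4 addresses determine the word size.

    Reversals are deleted while a list of 3n edges is traversed, and listed edges may vanish on the
    way. An invariant on the deleted edges makes up for this, and the search is repeated on the
    digraph that remains, since the necessary edges are found only in a list forming an SCSS of
    it. *)

Definition loopless n (E : digraph n) := forall u, ~~ edge_rel E u u.

(** * Short cycles and return paths *)

Section ShortCycles.

Variables (n : nat) (E : digraph n).
Hypothesis short : cycles_at_most 3 E.
Hypothesis noloop : loopless E.

Local Notation "u --> v" := (edge_rel E u v) (at level 70).

Lemma edge_neq u v : u --> v -> u != v.
Proof. by move=> uv; apply: contraTneq uv => ->; apply: noloop. Qed.

Lemma no_long_cycle p :
  3 < size p -> uniq p -> cycle (edge_rel E) p -> False.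
Proof.
move=> lp up cp; have : size p <= 3 by apply: short; rewrite /ucycle cp.
by rewrite leqNgt lp.
Qed.

(** Only non-consecutive vertices have to be assumed distinct: consecutive ones differ because there
    are no loops. The versions for five and six vertices follow the same convention. *)
Lemma no_cycle4 a b c d :
  a --> b -> b --> c -> c --> d -> d --> a -> a != c -> b != d -> False.
Proof.
move=> ab bc cd da ac bd.
apply: (@no_long_cycle [:: a; b; c; d]) => //=; last by rewrite ab bc cd da.
rewrite !inE !negb_or ac bd (edge_neq ab) (edge_neq bc) (edge_neq cd).
by rewrite [a == d]eq_sym (edge_neq da).
Qed.

Lemma no_cycle5 a b c d e :
  a --> b -> b --> c -> c --> d -> d --> e -> e --> a ->
  a != c -> a != d -> b != d -> b != e -> c != e -> False.
Proof.
move=> ab bc cd de ea ac ad bd be ce.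
apply: (@no_long_cycle [:: a; b; c; d; e]) => //=; last by rewrite ab bc cd de ea.
rewrite !inE !negb_or ac ad bd be ce (edge_neq ab) (edge_neq bc) (edge_neq cd).
by rewrite (edge_neq de) [a == e]eq_sym (edge_neq ea).
Qed.

Lemma no_cycle6 a b c d e f :
  a --> b -> b --> c -> c --> d -> d --> e -> e --> f -> f --> a ->
  a != c -> a != d -> a != e -> b != d -> b != e -> b != f ->
  c != e -> c != f -> d != f -> False.
Proof.
move=> ab bc cd de ef fa ac ad ae bd be bf ce cf df.
apply: (@no_long_cycle [:: a; b; c; d; e; f]) => //=; last first.
  by rewrite ab bc cd de ef fa.
rewrite !inE !negb_or ac ad ae bd be bf ce cf df.
rewrite (edge_neq ab) (edge_neq bc) (edge_neq cd) (edge_neq de) (edge_neq ef).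
by rewrite [a == f]eq_sym (edge_neq fa).
Qed.

(** A simple path from [y] to [x] closes up with the edge (x, y) to a cycle of [E], so it has at
    most two edges. *)
Lemma return_path (S : digraph n) x y :
  S \subset E -> x --> y -> connect (edge_rel S) y x ->
  edge_rel S y x \/
  exists q, [/\ edge_rel S y q, edge_rel S q x, q != x & q != y].
Proof.
move=> SE xy /connectP[p0 p0P x_def].
have [p [pP up last_p]] : exists p, [/\ path (edge_rel S) y p, uniq (y :: p)
    & x = last y p].
  by rewrite x_def; case/shortenP: p0P => p pP up _; exists p.
have sub : subrel (edge_rel S) (edge_rel E) by move=> u v /(subsetP SE).
have szp : size (y :: p) <= 3.
  apply: short; rewrite /ucycle up andbT /= rcons_path (sub_path sub pP) /=.
  by rewrite -last_p.
case: p pP up last_p szp => [|a [|b [|? ?]]] //=.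

- by move=> _ _ xE; move: (edge_neq xy); rewrite xE eqxx.
- by rewrite andbT => ya _ -> _; left.
rewrite !inE !negb_or andbT => /andP[ya ab] /and3P[/andP[Nya _] Nab _] -> _.
by right; exists a; rewrite Nab eq_sym Nya.
Qed.

End ShortCycles.

Lemma sc_sub_edges n (S S' : digraph n) :
  strongly_connected S ->
  (forall u v, edge_rel S u v -> connect (edge_rel S') u v) ->
  strongly_connected S'.
Proof.
by move=> scS sub u v; apply: (connect_sub (e := edge_rel S)) => //; apply: scS.
Qed.

(** * Removing reversed triangle edges *)

Definition rev_triangle n (x y z : 'I_n) : digraph n :=
  [set (y, x); (z, y); (x, z)].

Definition triangle_set n (x y z : 'I_n) : digraph n :=
  [set (x, y); (y, z); (z, x)].

Definition triangle n (E : digraph n) x y z :=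
  [&& edge_rel E x y, edge_rel E y z & edge_rel E z x].

Lemma triangle_rot n (E : digraph n) x y z :
  triangle E x y z -> triangle E y z x.
Proof. by case/and3P=> *; apply/and3P. Qed.

(** Exactly what minimum solutions need to carry back from [E'] to [E]; the case [S := E] shows that
    strong connectivity is inherited. *)
Definition reduces n (E E' : digraph n) :=
  E' \subset E /\ forall S, scss E S -> exists2 S', scss E' S' & #|S'| <= #|S|.

Lemma reduces_refl n (E : digraph n) : reduces E E.
Proof. by split=> // S SE; exists S. Qed.

Lemma reduces_trans n (E1 E2 E3 : digraph n) :
  reduces E1 E2 -> reduces E2 E3 -> reduces E1 E3.
Proof.
case=> s12 r12 [s23 r23]; split=> [|S /r12[S2 /r23[S3 S3P le32] le21]].
  exact: subset_trans s23 s12.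
by exists S3 => //; apply: leq_trans le21.
Qed.

Lemma reduces_min n (E E' S : digraph n) :
  reduces E E' -> min_scss E' S -> min_scss E S.
Proof.
case=> sub red [[SE scS] minS]; split; first by split; first exact: subset_trans sub.
by move=> S' /red[S2 /minS le1 le2]; apply: leq_trans le2.
Qed.

Lemma reduces_sc n (E E' : digraph n) :
  strongly_connected E -> reduces E E' -> strongly_connected E'.
Proof.
move=> scE [_ /(_ E) []]; first by split.
move=> S' [sub scS] _; apply: sc_sub_edges scS _ => u v uv.
exact/connect1/(subsetP sub).
Qed.

Lemma cycles_at_most_sub n k (E E' : digraph n) :
  E' \subset E -> cycles_at_most k E -> cycles_at_most k E'.
Proof.
move=> sub cE p /andP[cp up]; apply: cE; rewrite /ucycle up andbT.
by apply: sub_cycle cp => u v /(subsetP sub).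
Qed.

Lemma loopless_sub n (E E' : digraph n) :
  E' \subset E -> loopless E -> loopless E'.
Proof. by move=> sub l u; apply: contra (l u); apply: (subsetP sub). Qed.

Lemma reduces_noloop n (E : digraph n) : reduces E (E :\: [set e | e.1 == e.2]).
Proof.
split=> [|S [SE scS]]; first exact: subsetDl.
exists (S :\: [set e | e.1 == e.2]); last by rewrite subset_leq_card ?subsetDl.
split; first exact: setSD.
apply: sc_sub_edges scS _ => u v uv; have [->//|Nuv] := eqVneq u v.
by apply: connect1; rewrite /edge_rel !inE Nuv.
Qed.

Section RevTriangle.

Variables (n : nat) (E : digraph n).
Hypothesis short : cycles_at_most 3 E.
Hypothesis noloop : loopless E.

(** A single missing triangle edge is paid for by (x, z). If two or more are missing, the return
    paths in [S] have to run backwards around the triangle, since any other route closes a cycle of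
    length four or five; then [S] contains all three reversals. *)
Lemma rev_edge_swap (S : digraph n) x y z :
  scss E S -> triangle E x y z -> edge_rel S x z ->
  #|triangle_set x y z :\: S| <= #|rev_triangle x y z :&: S|.
Proof.
move=> [SE scS] /and3P[xy yz zx] Sxz.
have sub u v : edge_rel S u v -> edge_rel E u v by apply: (subsetP SE).
have neq u v : edge_rel E u v -> u != v by apply: edge_neq.
have [Nxy Nyz Nzx] := And3 (neq _ _ xy) (neq _ _ yz) (neq _ _ zx).
have n4 := no_cycle4 short noloop.
have all_rev : edge_rel S y x -> edge_rel S z y ->
    #|triangle_set x y z :\: S| <= #|rev_triangle x y z :&: S|.
  rewrite /edge_rel in Sxz * => Syx Szy.
  suff -> : rev_triangle x y z :&: S = rev_triangle x y z.
    apply: leq_trans (subset_leq_card (subsetDl _ _)) _.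
    have -> : rev_triangle x y z = [set (e.2, e.1) | e in triangle_set x y z].
      by rewrite !imsetU !imset_set1.
    by rewrite card_imset // => -[a b] [c d] [-> ->].
  by apply/setIidPl/subsetP=> e; rewrite !inE => /orP[/orP[]|] /eqP->.
have small : #|triangle_set x y z :\: S| <= 1 ->
    #|triangle_set x y z :\: S| <= #|rev_triangle x y z :&: S|.
  move=> /leq_trans; apply; rewrite card_gt0; apply/set0Pn; exists (x, z).
  by rewrite !inE eqxx orbT.
have one e : triangle_set x y z :\: S \subset [set e] ->
    #|triangle_set x y z :\: S| <= 1.
  by move=> /subset_leq_card; rewrite cards1.
(* Without (z, x), the return path of (x, z) must pass through [y], or it closes a four-cycle with x
   -> y -> z. *)
have [Szx|Szx] := boolP (edge_rel S z x); last first.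
  have [|[q [Szq Sqx Nqx Nqz]]] := return_path short noloop SE (sub _ _ Sxz) (scS z x).
    by rewrite (negPf Szx).
  have [qy|Nqy] := eqVneq q y; first by apply: all_rev; rewrite -qy.
  by case: (n4 _ _ _ _ xy yz (sub _ _ Szq) (sub _ _ Sqx)); rewrite ?Nzx // eq_sym.
have [Sxy|Sxy] := boolP (edge_rel S x y).
  apply/small/(one (y, z))/subsetP=> e; rewrite /edge_rel !inE in Szx Sxy *.
  by case/andP=> /negP NeS /orP[/orP[]|] /eqP eE; move: NeS; rewrite eE ?eqxx // ?Szx ?Sxy.
have [Syz|Syz] := boolP (edge_rel S y z).
  apply/small/(one (x, y))/subsetP=> e; rewrite /edge_rel !inE in Szx Syz *.
  by case/andP=> /negP NeS /orP[/orP[]|] /eqP eE; move: NeS; rewrite eE ?eqxx // ?Szx ?Syz.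
have xz := sub _ _ Sxz.
case: (return_path short noloop SE xy (scS y x)) => [Syx|[g [Syg Sgx Ngx Ngy]]].
  case: (return_path short noloop SE yz (scS z y)) => [Szy|[f [Szf Sfy Nfy Nfz]]].
    exact: all_rev.
  have Nfx : f != x by apply: contraNneq Sxy => <-.
  by case: (n4 _ _ _ _ xz (sub _ _ Szf) (sub _ _ Sfy) (sub _ _ Syx)); rewrite // eq_sym.
have Ngz : g != z by apply: contraNneq Syz => <-.
case: (return_path short noloop SE yz (scS z y)) => [Szy|[f [Szf Sfy Nfy Nfz]]].
  by case: (n4 _ _ _ _ xz (sub _ _ Szy) (sub _ _ Syg) (sub _ _ Sgx)); rewrite // eq_sym.
have Nfx : f != x by apply: contraNneq Sxy => <-.
have [fg|Nfg] := eqVneq f g.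
  subst g; case: (n4 _ _ _ _ xy yz (sub _ _ Szf) (sub _ _ Sgx)); rewrite // eq_sym //.
case: (no_cycle5 short noloop xz (sub _ _ Szf) (sub _ _ Sfy) (sub _ _ Syg) (sub _ _ Sgx));
  by rewrite // eq_sym.
Qed.

(** All reversals in [S] are exchanged for the whole triangle, in which the reversal of one edge is
    replaced by the path along the other two. *)
Lemma reduces_rev x y z :
  triangle E x y z -> reduces E (E :\: rev_triangle x y z).
Proof.
move=> T; split=> [|S scS]; first exact: subsetDl.
have [xy yz zx] := and3P T.
have [NSr|[e]] := set_0Vmem (rev_triangle x y z :&: S).
  exists S => //; case: scS => SE scS; split=> //.
  by rewrite subsetD SE -setI_eq0 setIC NSr eqxx.
rewrite inE => /andP[e_rev eS].
have le : #|triangle_set x y z :\: S| <= #|rev_triangle x y z :&: S|.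
  (* The triangle is rotated until the reversal known to be in [S] is the one that [rev_edge_swap]
     expects. *)
  move: e_rev eS; rewrite !inE => /orP[/orP[]|] /eqP-> eS.
  - have -> : triangle_set x y z = triangle_set y z x.
      by apply/setP=> f; rewrite !inE -orbA orbC.
    have -> : rev_triangle x y z = rev_triangle y z x.
      by apply/setP=> f; rewrite !inE -orbA orbC.
    exact: rev_edge_swap scS (triangle_rot T) eS.
  - have -> : triangle_set x y z = triangle_set z x y.
      by apply/setP=> f; rewrite !inE orbC orbA.
    have -> : rev_triangle x y z = rev_triangle z x y.
      by apply/setP=> f; rewrite !inE orbC orbA.
    exact: rev_edge_swap scS (triangle_rot (triangle_rot T)) eS.
  - exact: rev_edge_swap scS T eS.
case: scS => SE scS.
have neq u v : edge_rel E u v -> u != v by apply: edge_neq.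
have [Nxy Nyz Nzx] := And3 (neq _ _ xy) (neq _ _ yz) (neq _ _ zx).
have TR : [disjoint triangle_set x y z & rev_triangle x y z].
  rewrite -setI_eq0; apply/eqP/setP=> f; rewrite !inE.
  have [Nyx Nzy Nxz] : [/\ y != x, z != y & x != z] by split; rewrite eq_sym.
  apply/negP=> /andP[/orP[/orP[]|] /eqP->]; rewrite !xpair_eqE;
    by rewrite ?(negPf Nxy) ?(negPf Nyz) ?(negPf Nzx) ?(negPf Nyx) ?(negPf Nzy) ?(negPf Nxz) ?andbF.
exists ((S :\: rev_triangle x y z) :|: triangle_set x y z).
  split.
    apply/subsetP=> f; rewrite in_setU in_setD => /orP[/andP[Nf fS]|fT].
      by rewrite in_setD Nf (subsetP SE).
    rewrite in_setD (disjointFr TR fT) /=.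
    by move: fT; rewrite !inE => /orP[/orP[]|] /eqP->.
  apply: sc_sub_edges scS _ => u v uv.
  set S' := _ :|: _.
  have S'T a b : (a, b) \in triangle_set x y z -> connect (edge_rel S') a b.
    by move=> h; apply: connect1; rewrite /edge_rel inE h orbT.
  have [r|Nr] := boolP ((u, v) \in rev_triangle x y z); last first.
    by apply: connect1; rewrite /edge_rel in_setU in_setD Nr (uv : _ \in S).
  move: r; rewrite !inE -!orbA => /or3P[] /eqP[-> ->].
  - by apply: (connect_trans (S'T y z _) (S'T z x _)); rewrite !inE eqxx ?orbT.
  - by apply: (connect_trans (S'T z x _) (S'T x y _)); rewrite !inE eqxx ?orbT.
  - by apply: (connect_trans (S'T x y _) (S'T y z _)); rewrite !inE eqxx ?orbT.
apply: (@leq_trans #|(S :\: rev_triangle x y z) :|: (triangle_set x y z :\: S)|).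
  apply/subset_leq_card/subsetP=> f; rewrite in_setU => /orP[fSR|fT].
    by rewrite in_setU fSR.
  by rewrite in_setU !in_setD fT (disjointFr TR fT) /= andbT orbN.
apply: leq_trans (leq_card_setU _ _) _.
by rewrite -(cardsID (rev_triangle x y z) S) addnC setIC leq_add2r.
Qed.

End RevTriangle.

(** Rotating the triangle extends this to all three reversals. *)
Definition chordless n (E : digraph n) :=
  forall x y z, triangle E x y z -> ~~ edge_rel E y x.

(** This invariant replaces the history of the deletions: a missing edge is a reversal in some
    triangle of the original digraph, and the other two reversals of that triangle are gone as
    well. *)
Definition deleted_in_triangle n (E E' : digraph n) :=
  forall u v, edge_rel E u v -> ~~ edge_rel E' u v ->
  exists z, [/\ triangle E v u z, ~~ edge_rel E' z u & ~~ edge_rel E' v z].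

Lemma deleted_in_triangle_rev n (E E' : digraph n) x y z :
  E' \subset E -> deleted_in_triangle E E' -> triangle E' x y z ->
  deleted_in_triangle E (E' :\: rev_triangle x y z).
Proof.
move=> sub del T u v uv; rewrite {1}/edge_rel in_setD negb_and negbK.
have sub' a b : edge_rel E' a b -> edge_rel E a b by apply: (subsetP sub).
have TE : triangle E x y z by case/and3P: T => *; rewrite /triangle !sub'.
have rev a b c : triangle E' a b c -> rev_triangle a b c = rev_triangle x y z ->
    triangle E a b c ->
    exists c', [/\ triangle E a b c', ~~ edge_rel (E' :\: rev_triangle x y z) c' b
                 & ~~ edge_rel (E' :\: rev_triangle x y z) a c'].
  by move=> _ <- Tabc; exists c; rewrite Tabc /edge_rel !inE !eqxx !orbT.
have [r|Nr /= Nuv] := boolP ((u, v) \in rev_triangle x y z).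
  move=> _; move: r; rewrite !inE -!orbA => /or3P[] /eqP[-> ->].
  - exact: rev T (erefl _) TE.
  - apply: rev (triangle_rot T) _ (triangle_rot TE).
    by apply/setP=> f; rewrite !inE orbC orbA.
  - apply: rev (triangle_rot (triangle_rot T)) _ (triangle_rot (triangle_rot TE)).
    by apply/setP=> f; rewrite !inE -orbA orbC.
have [c [Tc Ncu Nvc]] := del u v uv Nuv.
by exists c; rewrite Tc /edge_rel !in_setD (negPf (Ncu : _ \notin _))
  (negPf (Nvc : _ \notin _)) !andbF.
Qed.

(** Only triangles through edges of [L] have been treated, and such edges may have been deleted, so
    [L] lies in [E] but perhaps not in [E']. Take an untreated triangle a -> c -> b -> a with chord
    (c, a). The return path of the chord in [L] is a -> b -> c. If both its edges survive, a -> b ->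
    c -> a is a treated triangle that still has the reversal (c, b); if one was deleted, the
    triangle witnessing the deletion gives a four-cycle. *)
Lemma chordless_after_deletion n (E L E' : digraph n) :
  cycles_at_most 3 E -> loopless E -> E' \subset E ->
  L \subset E -> strongly_connected L -> deleted_in_triangle E E' ->
  (forall x y z, edge_rel L x y -> triangle E' x y z ->
     [disjoint E' & rev_triangle x y z]) ->
  chordless E'.
Proof.
move=> short noloop sub subL scL del proc a c b T; apply/negP=> ca.
have sub' u v : edge_rel E' u v -> edge_rel E u v by apply: (subsetP sub).
have subL' u v : edge_rel L u v -> edge_rel E u v by apply: (subsetP subL).
have n4 := no_cycle4 short noloop.
have neq u v : edge_rel E u v -> u != v by apply: edge_neq.
have procF x y z u v : edge_rel L x y -> triangle E' x y z ->
    (u, v) \in rev_triangle x y z -> edge_rel E' u v -> False.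
  by move=> Lxy Txyz r uv; move: (disjointFr (proc _ _ _ Lxy Txyz) uv); rewrite r.
have [ac cb ba] := and3P T.
case: (return_path short noloop subL (sub' _ _ ca) (scL a c)) => [Lac|].
  by apply: (procF _ _ _ _ _ Lac T _ ca); rewrite !inE eqxx.
case=> q [Laq Lqc Nqc Nqa]; have [qb|Nqb] := eqVneq q b; last first.
  apply: (n4 _ _ _ _ (sub' _ _ cb) (sub' _ _ ba) (subL' _ _ Laq) (subL' _ _ Lqc)).
    by rewrite neq ?sub'.
  by rewrite eq_sym.
subst q; have [ab bc] := (subL' _ _ Laq, subL' _ _ Lqc).
have [E'ab|Nab] := boolP (edge_rel E' a b); last first.
  have [d [/and3P[Eba Ead Edb] Nda Nbd]] := del _ _ ab Nab.
  have [dc|Ndc] := eqVneq d c; first by rewrite dc ca in Nda.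
  apply: (n4 _ _ _ _ bc (sub' _ _ ca) Ead Edb); first by rewrite eq_sym neq.
  by rewrite eq_sym.
have [E'bc|Nbc] := boolP (edge_rel E' b c); last first.
  have [d [/and3P[Ecb Ebd Edc] Ndb Ncd]] := del _ _ bc Nbc.
  have [da|Nda] := eqVneq d a; first by rewrite da ca in Ncd.
  apply: (n4 _ _ _ _ (sub' _ _ ca) ab Ebd Edc); first by rewrite neq ?sub'.
  by rewrite eq_sym.
apply: (procF _ _ c _ _ Laq _ _ cb); first by rewrite /triangle E'ab E'bc ca.
by rewrite !inE eqxx orbT.
Qed.

(** * Necessary and redundant edges *)

Definition detour n (E : digraph n) a b c :=
  [exists q, [&& edge_rel E a q, edge_rel E q b & q != c]].

(* In a digraph with [chordless E] this means that u -> f -> z -> g -> v is a path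
   avoiding (u, v); every path from u to v avoiding the edge has this shape. *)
Definition redundant n (E : digraph n) u v :=
  edge_rel E u v &&
  [exists z, [&& edge_rel E v z, edge_rel E z u, detour E u z v & detour E z v u]].

Definition necessary n (E : digraph n) : digraph n :=
  [set e in E | ~~ redundant E e.1 e.2].

(* The necessary edges that need a redundant edge on their return path. *)
Definition star n (E : digraph n) u v :=
  let N := edge_rel (necessary E) in
  [&& N u v, ~~ edge_rel E v u & ~~ [exists q, N v q && N q u]].

(** For a redundant edge the existential evaluates the sum at the third vertex of its triangle,
    which is unique by [redundant_unique]. *)
Definition weight n (E : digraph n) u v :=
  if edge_rel (necessary E) u v then star E u v
  else [exists z, [&& edge_rel E v z, edge_rel E z u & star E v z (+) star E z u]].

Section Chordless.

Variables (n : nat) (E : digraph n).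
Hypothesis short : cycles_at_most 3 E.
Hypothesis noloop : loopless E.
Hypothesis nochord : chordless E.

Local Notation "u --> v" := (edge_rel E u v) (at level 70).
Local Notation N := (necessary E).

Let neq u v : u --> v -> u != v. Proof. exact: edge_neq. Qed.

Local Ltac distinct :=
  first [done | by rewrite eq_sym | by rewrite neq | by rewrite eq_sym neq].

Lemma necessaryE u v : edge_rel N u v = (u --> v) && ~~ redundant E u v.
Proof. by rewrite /edge_rel inE. Qed.

Lemma necessary_sub : N \subset E.
Proof. by apply/subsetP=> e; rewrite inE => /andP[]. Qed.

Lemma necessary_or_redundant u v : u --> v -> ~~ edge_rel N u v -> redundant E u v.
Proof. by move=> uv; rewrite necessaryE uv negbK. Qed.

(** A second third vertex [w] would close the two detours to the six-cycle u -> f -> z0 -> g -> v ->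
    w -> u. If [f], [g] and [w] are not distinct, some triangle has a chord. *)
Lemma redundant_unique u v z z' :
  redundant E u v -> v --> z -> z --> u -> v --> z' -> z' --> u -> z = z'.
Proof.
case/andP=> uv /existsP[z0 /and4P[vz0 z0u /existsP[f /and3P[uf fz0 Nfv]]]].
case/existsP=> g /and3P[z0g gv Ngu].
suff eq0 w : v --> w -> w --> u -> z0 = w.
  by move=> vz zu vz' z'u; rewrite -(eq0 z) // -(eq0 z').
move=> vw wu; apply/eqP/negPn/negP=> Nz0w.
have [fw|Nfw] := eqVneq f w.
  have /nochord/negP[] : triangle E u f z0 by apply/and3P.
  by rewrite fw.
have [gw|Ngw] := eqVneq g w.
  have /nochord/negP[] : triangle E g v z0 by apply/and3P.
  by rewrite gw.
have [fg|Nfg] := eqVneq f g.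
  have /nochord/negP[] : triangle E f z0 u by apply/and3P.
  by rewrite fg.
have Nuz0 : u != z0 by rewrite eq_sym neq.
have Nz0v : z0 != v by rewrite eq_sym neq.
by apply: (no_cycle6 short noloop uf fz0 z0g gv vw wu); distinct.
Qed.

(** The detours of two redundant edges run against all three edges of the triangle and form c -> g
    -> b -> f -> a -> h -> c. This is a six-cycle, or a coincidence among [f], [g], [h] leaves a
    four-cycle. *)
Lemma redundant_triangle a b c :
  triangle E a b c -> redundant E a b -> ~~ redundant E b c.
Proof.
case/and3P=> ab bc ca red1; apply/negP=> red2.
have n4 := no_cycle4 short noloop.
have [_ /existsP[z /and4P[bz za _ /existsP[g /and3P[zg gb Nga]]]]] := andP red1.
have zc := redundant_unique red1 bz za bc ca; subst z.
have [_ /existsP[z /and4P[cz zb]]] := andP red2.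
have {zb cz} -> := redundant_unique red2 cz zb ca ab.
case/existsP=> f /and3P[bf fa Nfc] /existsP[h /and3P[ah hc Nhb]].
have [gf|Ngf] := eqVneq g f.
  by subst g; apply: (n4 _ _ _ _ ab bc zg fa); distinct.
have [hg|Nhg] := eqVneq h g.
  by subst h; apply: (n4 _ _ _ _ ah gb bc ca); distinct.
have [hf|Nhf] := eqVneq h f.
  by subst h; apply: (n4 _ _ _ _ ab bf hc ca); distinct.
by apply: (no_cycle6 short noloop zg gb bf fa ah hc); distinct.
Qed.

Lemma redundant_return u v :
  redundant E u v -> exists z, edge_rel N v z && edge_rel N z u.
Proof.
move=> red; have [uv /existsP[z /and4P[vz zu _ _]]] := andP red.
have T : triangle E u v z by apply/and3P.
exists z; rewrite !necessaryE vz zu (redundant_triangle T red).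
by apply/negP=> /(redundant_triangle (triangle_rot (triangle_rot T)))/negP.
Qed.

(** The triangle of a redundant edge (u, v) would have the chord (v, u). *)
Lemma necessary_2cycle u v : u --> v -> v --> u -> edge_rel N u v.
Proof.
move=> uv vu; rewrite necessaryE uv; apply/negP.
case/andP=> _ /existsP[z /and4P[vz zu _ _]].
by have /nochord/negP[] : triangle E u v z by apply/and3P.
Qed.

Lemma simple_cycle_le3 (p : seq 'I_n) u :
  path (edge_rel E) u p -> uniq (u :: p) -> last u p --> u -> size p <= 2.
Proof.
move=> pP up lu; rewrite -ltnS -[(size p).+1]/(size (u :: p)).
by apply: short; rewrite /ucycle up andbT /= rcons_path pP.
Qed.

(** If [S] omits (u, v), take a simple path from [u] to [v] in [S]. A return edge (v, u) would make
    it a triangle with a chord. A return path v -> z -> u must meet it in [z], or both together form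
    a cycle of at least four edges. Each half of the path then has exactly two edges: more would
    close a long cycle, and a single edge would be a chord. This is the shape that [redundant] asks
    for. *)
Lemma necessary_scss (S : digraph n) u v : scss E S -> edge_rel N u v -> edge_rel S u v.
Proof.
move=> [SE scS]; rewrite necessaryE => /andP[uv]; apply: contraNT => Suv.
have sub : subrel (edge_rel S) (edge_rel E) by move=> x y; apply: (subsetP SE).
have [p [pP up v_last]] : exists p,
    [/\ path (edge_rel S) u p, uniq (u :: p) & v = last u p].
  have /connectP[p0 p0P ->] := scS u v.
  by case/shortenP: p0P => p pP up _; exists p.
have pE := sub_path sub pP.
case: (return_path short noloop SE uv (scS v u))
    => [/sub vu|[z [/sub vz /sub zu Nzu Nzv]]].
  have := simple_cycle_le3 pE up; rewrite -v_last => /(_ vu).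
  case: p pP up v_last pE => [|a [|b [|? ?]]] //=.
  - by move=> _ _ vu'; move: (neq uv); rewrite vu' eqxx.
  - by move=> /andP[Sua _] _ va; rewrite -va (negPf Suv) in Sua.
  move=> _ _ vb /and3P[ua ab _] _; subst b.
  by have /nochord/negP[] : triangle E v u a by apply/and3P.
have [zp|Nzp] := boolP (z \in p); last first.
  have := @simple_cycle_le3 (rcons p z) u.
  rewrite rcons_path pE -v_last vz last_rcons zu -rcons_cons rcons_uniq up andbT.
  rewrite inE negb_or Nzu Nzp size_rcons => /(_ isT isT isT).
  case: p pP up v_last pE Nzp => [|a [|? ?]] //= => [_ _ vu|/andP[ua _] _ va].
    by move: (neq uv); rewrite vu eqxx.
  by rewrite -va (negPf Suv) in ua.
rewrite /redundant uv; apply/existsP; exists z; rewrite vz zu /=.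
case/splitPr: zp pP pE up v_last => p1 p2 _.
rewrite cat_path last_cat /= => /and3P[p1E lz p2E].
rewrite mem_cat inE !negb_or cat_uniq /= !negb_or.
case/andP=> /and3P[Nup1 Nuz Nup2] /and4P[up1 /andP[Nzp1 p1p2] Nzp2 up2] v_last.
have vp2 : v \in p2.
  by have := mem_last z p2; rewrite -v_last inE eq_sym (negPf Nzv).
apply/andP; split.
  have := @simple_cycle_le3 (rcons p1 z) u.
  rewrite rcons_path p1E lz last_rcons zu -rcons_cons rcons_uniq /= inE negb_or.
  rewrite Nzu Nzp1 Nup1 up1 size_rcons => /(_ isT isT isT).
  case: p1 p1E lz p1p2 {Nup1 up1 Nzp1} => [|f [|? ?]] //= => [_ uz _ _|/andP[uf _] fz].
    by have /nochord/negP[] : triangle E z u v by apply/and3P.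
  move=> p1p2 _; apply/existsP; exists f; rewrite uf fz.
  apply: contraNneq p1p2 => fv; apply/hasP; exists v => //.
  by rewrite fv inE.
have := @simple_cycle_le3 p2 z p2E; rewrite -v_last vz /= Nzp2 up2 => /(_ isT isT).
case: p2 p2E v_last Nup2 {Nzp2 up2 p1p2 vp2} => [|g [|h [|? ?]]] //=.
- by move=> _ vz'; rewrite vz' eqxx in Nzv.
- move=> /andP[zg _] vg; subst g.
  by have /nochord/negP[] : triangle E v z u by apply/and3P.
move=> /and3P[zg gh _] vh; rewrite inE negb_or eq_sym => /andP[Ngu _] _.
by apply/existsP; exists g; rewrite zg vh gh.
Qed.

(** * Stars and strong connectivity *)

(** The two edges of the return path are not both necessary by the definition of a star, and not
    both redundant by [redundant_triangle]. *)
Lemma star_return (S : digraph n) x y : scss E S -> star E x y ->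
  exists2 q, edge_rel S y q /\ edge_rel S q x &
    redundant E y q /\ edge_rel N q x \/ edge_rel N y q /\ redundant E q x.
Proof.
move=> [SE scS] /and3P[Nxy Nyx /existsPn Nq].
have sub u v : edge_rel S u v -> u --> v by apply: (subsetP SE).
have /andP[xy _] : (x --> y) && ~~ redundant E x y by rewrite -necessaryE.
case: (return_path short noloop SE xy (scS y x)) => [/sub|[q [yq qx _ _]]].
  by rewrite (negPf Nyx).
exists q => //; have T : triangle E y q x by rewrite /triangle xy (sub _ _ yq) (sub _ _ qx).
have [red|Nred] := boolP (redundant E y q); [left|right].
  by split=> //; rewrite necessaryE (sub _ _ qx) (redundant_triangle T red).
have Nyq : edge_rel N y q by rewrite necessaryE (sub _ _ yq).
split=> //; apply: necessary_or_redundant (sub _ _ qx) _.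
by move: (Nq q); rewrite Nyq.
Qed.

(** Under these hypotheses every necessary edge can be undone by a path in [S]. A redundant edge (u,
    v) is then simulated by undoing the two necessary edges of its return path v -> z -> u. *)
Lemma scss_of_star_return (S : digraph n) :
  S \subset E -> N \subset S -> strongly_connected E ->
  (forall x y, star E x y -> exists q, edge_rel S y q && edge_rel S q x) ->
  scss E S.
Proof.
move=> SE NS scE stS; split=> //.
have NSr u v : edge_rel N u v -> connect (edge_rel S) u v.
  by move=> uv; apply/connect1/(subsetP NS).
have ret u v : edge_rel N u v -> connect (edge_rel S) v u.
  move=> uv; have [st|] := boolP (star E u v).
    have [q /andP[vq qu]] := stS _ _ st.
    exact: connect_trans (connect1 vq) (connect1 qu).
  rewrite /star uv /= negb_and !negbK => /orP[vu|/existsP[q /andP[vq qu]]].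
    by apply/NSr/necessary_2cycle => //; apply: (subsetP necessary_sub).
  exact: connect_trans (NSr _ _ vq) (NSr _ _ qu).
apply: sc_sub_edges scE _ => u v uv; have [/NSr //|Nuv] := boolP (edge_rel N u v).
have [z /andP[vz zu]] := redundant_return (necessary_or_redundant uv Nuv).
exact: connect_trans (ret _ _ zu) (ret _ _ vz).
Qed.

End Chordless.

(** * The parity potential *)

Fixpoint walk_weight n (E : digraph n) x p :=
  if p is y :: q then weight E x y (+) walk_weight E y q else false.

Lemma walk_weight_cat n (E : digraph n) x p q :
  walk_weight E x (p ++ q) = walk_weight E x p (+) walk_weight E (last x p) q.
Proof. by elim: p x => //= y p IHp x; rewrite IHp addbA. Qed.

Section Potential.

Variables (n : nat) (E : digraph n).
Hypothesis short : cycles_at_most 3 E.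
Hypothesis noloop : loopless E.
Hypothesis nochord : chordless E.

Local Notation "u --> v" := (edge_rel E u v) (at level 70).
Local Notation N := (necessary E).

Lemma weight_redundant u v z :
  redundant E u v -> v --> z -> z --> u ->
  weight E u v = star E v z (+) star E z u.
Proof.
move=> red vz zu; rewrite /weight necessaryE red andbF.
apply/existsP/idP => [[z' /and3P[vz' z'u]]|st].
  by rewrite (redundant_unique short noloop nochord red vz' z'u vz zu).
by exists z; rewrite vz zu.
Qed.

Lemma weight_necessary u v : edge_rel N u v -> weight E u v = star E u v.
Proof. by rewrite /weight => ->. Qed.

(** A redundant edge cancels the weights of the other two by definition. If all three edges are
    necessary, each has a necessary return path and none is a star. *)
Lemma triangle_weight x y z : triangle E x y z ->
  weight E x y (+) (weight E y z (+) weight E z x) = false.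
Proof.
have redT a b c : triangle E a b c -> redundant E a b ->
    weight E a b (+) (weight E b c (+) weight E c a) = false.
  move=> T red; have [ab bc ca] := and3P T.
  have Nbc : edge_rel N b c.
    by rewrite necessaryE bc (redundant_triangle short noloop nochord T red).
  have Nca : edge_rel N c a.
    rewrite necessaryE ca; apply/negP=> red'.
    have := redundant_triangle short noloop nochord (triangle_rot (triangle_rot T)) red'.
    by rewrite red.
  by rewrite (weight_redundant red bc ca) !weight_necessary // addbb.
move=> T; have [xy yz zx] := and3P T.
have [/redT->//|Nxy] := boolP (redundant E x y).
have [/(redT _ _ _ (triangle_rot T))<-|Nyz] := boolP (redundant E y z).
  by rewrite addbC addbA.
have [/(redT _ _ _ (triangle_rot (triangle_rot T)))<-|Nzx] := boolP (redundant E z x).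
  by rewrite addbA addbC.
have {}Nxy : edge_rel N x y by rewrite necessaryE xy.
have {}Nyz : edge_rel N y z by rewrite necessaryE yz.
have {}Nzx : edge_rel N z x by rewrite necessaryE zx.
have st a b c : edge_rel N b c -> edge_rel N c a -> star E a b = false.
  move=> bc ca; apply/negP=> /and3P[_ _ /existsP[]].
  by exists c; rewrite bc.
by rewrite !weight_necessary // (st x y z) ?(st y z x) ?(st z x y).
Qed.

(** By strong induction on the length: a closed walk without repetition is a cycle of at most three
    edges, and any other splits at a repeated vertex into two shorter closed walks. *)
Lemma closed_walk_weight x p :
  path (edge_rel E) x p -> last x p = x -> walk_weight E x p = false.
Proof.
have [m le_pm] := ubnP (size p); elim: m => // m IHm in x p le_pm *.
move=> pE lp; have [up|/(uniqPn x)[i [j [ij jp eq_ij]]]] := boolP (uniq p).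
  have : ucycle (edge_rel E) p by rewrite /ucycle (cycle_path x) lp pE.
  move=> /short; case: p pE lp {up le_pm} => [|a [|b [|c [|? ?]]]] //=.
  - by move=> /andP[xa _] ax; move: (noloop x); rewrite ax in xa; rewrite xa.
  - case/and3P=> xa ab _ bx _; subst b.
    rewrite !weight_necessary ?necessary_2cycle //.
    by rewrite /star xa ab /= !andbF.
  case/and4P=> xa ab bc _ cx _; subst c; rewrite addbF.
  by apply: triangle_weight; apply/and3P.
have ip : i < size p by apply: ltn_trans jp.
have last_take k : k < size p -> last x (take k.+1 p) = nth x p k.
  move=> kp; rewrite (last_nth x) size_take_min (minn_idPl kp) /=.
  by rewrite nth_take.
(* [p2] is the closed walk between two visits to the repeated vertex, and [p1 ++ p3] is what
   remains. *)
set p1 := take i.+1 p; set p2 := take (j - i) (drop i.+1 p).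
set p3 := drop (j - i) (drop i.+1 p).
have pdef : p = p1 ++ p2 ++ p3 by rewrite !cat_take_drop.
have p12 : p1 ++ p2 = take j.+1 p by rewrite -takeD addSn subnKC // ltnW.
have l1 : last x p1 = nth x p i by apply: last_take.
have l2 : last (nth x p i) p2 = nth x p i.
  by rewrite -{1}l1 -last_cat p12 last_take.
have l3 : last (nth x p i) p3 = x.
  by rewrite -{2}lp [in RHS]pdef !last_cat l1 l2.
have [sz2 sz13] : size p2 < m /\ size (p1 ++ p3) < m.
  have sz1 : size p1 = i.+1 by rewrite /p1 size_take_min (minn_idPl ip).
  have szp : i.+1 + size p2 = j.+1.
    by rewrite -sz1 -size_cat p12 size_take_min (minn_idPl jp).
  have szp3 : size p = j.+1 + size p3
    by rewrite {1}pdef catA size_cat p12 size_take_min (minn_idPl jp).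
  rewrite ltnS in le_pm; rewrite size_cat sz1; split; apply: leq_trans le_pm; rewrite szp3 -szp.
    by rewrite -addnA addSn ltnS addnCA leq_addr.
  rewrite -addnA ltn_add2l -[X in X < _]add0n ltn_add2r.
  by rewrite -(ltn_add2l i.+1) addn0 szp ltnS.
move: pE; rewrite pdef !cat_path l1 l2 => /and3P[p1E p2E p3E].
rewrite !walk_weight_cat l1 l2 (IHm _ _ sz2 p2E l2) /=.
have := IHm x (p1 ++ p3) sz13; rewrite cat_path last_cat walk_weight_cat l1 p1E p3E.
exact.
Qed.

Definition is_potential (phi : 'I_n -> bool) :=
  forall x y, x --> y -> phi y = phi x (+) weight E x y.

(** The chosen walks need not be related: the walk to [x] extended by (x, y) and the walk to [y] are
    closed by one and the same path back to [r], and both closed walks have weight 0. *)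
Lemma walks_potential r phi : strongly_connected E ->
  (forall x, exists p, [/\ path (edge_rel E) r p, last r p = x
                         & walk_weight E r p = phi x]) ->
  is_potential phi.
Proof.
move=> scE walk x y xy.
have [p [pE lp <-]] := walk x; have [q [qE lq <-]] := walk y.
have /connectP[s sE ls] := scE y r.
have w1 : walk_weight E r (p ++ y :: s) = false.
  by apply: closed_walk_weight; rewrite ?cat_path ?last_cat /= ?pE ?lp ?xy.
have w2 : walk_weight E r (q ++ s) = false.
  by apply: closed_walk_weight; rewrite ?cat_path ?last_cat ?qE ?lq.
move: w1 w2; rewrite !walk_weight_cat lp lq /=.
by case: (walk_weight E r p); case: (walk_weight E r q); case: (weight E x y);
  case: (walk_weight E y s).
Qed.

End Potential.

(** * The edge cover instance *)

Definition cell n (u v : 'I_n) : nat := u * n + v.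

Lemma cell_inj n (u v u' v' : 'I_n) : cell u v = cell u' v' -> u = u' /\ v = v'.
Proof.
have n_gt0 : 0 < n by apply: leq_ltn_trans (ltn_ord u).
move=> eq_c; split; apply: ord_inj.
  have := congr1 (divn^~ n) eq_c.
  by rewrite /cell !divnMDl // !divn_small // !addn0.
by have := congr1 (modn^~ n) eq_c; rewrite /cell !modnMDl !modn_small.
Qed.

Lemma cell_lt n (u v : 'I_n) : cell u v < n * n.
Proof. by rewrite /cell; have := ltn_ord u; have := ltn_ord v; nia. Qed.

Lemma card_functional (A B : finType) (X : {set A}) (R : A -> B -> bool) :
  (forall a b b', R a b -> R a b' -> b = b') ->
  #|[set b | [exists a in X, R a b]]| <= #|X|.
Proof.
move=> funR; set Y := [set b | _].
have [->|[b0 _]] := set_0Vmem Y; first by rewrite cards0.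
pose h a := odflt b0 [pick b | R a b].
apply: leq_trans (leq_imset_card h X).
apply/subset_leq_card/subsetP=> b; rewrite inE => /existsP[a /andP[aX Rab]].
apply/imsetP; exists a => //; rewrite /h.
by case: pickP => [b' Rab'|/(_ b)]; [apply: funR Rab Rab' | rewrite Rab].
Qed.

Section Cover.

Variables (n : nat) (E : digraph n) (phi : 'I_n -> bool).

Local Notation "u --> v" := (edge_rel E u v) (at level 70).
Local Notation N := (necessary E).
Local Notation dummy := (n * n).
Local Notation K := (n * n + 2).

(* Left and right have the same index set: star (u, v) is vertex [cell u v] on
   the side given by [phi u], and its twin on the other side is unused. *)
Definition used (b : bool) (i : nat) :=
  [exists u, exists v, [&& i == cell u v, star E u v & phi u == b]].

Definition forced l r :=
  [|| [&& r == dummy, l != dummy & ~~ used false l]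
    | [&& l == dummy, r != dummy & ~~ used true r]].

(** The dummy stands for the missing second end of a redundant edge that serves a single star. *)
Definition slot u v := if star E u v then cell u v else dummy.

Definition orient (b : bool) (i j : nat) := if b then (j, i) else (i, j).

(* The redundant edge (u, v) is the edge c of the cover instance; c is computed
   from a star (x, y) served by (u, v), the two cases being z = x and z = y. *)
Definition joins (u v : 'I_n) (c : nat * nat) :=
  [exists x, exists y, exists q, [&& star E x y, triangle E x y q &
    if edge_rel N q x
    then ((u, v) == (y, q)) && (c == orient (phi x) (cell x y) (slot q x))
    else ((u, v) == (q, x)) && (c == orient (phi x) (cell x y) (slot y q))]].

Variable F : nat -> nat -> nat.

(** Values are shifted by one so that 0 means no edge; the value [dummy.+1] of a forced edge differs
    from every shifted cell. Where several redundant edges join the same pair, [F] keeps one of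
    them. *)
Definition encodes :=
  forall l r, l < K -> r < K ->
  [/\ 0 < F l r -> forced l r /\ F l r = dummy.+1 \/
                   exists u v, joins u v (l, r) /\ F l r = (cell u v).+1,
      forced l r -> 0 < F l r &
      forall u v, joins u v (l, r) -> 0 < F l r].

Definition cover_graph : bigraph :=
  @Bigraph K K [set e : 'I_K * 'I_K | 0 < F e.1 e.2].

Definition selected (C : {set 'I_K * 'I_K}) : digraph n :=
  N :|: [set e | [exists c in C, F c.1 c.2 == (cell e.1 e.2).+1]].

Hypothesis short : cycles_at_most 3 E.
Hypothesis noloop : loopless E.
Hypothesis nochord : chordless E.
Hypothesis scE : strongly_connected E.
Hypothesis pot : is_potential E phi.
Hypothesis encF : encodes.

Lemma star_necessary x y : star E x y -> edge_rel N x y.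
Proof. by case/and3P. Qed.

Lemma star_edge x y : star E x y -> x --> y.
Proof. by move/star_necessary/(subsetP (necessary_sub E)). Qed.

Lemma star_flip x y : star E x y -> phi y = ~~ phi x.
Proof.
move=> st; rewrite (pot (star_edge st)) weight_necessary ?st ?addbT //.
exact: star_necessary.
Qed.

Variant joins_spec (u v : 'I_n) (c : nat * nat) : Prop :=
  | JoinsHead x y q of star E x y & triangle E x y q & edge_rel N q x
      & u = y & v = q & c = orient (phi x) (cell x y) (slot q x)
  | JoinsTail x y q of star E x y & triangle E x y q & edge_rel N y q
      & u = q & v = x & c = orient (phi x) (cell x y) (slot y q).

Lemma joinsP u v c : joins u v c -> redundant E u v /\ joins_spec u v c.
Proof.
case/existsP=> x /existsP[y /existsP[q /and3P[st T]]].
have [xy yq qx] := and3P T; have Nxy := star_necessary st.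
have Nq : edge_rel N y q -> edge_rel N q x -> False.
  move=> Nyq Nqx; have /and3P[_ _ /existsP[]] := st.
  by exists q; rewrite Nyq.
case: ifPn => [Nqx|Nqx] /andP[/eqP[-> ->] /eqP cE].
  split; last exact: JoinsHead st T _ _ _ cE.
  by apply: necessary_or_redundant => //; apply/negP=> /Nq.
have red := necessary_or_redundant qx Nqx.
split=> //; apply: (JoinsTail st T _ _ _ cE) => //; rewrite necessaryE yq.
apply/negP=> red'; have := redundant_triangle short noloop nochord (triangle_rot T) red'.
by rewrite red.
Qed.

Lemma used_cell b x y : star E x y -> phi x = b -> used b (cell x y).
Proof.
by move=> st ph; apply/existsP; exists x; apply/existsP; exists y; rewrite eqxx st ph eqxx.
Qed.

(** This is where bipartiteness enters: consecutive stars have opposite values of [phi] by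
    [star_flip], so the second star belongs to the side opposite to the first. *)
Lemma joins_used u v l r : joins u v (l, r) ->
  [/\ (l == dummy) || used false l, (r == dummy) || used true r
    & (l != dummy) || (r != dummy)].
Proof.
have slot_used x y b : phi x = b -> (slot x y == dummy) || used b (slot x y).
  by rewrite /slot => ph; case: ifP => [/used_cell->|]; rewrite ?eqxx ?orbT.
have Nd (x y : 'I_n) : cell x y != dummy by rewrite neq_ltn cell_lt.
case/joinsP=> _ [] x y q st T.
  move=> _ _ _ [].
  have [sq|Nsq] := boolP (star E q x).
    have ph := star_flip sq.
    rewrite /orient; case phx: (phi x) => -[-> ->]; rewrite ?Nd ?orbT ?used_cell ?orbT //=.
    + by rewrite slot_used //; move: ph; rewrite phx; case: (phi q).
    + by rewrite slot_used //; move: ph; rewrite phx; case: (phi q).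
  rewrite /slot (negPf Nsq) /orient.
  by case phx: (phi x) => -[-> ->]; rewrite ?Nd ?eqxx ?used_cell ?orbT.
move=> _ _ _ [].
have ph := star_flip st.
rewrite /orient; case phx: (phi x) => -[-> ->]; rewrite phx in ph;
  by rewrite ?Nd ?orbT ?used_cell ?slot_used ?orbT.
Qed.

Lemma forced_joins u v l r : forced l r -> ~~ joins u v (l, r).
Proof.
move=> fo; apply/negP=> /joins_used[ul ur _].
by case/orP: fo => /and3P[_ Nd Nu]; move: ul ur; rewrite (negPf Nd) (negPf Nu).
Qed.

(** The pair can be computed from either of the stars served by (u, v); the change of [phi] along a
    star makes both computations give the same orientation. This allows one edge of a cover to be
    charged to one redundant edge. *)
Lemma joins_functional u v c c' : joins u v c -> joins u v c' -> c = c'.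
Proof.
case/joinsP=> red [] x y q st T Nq uE vE -> /joinsP[_ []] x' y' q' st' T' Nq' uE' vE' ->.
all: have [xy yq qx] := and3P T; have [xy' yq' qx'] := and3P T'; subst u v.
all: have uniq3 := redundant_unique short noloop nochord red.
- by subst y' q'; rewrite (uniq3 x x').
- subst q' x'; have xE : x = y' by apply: uniq3.
  subst y'; rewrite /slot st st' (star_flip st').
  by case: (phi _).
- subst y' q'; have xE : y = x' by apply: uniq3.
  subst x'; rewrite /slot st st' (star_flip st).
  by case: (phi _).
- by subst q' x'; rewrite (uniq3 y y').
Qed.

Lemma joins_star (S : digraph n) u v l r x y : N \subset S -> edge_rel S u v ->
  joins u v (l, r) -> star E x y -> l = cell x y \/ r = cell x y ->
  exists q, edge_rel S y q && edge_rel S q x.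
Proof.
move=> NS Suv jo st lr.
have NSr a b : edge_rel N a b -> edge_rel S a b by apply: (subsetP NS).
have Nd (a b : 'I_n) : cell a b != dummy by rewrite neq_ltn cell_lt.
have slotE a b i : slot a b = i -> i = cell x y -> a = x /\ b = y.
  rewrite /slot => <-; case: ifP => _; first exact: cell_inj.
  by move=> d; move: (Nd x y); rewrite -d eqxx.
have main a b c d : (l, r) = orient (phi a) (cell a b) (slot c d) ->
    (x = a /\ y = b) \/ (x = c /\ y = d).
  rewrite /orient; case: (phi a) => -[lE rE]; case: lr => e.
  - by right; have [-> ->] := slotE _ _ _ (esym lE) e.
  - by left; rewrite rE in e; have [-> ->] := cell_inj e.
  - by left; rewrite lE in e; have [-> ->] := cell_inj e.
  - by right; have [-> ->] := slotE _ _ _ (esym rE) e.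
have [_ []] := joinsP jo => a b q st' T Nq uE vE /main; subst u v;
  case=> -[xE yE]; subst x y.
- by exists q; rewrite Suv NSr.
- by exists b; rewrite Suv andbT NSr // star_necessary.
- by exists q; rewrite Suv andbT NSr.
- by exists a; rewrite Suv NSr // star_necessary.
Qed.

Lemma star_joins (S : digraph n) x y b : scss E S -> star E x y -> phi x = b ->
  exists u v i, [/\ (u, v) \in S :\: N, joins u v (orient b (cell x y) i) & i < K].
Proof.
move=> scS st ph; have slot_lt a c : slot a c < K.
  by rewrite /slot; have := cell_lt a c; case: ifP; lia.
have [q [yq qx] alt] := star_return short noloop nochord scS st.
have SE := subsetP scS.1.
have T : triangle E x y q by apply/and3P; split; [exact: star_edge|exact: SE|exact: SE].
case: alt => [[red Nqx]|[Nyq red]].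
  exists y, q, (slot q x); split=> //.
    by rewrite in_setD [_ \in N]necessaryE red andbF.
  apply/existsP; exists x; apply/existsP; exists y; apply/existsP; exists q.
  by rewrite st T Nqx ph !eqxx.
exists q, x, (slot y q); split=> //.
  by rewrite in_setD [_ \in N]necessaryE red andbF.
apply/existsP; exists x; apply/existsP; exists y; apply/existsP; exists q.
by rewrite st T (necessaryE E q x) red andbF ph !eqxx.
Qed.

Definition forced_set : {set 'I_K * 'I_K} := [set c : 'I_K * 'I_K | forced c.1 c.2].

Definition induced_cover (S : digraph n) : {set 'I_K * 'I_K} :=
  forced_set :|: [set c : 'I_K * 'I_K | [exists e in S :\: N, joins e.1 e.2 (val c.1, val c.2)]].

Lemma induced_cover_card S : #|induced_cover S| <= #|forced_set| + #|S :\: N|.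
Proof.
apply: leq_trans (leq_card_setU _ _) _; rewrite leq_add2l.
apply: (@card_functional _ _ _ (fun e c => joins e.1 e.2 (val c.1, val c.2))).
move=> e [c1 c2] [c1' c2'] /= j1 j2.
by have [/ord_inj-> /ord_inj->] := joins_functional j1 j2.
Qed.

Lemma induced_cover_cover S : scss E S -> edge_cover (H := cover_graph) (induced_cover S).
Proof.
move=> scS; split.
  apply/subsetP=> -[l r]; rewrite !inE /=.
  have [_ fo jo] := encF (ltn_ord l) (ltn_ord r).
  case/orP=> [/fo //|/existsP[[u v] /andP[_]]]; exact: jo.
have d_lt : dummy < K by lia.
have d1_lt : dummy.+1 < K by lia.
have d1_neq : (dummy.+1 == dummy) = false by apply/negbTE; rewrite neq_ltn ltnSn orbT.
have fo_d b : ~~ used b dummy.+1.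
  apply/negP=> /existsP[u /existsP[v /and3P[/eqP e _ _]]].
  by have := cell_lt u v; lia.
case=> i /=.
  have [/eqP iE|Nid] := boolP (val i == dummy).
    exists (i, Ordinal d1_lt); last by rewrite /incident /= eqxx.
    by rewrite !inE /forced /= iE eqxx fo_d d1_neq.
  have [us|Nus] := boolP (used false i); last first.
    exists (i, Ordinal d_lt); last by rewrite /incident /= eqxx.
    by rewrite !inE /forced /= eqxx Nid Nus.
  case/existsP: us => x /existsP[y /and3P[/eqP iE st /eqP ph]].
  have [u [v [j [uv jo j_lt]]]] := star_joins scS st ph.
  exists (i, Ordinal j_lt); last by rewrite /incident /= eqxx.
  rewrite in_setU [X in _ || X]inE; apply/orP; right; apply/existsP; exists (u, v).
  by rewrite uv /= iE.
have [/eqP iE|Nid] := boolP (val i == dummy).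
  exists (Ordinal d1_lt, i); last by rewrite /incident /= eqxx.
  by rewrite !inE /forced /= iE eqxx fo_d d1_neq.
have [us|Nus] := boolP (used true i); last first.
  exists (Ordinal d_lt, i); last by rewrite /incident /= eqxx.
  by rewrite !inE /forced /= eqxx Nid Nus orbT.
case/existsP: us => x /existsP[y /and3P[/eqP iE st /eqP ph]].
have [u [v [j [uv jo j_lt]]]] := star_joins scS st ph.
exists (Ordinal j_lt, i); last by rewrite /incident /= eqxx.
rewrite in_setU [X in _ || X]inE; apply/orP; right; apply/existsP; exists (u, v).
by rewrite uv /= iE.
Qed.

Lemma forced_sub_cover (C : {set 'I_K * 'I_K}) :
  edge_cover (H := cover_graph) C -> forced_set \subset C.
Proof.
case=> /subsetP CH covC; apply/subsetP=> -[l r]; rewrite inE /= => /orP[] /and3P[/eqP dE Nd Nu].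
  have [[l' r'] cC /= /eqP lE] := covC (inl l); subst l'.
  have := CH _ cC; rewrite [_ \in bedges _]inE /= => F0.
  have [/(_ F0) alt _ _] := encF (ltn_ord l) (ltn_ord r').
  case: alt => [[/orP[/and3P[/eqP rE _ _]|/and3P[lE _ _]] _]|[u [v [/joins_used[ul _ _] _]]]].
  - by rewrite (ord_inj (etrans dE (esym rE))).
  - by rewrite lE in Nd.
  - by rewrite (negPf Nd) (negPf Nu) in ul.
have [[l' r'] cC /= /eqP rE] := covC (inr r); subst r'.
have := CH _ cC; rewrite [_ \in bedges _]inE /= => F0.
have [/(_ F0) alt _ _] := encF (ltn_ord l') (ltn_ord r).
case: alt => [[/orP[/and3P[rE _ _]|/and3P[/eqP lE _ _]] _]|[u [v [/joins_used[_ ur _] _]]]].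
- by rewrite rE in Nd.
- by rewrite (ord_inj (etrans dE (esym lE))).
- by rewrite (negPf Nd) (negPf Nu) in ur.
Qed.

Lemma cover_value (C : {set 'I_K * 'I_K}) (c : 'I_K * 'I_K) (e : 'I_n * 'I_n) :
  C \subset bedges cover_graph -> c \in C ->
  F c.1 c.2 = (cell e.1 e.2).+1 -> joins e.1 e.2 (val c.1, val c.2).
Proof.
move=> /subsetP CH /CH; rewrite inE => F0 Fe.
have [/(_ F0) alt _ _] := encF (ltn_ord c.1) (ltn_ord c.2).
case: alt => [[_ Fd]|[u [v [jo Fuv]]]].
  by move: Fe; rewrite Fd => -[d]; have := cell_lt e.1 e.2; rewrite -d ltnn.
by move: Fe; rewrite Fuv => -[/cell_inj[<- <-]].
Qed.

Lemma selected_scss (C : {set 'I_K * 'I_K}) :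
  edge_cover (H := cover_graph) C -> scss E (selected C).
Proof.
move=> covC; have [CH inc] := covC.
apply: scss_of_star_return => //; last first.
- move=> x y st.
  (* The vertex of a star is looked up on the side given by [phi x]. It is used there, so the edge
     of [C] covering it is not forced and carries a redundant edge. *)
  have [c cC lr] : exists2 c, c \in C &
      val c.1 = cell x y /\ ~~ phi x \/ val c.2 = cell x y /\ phi x.
    have clt : cell x y < K by have := cell_lt x y; lia.
    case ph: (phi x).
      have [c cC /= /eqP e] := inc (inr (Ordinal clt)).
      by exists c => //; right; rewrite e.
    have [c cC /= /eqP e] := inc (inl (Ordinal clt)).
    by exists c => //; left; rewrite e.
  have := subsetP CH _ cC; rewrite [_ \in bedges _]inE => F0.
  have [/(_ F0) alt _ _] := encF (ltn_ord c.1) (ltn_ord c.2).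
  have Nd : cell x y != dummy by rewrite neq_ltn cell_lt.
  case: alt => [[fo _]|[u [v [jo Fuv]]]].
    case: lr => -[e ph]; case/orP: fo => /and3P[]; rewrite e ?(negPf Nd) // => _ _.
      by rewrite used_cell //; apply/negbTE.
    by rewrite used_cell.
  apply: (joins_star (subsetUl _ _) _ jo st).
    rewrite /edge_rel in_setU [X in _ || X]inE; apply/orP; right.
    by apply/existsP; exists c; rewrite cC Fuv eqxx.
  by case: lr => -[-> _]; [left|right].
- exact: subsetUl.
rewrite subUset necessary_sub; apply/subsetP=> e; rewrite inE.
case/existsP=> c /andP[cC /eqP/(cover_value CH cC)/joinsP[/andP[]]].
by case: e.
Qed.

(** The forced edges cancel: they lie in [C], so at most #|C| - #|forced_set| redundant edges are
    selected, while the cover induced by [S] has at most #|forced_set| + #|S :\: N| edges. *)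
Lemma selected_min (C : {set 'I_K * 'I_K}) :
  min_edge_cover (H := cover_graph) C -> min_scss E (selected C).
Proof.
case=> covC minC; split; first exact: selected_scss.
move=> S scS; have NS : N \subset S.
  by apply/subsetP=> -[u v]; apply: necessary_scss.
have [CH _] := covC.
have le1 : #|selected C| <= #|N| + #|C :\: forced_set|.
  apply: (@leq_trans #|N :|: [set e | [exists c in C :\: forced_set,
      F c.1 c.2 == (cell e.1 e.2).+1]]|).
    apply: subset_leq_card; apply: setUS; apply/subsetP=> e; rewrite !inE.
    case/existsP=> c /andP[cC Fe]; apply/existsP; exists c; rewrite in_setD cC Fe !andbT.
    rewrite inE; apply/negP=> /(forced_joins e.1 e.2)/negP[].
    exact: cover_value CH cC (eqP Fe).
  apply: leq_trans (leq_card_setU _ _) _; rewrite leq_add2l.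
  apply: (@card_functional _ _ _ (fun (c : 'I_K * 'I_K) (e : 'I_n * 'I_n) => F c.1 c.2 == (cell e.1 e.2).+1)).
  move=> c [u v] [u' v'] /eqP /= -> /eqP [/cell_inj[<- <-]] //.
have le2 : #|C| <= #|induced_cover S| := minC _ (induced_cover_cover scS).
have := cardsID forced_set C; rewrite (setIidPr (forced_sub_cover covC)).
have := cardsID N S; rewrite (setIidPr NS).
by have := induced_cover_card S; lia.
Qed.

Lemma cover_exists : exists C, edge_cover (H := cover_graph) C.
Proof.
exists (induced_cover E); apply: induced_cover_cover; split=> //.
Qed.

End Cover.

(** * A program logic with time bounds *)

Definition runs W c s T (Post : state -> Prop) :=
  exists t s', [/\ exec W c s t s', t <= T & Post s'].

Lemma runs_le W c s T T' (Post Post' : state -> Prop) :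
  runs W c s T Post -> (forall s', Post s' -> Post' s') -> T <= T' ->
  runs W c s T' Post'.
Proof.
move=> [t [s' [ex tT Ps']]] sub le; exists t, s'; split=> //; last exact: sub.
exact: leq_trans le.
Qed.

Lemma runs_skip W s (Post : state -> Prop) : Post s -> runs W Skip s 1 Post.
Proof. by exists 1, s; split=> //; constructor. Qed.

Lemma runs_assign W x e s (Post : state -> Prop) :
  value s e <= W -> Post (set_reg s x (value s e)) -> runs W (Assign x e) s 1 Post.
Proof. by move=> le Ps; exists 1, (set_reg s x (value s e)); split=> //; constructor. Qed.

Lemma runs_write W a y z s (Post : state -> Prop) :
  Post (set_cell s a (reg s y) (reg s z)) -> runs W (Write a y z) s 1 Post.
Proof. by move=> Ps; exists 1, (set_cell s a (reg s y) (reg s z)); split=> //; constructor. Qed.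

Lemma runs_seq W c d s t1 t2 (Post : state -> Prop) :
  runs W c s t1 (fun s' => runs W d s' t2 Post) ->
  runs W (Seq c d) s (t1 + t2) Post.
Proof.
move=> [t [s' [ex le [t' [s'' [ex' le' Ps'']]]]]].
by exists (t + t'), s''; split=> //; [exact: ExecSeq ex ex' | exact: leq_add].
Qed.

(** The sum is a crude bound for the longer branch, but keeps the arithmetic of time bounds
    linear. *)
Lemma runs_if W y z c d s t1 t2 (Post : state -> Prop) :
  (reg s y < reg s z -> runs W c s t1 Post) ->
  (reg s z <= reg s y -> runs W d s t2 Post) ->
  runs W (IfLt y z c d) s (t1 + t2).+1 Post.
Proof.
move=> runc rund; case: (ltnP (reg s y) (reg s z)) => h.
  have [t [s' [ex le Ps']]] := runc h.
  by exists t.+1, s'; split=> //; [exact: ExecIfTrue | rewrite ltnS (leq_trans le) ?leq_addr].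
have [t [s' [ex le Ps']]] := rund h.
by exists t.+1, s'; split=> //; [exact: ExecIfFalse | rewrite ltnS (leq_trans le) ?leq_addl].
Qed.

(** The index of [Inv] counts rounds. That a true guard forces [i < N] yields both termination and
    the time bound. *)
Lemma runs_while W y z c s k N T (Inv : nat -> state -> Prop) :
  k <= N ->
  (forall i s', i <= N -> Inv i s' -> reg s' y < reg s' z ->
     i < N /\ runs W c s' T (Inv i.+1)) ->
  Inv k s ->
  runs W (WhileLt y z c) s ((N - k) * T.+1).+1
    (fun s' => reg s' z <= reg s' y /\ exists2 i, i <= N & Inv i s').
Proof.
move=> kN step; have [m mE] : exists m, m = N - k by exists (N - k).
elim: m => [|m IHm] in k s kN mE * => Is.
all: have [h|h] := leqP (reg s z) (reg s y);
  first by exists 1, s; split; [exact: ExecWhileFalse | by [] | split=> //; exists k].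
  by have [ltk _] := step _ _ kN Is h; move: mE ltk; rewrite -subn_gt0 => <-.
have [ltk [t [s' [ex le Is']]]] := step _ _ kN Is h.
have mE' : m = N - k.+1 by rewrite subnS -mE.
have [t' [s'' [ex' le' Ps'']]] := IHm k.+1 s' ltk mE' Is'.
exists (t + t').+1, s''; split=> //; first exact: ExecWhileTrue ex ex'.
rewrite -mE mulSn ltnS addSn -addnS; apply: leq_add => //.
by move: le'; rewrite subnS -mE.
Qed.

Fixpoint regs_written c : seq nat :=
  match c with
  | Skip | Write _ _ _ => [::]
  | Assign x _ => [:: x]
  | Seq c d | IfLt _ _ c d => regs_written c ++ regs_written d
  | WhileLt _ _ c => regs_written c
  end.

Fixpoint arrs_written c : seq nat :=
  match c with
  | Skip | Assign _ _ => [::]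
  | Write a _ _ => [:: a]
  | Seq c d | IfLt _ _ c d => arrs_written c ++ arrs_written d
  | WhileLt _ _ c => arrs_written c
  end.

(** A purely syntactic notion: whatever the text of [c] never assigns is preserved, so loop
    invariants need not mention it. *)
Definition frame c s s' :=
  (forall x, x \notin regs_written c -> reg s' x = reg s x) /\
  (forall a, a \notin arrs_written c -> arr s' a = arr s a).

Lemma exec_frame W c s t s' : exec W c s t s' -> frame c s s'.
Proof.
elim=> {c s t s'} //=.
- by move=> x e s _; split=> //= y; rewrite inE /upd => /negPf->.
- by move=> a y z s; split=> //= b; rewrite inE /upd => /negPf->.
- move=> c d s t s' t' s'' _ [r1 a1] _ [r2 a2]; split=> x; rewrite mem_cat negb_or => /andP[Nc Nd].
    by rewrite r2 ?r1.
  by rewrite a2 ?a1.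
- move=> y z c d s t s' _ _ [r1 a1]; split=> x; rewrite mem_cat negb_or => /andP[Nc Nd].
    exact: r1.
  exact: a1.
- move=> y z c d s t s' _ _ [r1 a1]; split=> x; rewrite mem_cat negb_or => /andP[Nc Nd].
    exact: r1.
  exact: a1.
- move=> y z c s t s' t' s'' _ _ [r1 a1] _ [r2 a2]; split=> x Nx.
    by rewrite r2 ?r1.
  by rewrite a2 ?a1.
Qed.

Lemma runs_frame W c s T Post :
  runs W c s T Post -> runs W c s T (fun s' => Post s' /\ frame c s s').
Proof.
move=> [t [s' [ex le Ps']]]; exists t, s'; split=> //; split=> //.
exact: exec_frame ex.
Qed.

(* Register 6 holds the constant 1 once the program has been initialised. *)
Definition for_loop i b c :=
  Seq (Assign i (Const 0)) (WhileLt i b (Seq c (Assign i (Add i 6)))).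

(** The body receives the frame of the whole loop since its start, and [Inv] is restored for the
    state with the counter already advanced. A round costs [T] plus the increment and the test; the
    extra 2 pay for the initial assignment and the last test. *)
Lemma runs_for W i b c s N T (Inv : nat -> state -> Prop) :
  reg s b = N -> reg s 6 = 1 -> N <= W ->
  [&& i != b, i != 6, i \notin regs_written c, b \notin regs_written c
    & 6 \notin regs_written c] ->
  Inv 0 (set_reg s i 0) ->
  (forall k s', k < N -> reg s' i = k -> frame (for_loop i b c) s s' ->
     Inv k s' -> runs W c s' T (fun s'' => Inv k.+1 (set_reg s'' i k.+1))) ->
  runs W (for_loop i b c) s (N * T.+2 + 2) (Inv N).
Proof.
move=> bN one NW /and5P[ib i6 ic bc c6] I0 step.
set fr := frame (for_loop i b c).
pose I k s' := [/\ Inv k s', reg s' i = k & fr s s'].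
apply: (@runs_le _ _ _ (1 + ((N - 0) * (T + 1).+1).+1) _
  (fun s' => reg s' b <= reg s' i /\ exists2 k, k <= N & I k s')); last by rewrite subn0 addn1; lia.
- apply/runs_seq/runs_assign; first by rewrite /=.
  apply: (@runs_while _ _ _ _ _ 0 N) => //.
    move=> k s' kN [Ik s'i frs] lt_ib.
    have s'b : reg s' b = N.
      by rewrite frs.1 //= inE negb_or mem_cat negb_or bc inE !(eq_sym b) ib.
    have s'6 : reg s' 6 = 1.
      by rewrite frs.1 //= inE negb_or mem_cat negb_or c6 inE !(eq_sym 6) i6.
    have ltk : k < N by rewrite -s'i -s'b.
    split=> //; apply: runs_seq.
    apply: (runs_le (runs_frame (step _ _ ltk s'i frs Ik))) (leqnn _).
    move=> s'' [Is'' frs'']; have s''i : reg s'' i = k by rewrite frs''.1.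
    have s''6 : reg s'' 6 = 1 by rewrite frs''.1.
    have val : value s'' (Add i 6) = k.+1 by rewrite /= s''i s''6 addn1.
    apply: runs_assign; rewrite val; first exact: leq_trans NW.
    split; [by [] | by rewrite /= /upd eqxx | split].
      move=> x Nx /=; rewrite /upd.
      have: x \notin regs_written (for_loop i b c) by [].
      rewrite /= inE negb_or mem_cat negb_or => /and3P[/negPf-> Nxc _].
      by rewrite frs''.1 // frs.1.
    move=> a Na /=; rewrite frs''.2 ?frs.2 //.
    by move: Na; rewrite /= cats0.
  split=> //; first by rewrite /= /upd eqxx.
  split=> [x|//]; rewrite /= inE negb_or /upd => /andP[/negPf->] //.
move=> s' [le [k kN [Ik s'i frs]]].
have s'b : reg s' b = N.
  by rewrite frs.1 //= inE negb_or mem_cat negb_or bc inE !(eq_sym b) ib.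
by have -> : N = k by apply/eqP; rewrite eqn_leq kN andbT -s'b -s'i.
Qed.

(** * Matrix access *)

Definition mat n (m : nat -> nat) (P : rel 'I_n) :=
  forall u v, m (cell u v) = P u v.

(** Register 14 is overwritten before [y] is read, whence the condition [y != 14] on every use. *)
Definition get dst a x y :=
  Seq (Assign 14 (Mul x 0)) (Seq (Assign 15 (Add 14 y)) (Assign dst (Read a 15))).

Lemma runs_get W n dst a x y s (u v : 'I_n) P Post :
  reg s 0 = n -> reg s x = u -> reg s y = v -> mat (arr s a) P ->
  y != 14 -> n * n < W ->
  Post (set_reg (set_reg (set_reg s 14 (u * n)) 15 (cell u v)) dst (P u v)) ->
  runs W (get dst a x y) s 3 Post.
Proof.
move=> sn sx sy sa y14 nW; rewrite -sa => Ps.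
have ltc : cell u v <= W := ltnW (ltn_trans (cell_lt u v) nW).
apply: (@runs_seq _ _ _ _ 1 2); apply: runs_assign; rewrite /= sx sn.
  by apply: leq_trans ltc; rewrite /cell leq_addr.
apply: (@runs_seq _ _ _ _ 1 1); apply: runs_assign; rewrite /= /upd eqxx (negPf y14) sy //.
by apply: runs_assign; rewrite /= /upd eqxx // sa; case: (P u v); rewrite // (leq_ltn_trans _ nW).
Qed.

Definition test a x y c d := Seq (get 16 a x y) (IfLt 5 16 c d).

Definition probe n s (u v : 'I_n) (b : bool) :=
  set_reg (set_reg (set_reg s 14 (u * n)) 15 (cell u v)) 16 b.

Lemma runs_test W n a x y c d s (u v : 'I_n) P t1 t2 Post :
  reg s 0 = n -> reg s 5 = 0 -> reg s x = u -> reg s y = v -> mat (arr s a) P ->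
  y != 14 -> n * n < W ->
  (P u v -> runs W c (probe s u v true) t1 Post) ->
  (~~ P u v -> runs W d (probe s u v false) t2 Post) ->
  runs W (test a x y c d) s (3 + (t1 + t2).+1) Post.
Proof.
move=> sn s0 sx sy sa y14 nW run1 run2; apply: runs_seq.
apply: (runs_get sn sx sy sa y14 nW); rewrite -/(probe s u v (P u v)).
apply: runs_if => /=; rewrite /upd /= s0.
  by case: (P u v) run1 => // run1 _; apply: run1.
by case: (P u v) run2 => // run2 _; apply: run2.
Qed.

(* Registers: 0 holds n, 1 and 2 the side n^2 + 2 of the cover instance, 3 its
   number of edges, 5 zero, 10 and 11 loop counters, 12 and 13 the end points of
   the current edge, 14-17 scratch values, 20-24 the interface of [middle].
   Arrays: 0 is the adjacency matrix, edited in place; 1 and 2 list the edges of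
   the cover instance; 5 marks the necessary edges and becomes the output; 6
   marks the stars; 7 is phi; 8, 9, 10 are the marks, the order and the parents
   of the search; 11 and 12 list 3n edges; 13 maps an edge of the cover instance
   to the shifted cell of the redundant edge it stands for. *)
Record base n W (s : state) : Prop := Base {
  base_n : reg s 0 = n;
  base_K : reg s 1 = n * n + 2;
  base_K' : reg s 2 = n * n + 2;
  base_0 : reg s 5 = 0;
  base_1 : reg s 6 = 1;
  base_d1 : reg s 7 = (n * n).+1;
  base_d : reg s 8 = n * n;
  base_3n : reg s 9 = 3 * n;
  base_2 : reg s 25 = 2;
  base_W : (n * n + 3) * (n * n + 3) <= W }.

Lemma base_frame n W c s s' : frame c s s' ->
  all (fun x => x \notin regs_written c) [:: 0; 1; 2; 5; 6; 7; 8; 9; 25] ->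
  base n W s -> base n W s'.
Proof.
move=> [fr _] /= /and5P[N0 N1 N2 N5 /and5P[N6 N7 N8 N9 /andP[N25 _]]] [? ? ? ? ? ? ? ? ? ?].
by split; rewrite ?fr.
Qed.

Lemma base_nnW n W s : base n W s -> n * n < W.
Proof. by move=> B; have := base_W B; nia. Qed.

Lemma base_3nW n W s : base n W s -> 3 * n < W.
Proof. by move=> B; have := base_W B; nia. Qed.

Lemma base_nW n W s : base n W s -> n < W.
Proof. by move=> B; have := base_W B; nia. Qed.

Ltac by_base B :=
  first [ exact: (base_n B) | exact: (base_0 B) | exact: (base_1 B) | exact: (base_nnW B)
        | eassumption | by [] ].

(* The last q with a[x, q], b[q, y] and q <> c, where x, y, c are given in
   registers 20, 21, 22; register 23 is left unchanged if there is none. *)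
Definition middle a b :=
  let found := Assign 23 (Add 24 5) in
  for_loop 24 0
    (test a 20 24 (test b 24 21 (IfLt 24 22 found (IfLt 22 24 found Skip)) Skip) Skip).

Definition middle_spec n (P Q : rel 'I_n) x y c r s :=
  (exists q : 'I_n, [/\ P x q, Q q y, (q : nat) != c & reg s 23 = q]) \/
  (forall q : 'I_n, P x q -> Q q y -> (q : nat) = c) /\ reg s 23 = r.

Lemma runs_middle W n a b s (x y : 'I_n) c r P Q :
  base n W s -> reg s 20 = x -> reg s 21 = y -> reg s 22 = c -> reg s 23 = r ->
  mat (arr s a) P -> mat (arr s b) Q ->
  runs W (middle a b) s (20 * n + 20) (middle_spec P Q x y c r).
Proof.
move=> B sx sy sc sr sa sb; have nW := base_nnW B; have nW' := base_nW B.
pose Inv k s' :=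
  (exists q : 'I_n, [/\ P x q, Q q y, (q : nat) != c & reg s' 23 = q]) \/
  (forall q : 'I_n, q < k -> P x q -> Q q y -> (q : nat) = c) /\ reg s' 23 = r.
eapply (@runs_le _ _ _ _ _ (Inv n)).
- eapply runs_for; try by_base B.
  + exact: ltnW.
  + by right; split=> //.
  move=> k s' kn s'k fr Is'; have B' := base_frame fr isT B.
  have [s'20 s'21 s'22] : [/\ reg s' 20 = x, reg s' 21 = y & reg s' 22 = c].
    by rewrite !fr.1.
  have [s'a s'b] : mat (arr s' a) P /\ mat (arr s' b) Q by rewrite !fr.2.
  pose q := Ordinal kn; have s'q : reg s' 24 = q by [].
  have keep (s2 : state) : reg s2 23 = reg s' 23 ->
      (P x q -> Q q y -> (q : nat) = c) -> Inv k.+1 (set_reg s2 24 k.+1).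
    move=> s2r hq; case: Is' => [[q' [Pq Qq Nq s'r]]|[none s'r]].
      by left; exists q'; rewrite /= /upd /= s2r.
    right; rewrite /= /upd /= s2r; split=> // q'; rewrite ltnS leq_eqVlt.
    case/orP=> [/eqP q'k|/none//]; have -> : q' = q by apply: ord_inj.
    exact: hq.
  have hit (s2 : state) : reg s2 23 = q -> P x q -> Q q y -> (q : nat) != c ->
      Inv k.+1 (set_reg s2 24 k.+1).
    by move=> s2r Pq Qq Nq; left; exists q.
  eapply runs_test; try by_base B'.
    move=> Pxq; eapply runs_test; rewrite /probe /= /upd /=; try by_base B'.
      move=> Qqy; apply: runs_if; rewrite /= /upd /= s'22 s'k => lt.
        apply: runs_assign; rewrite /= /upd /= s'k (base_0 B') addn0; first lia.
        by apply: hit => //=; rewrite /upd /= ?neq_ltn ?lt.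
      apply: runs_if; rewrite /= /upd /= s'22 s'k => lt'.
        apply: runs_assign; rewrite /= /upd /= s'k (base_0 B') addn0; first lia.
        by apply: hit => //=; rewrite /upd /= neq_ltn lt' orbT.
      by apply: runs_skip; apply: keep => //= _ _; apply/eqP; rewrite eqn_leq lt lt'.
    by move=> /negPf Qqy; apply: runs_skip; apply: keep => //= _; rewrite Qqy.
  by move=> /negPf Pxq; apply: runs_skip; apply: keep => //=; rewrite Pxq.
- move=> s' [?|[none ?]]; [by left | right; split=> // q; exact: none].
- lia.
Qed.

Definition put a x y v :=
  Seq (Assign 14 (Mul x 0)) (Seq (Assign 15 (Add 14 y)) (Write a 15 v)).

Definition poke n s a (u v : 'I_n) w :=
  set_cell (set_reg (set_reg s 14 (u * n)) 15 (cell u v)) a (cell u v) w.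

Lemma runs_put W n a x y z s (u v : 'I_n) w Post :
  reg s 0 = n -> reg s x = u -> reg s y = v -> reg s z = w ->
  y != 14 -> z != 14 -> z != 15 -> n * n < W ->
  Post (poke s a u v w) -> runs W (put a x y z) s 3 Post.
Proof.
move=> sn sx sy sz y14 z14 z15 nW Ps.
have ltc : cell u v <= W := ltnW (ltn_trans (cell_lt u v) nW).
apply: (@runs_seq _ _ _ _ 1 2); apply: runs_assign; rewrite /= sx sn.
  by apply: leq_trans ltc; rewrite /cell leq_addr.
apply: (@runs_seq _ _ _ _ 1 1); apply: runs_assign; rewrite /= /upd eqxx (negPf y14) sy //.
by apply: runs_write; rewrite /= /upd eqxx (negPf z14) (negPf z15) sz.
Qed.

Lemma mat_upd n m (P : rel 'I_n) x y (b : bool) : mat m P ->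
  mat (upd m (cell x y) b) (fun u v => if (u, v) == (x, y) then b else P u v).
Proof.
move=> mP u v; rewrite /upd; case: eqP => [/cell_inj[-> ->]|Nc]; first by rewrite eqxx.
by case: eqP => [[uE vE]|_]; [case: Nc; rewrite uE vE | exact: mP].
Qed.

Lemma mat_ext n m (P Q : rel 'I_n) : mat m P -> P =2 Q -> mat m Q.
Proof. by move=> mP PQ u v; rewrite mP PQ. Qed.

(** * Programs that delete loops and reversed triangle edges *)

Definition remove_loops := for_loop 10 0 (put 0 10 10 5).

Lemma runs_remove_loops W n s (E : digraph n) :
  base n W s -> mat (arr s 0) (edge_rel E) ->
  runs W remove_loops s (20 * n + 20)
    (fun s' => mat (arr s' 0) (edge_rel (E :\: [set e | e.1 == e.2]))).
Proof.
move=> B ME; pose Inv k s' := mat (arr s' 0)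
  (fun u v => if (u == v) && (u < k) then false else edge_rel E u v).
eapply (@runs_le _ _ _ _ _ (Inv n)).
- eapply runs_for; try by_base B.
  + exact/ltnW/base_nW/B.
  + by apply: mat_ext ME _ => u v; rewrite ltn0 andbF.
  move=> k s' kn s'k fr Is'; have B' := base_frame fr isT B.
  pose q := Ordinal kn; eapply (@runs_put _ _ _ _ _ _ _ q q);
    try exact: base_n B'; try exact: base_0 B'; try exact: base_nnW B'; try by [].
  rewrite /Inv /= /upd /=; apply: mat_ext (mat_upd q q false Is') _ => u v.
  rewrite xpair_eqE ltnS [u <= k]leq_eqVlt -(inj_eq val_inj u q) /=.
  case: (eqVneq u v) => [->|Nuv] /=.
    by rewrite andbb; case: (eqVneq (val v) k).
  case: eqP => //= uq; case: eqP => // vq; case/negP: Nuv.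
  by apply/eqP/ord_inj; rewrite uq vq.
- move=> s' Is' u v; rewrite Is' ltn_ord andbT /edge_rel in_setD inE /=.
  by case: eqP.
- lia.
Qed.

Definition each_edge c :=
  for_loop 10 9 (Seq (Assign 12 (Read 11 10)) (Seq (Assign 13 (Read 12 10)) c)).

Definition entry n (A : nat -> nat -> nat) k (x y : 'I_n) := A 11 k = x /\ A 12 k = y.

Definition listing n (A : nat -> nat -> nat) :=
  forall k, k < 3 * n -> exists x y : 'I_n, entry A k x y.

(** The list may contain placeholder pairs that are not edges, hence the restriction to [E]. *)
Definition listed n (A : nat -> nat -> nat) (E : digraph n) : digraph n :=
  [set e in E | [exists k : 'I_(3 * n), (A 11 k == e.1) && (A 12 k == e.2)]].

Lemma listedP n A (E : digraph n) u v :
  reflect (edge_rel E u v /\ exists2 k, k < 3 * n & entry A k u v) (edge_rel (listed A E) u v).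
Proof.
rewrite /edge_rel inE; apply: (iffP andP) => -[uv].
  by case/existsP=> k /andP[/eqP eu /eqP ev]; split=> //; exists k.
case=> k lt_k [eu ev]; split=> //; apply/existsP; exists (Ordinal lt_k).
by rewrite eu ev !eqxx.
Qed.

Lemma listed_sub n A (E : digraph n) : listed A E \subset E.
Proof. by apply/subsetP=> e; rewrite inE => /andP[]. Qed.

(** Besides the arrays the invariant sees only register 3, the number of instance edges written so
    far. *)
Lemma runs_each_edge W n c s T (Inv : nat -> (nat -> nat -> nat) -> nat -> Prop) :
  base n W s -> listing n (arr s) ->
  all (fun x => x \notin regs_written c) [:: 6; 9; 10] ->
  all (fun a => a \notin arrs_written c) [:: 11; 12] ->
  Inv 0 (arr s) (reg s 3) ->
  (forall k s' (x y : 'I_n), k < 3 * n -> entry (arr s) k x y ->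
     reg s' 12 = x -> reg s' 13 = y -> frame (each_edge c) s s' ->
     Inv k (arr s') (reg s' 3) ->
     runs W c s' T (fun s'' => Inv k.+1 (arr s'') (reg s'' 3))) ->
  runs W (each_edge c) s (3 * n * (T + 4) + 2) (fun s' => Inv (3 * n) (arr s') (reg s' 3)).
Proof.
move=> B ls /and4P[c6 c9 c10 _] /and3P[c11 c12 _] I0 step.
eapply (@runs_le _ _ _ _ _ (fun s' => Inv (3 * n) (arr s') (reg s' 3))); last first.
- instantiate (1 := 3 * n * (1 + (1 + T)).+2 + 2); lia.
- by [].
eapply (@runs_for _ _ _ _ _ _ _ (fun k s' => Inv k (arr s') (reg s' 3)));
  try exact: base_1 B; try exact: base_3n B; try by [].
- exact/ltnW/base_3nW/B.
- by rewrite /= !inE /= c10 c9 c6.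
move=> k s' lt_k s'k fr Is'; have [x [y [ex ey]]] := ls k lt_k.
have fr11 : arr s' 11 = arr s 11 by rewrite fr.2 //= cats0.
have fr12 : arr s' 12 = arr s 12 by rewrite fr.2 //= cats0.
have nW := base_nW B.
have xW : x <= W := ltnW (ltn_trans (ltn_ord x) nW).
have yW : y <= W := ltnW (ltn_trans (ltn_ord y) nW).
apply: runs_seq; apply: runs_assign; rewrite /= s'k fr11 ex //.
apply: runs_seq; apply: runs_assign; rewrite /= /upd /= s'k fr12 ey //.
eapply (@runs_le _ _ _ _ _ (fun s'' => Inv k.+1 (arr s'') (reg s'' 3))); [|by []|exact: leqnn].
apply: (step _ _ x y lt_k) => //; split=> z Nz /=; last exact: fr.2.
rewrite /upd; have := Nz; rewrite /= !inE !negb_or => /and4P[_ /negPf-> /negPf-> _].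
exact: fr.1.
Qed.

Definition unchord :=
  each_edge (for_loop 11 0
    (test 0 12 13 (test 0 13 11 (test 0 11 12
       (Seq (put 0 13 12 5) (Seq (put 0 11 13 5) (put 0 12 11 5))) Skip) Skip) Skip)).

Lemma mat_rev n m (E : digraph n) x y z : mat m (edge_rel E) ->
  mat (upd (upd (upd m (cell y x) false) (cell z y) false) (cell x z) false)
    (edge_rel (E :\: rev_triangle x y z)).
Proof.
move=> mE; apply: mat_ext (mat_upd x z false (mat_upd z y false (mat_upd y x false mE))) _.
move=> u v; rewrite /edge_rel !inE /=.
by do 3!case: eqP => _ //=.
Qed.

Lemma runs_unchord W n s (E : digraph n) :
  base n W s -> listing n (arr s) -> mat (arr s 0) (edge_rel E) ->
  cycles_at_most 3 E -> loopless E -> strongly_connected (listed (arr s) E) ->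
  runs W unchord s (200 * (n * n) + 200 * n + 200)
    (fun s' => exists E' : digraph n,
       [/\ mat (arr s' 0) (edge_rel E'), reduces E E' & chordless E']).
Proof.
move=> B ls ME short noloop scL.
pose done_at (E' : digraph n) (x y z : 'I_n) :=
  triangle E' x y z -> [disjoint E' & rev_triangle x y z].
pose good (E' : digraph n) (A : nat -> nat -> nat) := [/\ mat (A 0) (edge_rel E'), reduces E E'
   & deleted_in_triangle E E'].
pose Inv k A (_ : nat) := exists2 E' : digraph n, good E' A &
  forall j x y z, j < k -> entry (arr s) j x y -> done_at E' x y z.
(* A treated triple stays treated under later deletions, because both the triangles and the edges
   avoiding the reversals only decrease. *)
have done_sub (E1 E2 : digraph n) x y z : E2 \subset E1 -> done_at E1 x y z -> done_at E2 x y z.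
  move=> sub d T; apply: disjointWl (d _); first by [].
  by case/and3P: T => *; apply/and3P; split; apply: (subsetP sub).
eapply (@runs_le _ _ _ _ _ (fun s' => Inv (3 * n) (arr s') (reg s' 3))).
- eapply (@runs_each_edge _ _ _ _ _ Inv B ls) => //.
    exists E => //; split=> //; first exact: reduces_refl.
    by move=> u v ->.
  move=> k s' x y lt_k exy s'x s'y fr [E' goodE' doneE'].
  have B' := base_frame fr isT B.
  pose Inv' q s'' := exists2 E' : digraph n, good E' (arr s'') &
    (forall j x y z, j < k -> entry (arr s) j x y -> done_at E' x y z) /\
    (forall z : 'I_n, z < q -> done_at E' x y z).
  eapply (@runs_le _ _ _ _ _ (Inv' n)).
  + eapply runs_for; try by_base B'.
    * exact/ltnW/base_nW/B.
    * by exists E'.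
    move=> q s2 qn s2q fr2 [E2 good2 [done2 done2']]; have B2 := base_frame fr2 isT B'.
    have [ME2 red2 del2] := good2; pose z := Ordinal qn.
    have s2z : reg s2 11 = z by [].
    have [s2x s2y] : reg s2 12 = x /\ reg s2 13 = y by rewrite !fr2.1.
    have skip (s3 : state) : arr s3 = arr s2 -> ~~ triangle E2 x y z -> Inv' q.+1 (set_reg s3 11 q.+1).
      move=> s3E NT; exists E2; rewrite /good /= ?s3E //; split=> // z'.
      rewrite ltnS leq_eqVlt => /orP[/eqP z'q|]; last exact: done2'.
      by have -> : z' = z by [apply: ord_inj]; rewrite /done_at (negPf NT).
    have nW := base_nnW B2.
    eapply runs_test; try by_base B2.
      move=> xy; eapply runs_test; rewrite /probe /= /upd /=; try by_base B2.
        move=> yz; eapply runs_test; rewrite /probe /= /upd /=; try by_base B2.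
          move=> zx; have T : triangle E2 x y z by apply/and3P.
          apply: runs_seq; eapply (@runs_put _ _ _ _ _ _ _ y x false); rewrite /probe /= /upd /=; try by_base B2.
          apply: runs_seq; eapply (@runs_put _ _ _ _ _ _ _ z y false); rewrite /probe /= /upd /=; try by_base B2.
          eapply (@runs_put _ _ _ _ _ _ _ x z false); rewrite /probe /= /upd /=; try by_base B2.
          have sub : E2 :\: rev_triangle x y z \subset E2 := subsetDl _ _.
          exists (E2 :\: rev_triangle x y z).
            split; first exact: mat_rev.
              apply: (reduces_trans red2); apply: reduces_rev T.
                exact: cycles_at_most_sub red2.1 short.
              exact: loopless_sub red2.1 noloop.
            exact: deleted_in_triangle_rev red2.1 del2 T.
          split=> [j x' y' z' jk e|z']; first exact/(done_sub _ _ _ _ _ sub)/(done2 _ _ _ _ jk).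
          rewrite ltnS leq_eqVlt => /orP[/eqP z'q|lt]; last exact/(done_sub _ _ _ _ _ sub)/done2'.
          have -> : z' = z by [apply: ord_inj]; move=> _.
          by apply/pred0P=> e /=; rewrite in_setD andbC andbA andbN.
        by move=> Nzx; apply: runs_skip; apply: skip => //; rewrite /triangle (negPf Nzx) !andbF.
      by move=> Nyz; apply: runs_skip; apply: skip => //; rewrite /triangle (negPf Nyz) andbF.
    by move=> Nxy; apply: runs_skip; apply: skip => //; rewrite /triangle (negPf Nxy).
  + move=> s2 [E2 good2 [done2 done2']]; exists E2 => // j x' y' z; rewrite ltnS leq_eqVlt.
    case/orP=> [/eqP->|]; last exact: done2.
    case: exy => ex ey [ex' ey'].
    have -> : x' = x by apply: ord_inj; rewrite -ex' ex.
    have -> : y' = y by apply: ord_inj; rewrite -ey' ey.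
    exact: done2'.
  + exact: leqnn.
- move=> s' [E' [ME' red del] doneE']; exists E'; split=> //.
  apply: chordless_after_deletion red.1 (listed_sub _ _) scL del _ => //.
  move=> x y z /listedP[_ [k kn e]]; exact: doneE' kn e.
- lia.
Qed.

(** * Breadth-first search *)

Definition clear_visited := for_loop 10 0 (Write 8 10 5).

(** Array 9 is the queue, with head in register 30 and end in register 31. Vertex 0 is the root and
    its own parent; the test whether 0 < n leaves the queue empty for the empty digraph. *)
Definition start_search :=
  Seq (IfLt 5 0 (Seq (Write 8 5 6) (Seq (Write 9 5 5) (Seq (Write 10 5 5) (Assign 31 (Const 1)))))
                (Assign 31 (Const 0)))
      (Assign 30 (Const 0)).

Definition scan_successors :=
  for_loop 11 0
    (test 0 32 11
       (Seq (Assign 17 (Read 8 11))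
          (IfLt 17 6
             (Seq (Write 8 11 6) (Seq (Write 9 31 11)
                (Seq (Write 10 11 32) (Assign 31 (Add 31 6)))))
             Skip))
       Skip).

Definition visit_all :=
  WhileLt 30 31 (Seq (Assign 32 (Read 9 30)) (Seq scan_successors (Assign 30 (Add 30 6)))).

(** Position c receives the tree edge (p, c), positions n + c and 2n + c the return path c -> z ->
    p. Without a path of two edges [z] defaults to p, so that (c, p) is the direct return and (p, p)
    a placeholder. *)
Definition list_returns :=
  for_loop 10 0
    (Seq (Seq (Assign 20 (Add 10 5)) (Seq (Assign 21 (Read 10 10))
         (Seq (Assign 22 (Add 0 5)) (Assign 23 (Add 21 5)))))
    (Seq (middle 0 0)
    (Seq (Seq (Write 11 10 21) (Write 12 10 10))
    (Seq (Seq (Assign 14 (Add 0 10)) (Seq (Write 11 14 10) (Write 12 14 23)))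
         (Seq (Assign 14 (Add 14 0)) (Seq (Write 11 14 23) (Write 12 14 21))))))).

Definition search := Seq clear_visited (Seq start_search (Seq visit_all list_returns)).

Definition search_order n (E : digraph n) (A : nat -> nat -> nat) (o : seq 'I_n) :=
  [/\ uniq o,
      forall v : 'I_n, v \in o -> A 9 (index v o) = v,
      forall v : 'I_n, v \in o -> index v o = 0 -> v = 0 :> nat /\ A 10 v = 0 &
      forall v : 'I_n, v \in o -> 0 < index v o ->
        exists u : 'I_n, [/\ A 10 v = u, u \in o, index u o < index v o & edge_rel E u v]].

Definition visited n (A : nat -> nat -> nat) (o : seq 'I_n) := forall v : 'I_n, A 8 v = (v \in o).

Definition explored n (E : digraph n) (o : seq 'I_n) k :=
  forall v w, v \in o -> index v o < k -> edge_rel E v w -> w \in o.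

Definition searching n (E : digraph n) k s := exists o : seq 'I_n,
  [/\ search_order E (arr s) o, visited (arr s) o, explored E o k,
      [/\ reg s 30 = k, reg s 31 = size o & k <= size o] &
      forall v : 'I_n, v = 0 :> nat -> v \in o].

Lemma index_rconsl (T : eqType) (o : seq T) v w : v \in o -> index v (rcons o w) = index v o.
Proof. by move=> vo; rewrite -cats1 index_cat vo. Qed.

Lemma index_rconsr (T : eqType) (o : seq T) w : w \notin o -> index w (rcons o w) = size o.
Proof. by move=> wo; rewrite -cats1 index_cat (negPf wo) /= eqxx addn0. Qed.

Lemma index_surj (T : eqType) (o : seq T) k : uniq o -> k < size o ->
  exists2 u, u \in o & index u o = k.
Proof.
move=> uo ko; case: o uo ko => // x o uo ko; exists (nth x (x :: o) k).
  exact: mem_nth.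
exact: index_uniq.
Qed.

Lemma size_uniq_ord n (o : seq 'I_n) : uniq o -> size o <= n.
Proof. by move=> uo; rewrite -[n in X in _ <= X]card_ord -(card_uniqP uo) max_card. Qed.

Lemma runs_clear_visited W n s : base n W s ->
  runs W clear_visited s (20 * n + 20) (fun s' => forall v : 'I_n, arr s' 8 v = 0).
Proof.
move=> B; pose Inv k s' := forall v : 'I_n, v < k -> arr s' 8 v = 0.
eapply (@runs_le _ _ _ _ _ (Inv n)).
- eapply runs_for; try by_base B.
  + exact/ltnW/base_nW/B.
  move=> k s' kn s'k fr Is'; have B' := base_frame fr isT B.
  apply: runs_write => v; rewrite ltnS leq_eqVlt /= /upd /= s'k (base_0 B').
  by case: eqP => //= _; apply: Is'.
- by move=> s' Is' v; apply: Is'.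
- lia.
Qed.

Lemma runs_start_search W n (E : digraph n) s : base n W s ->
  (forall v : 'I_n, arr s 8 v = 0) ->
  runs W start_search s 20 (searching E 0).
Proof.
move=> B A8; have W1 : 1 <= W by have := base_nW B; lia.
eapply runs_le; [|by move=> s'; apply|].
- apply: runs_seq; apply: runs_if; rewrite (base_0 B) (base_n B) => n0.
    apply/runs_seq/runs_write; apply/runs_seq/runs_write; apply/runs_seq/runs_write.
    apply: runs_assign => //; apply: runs_assign => //.
    pose r := Ordinal n0; exists [:: r]; split.
    + split=> //= v; rewrite inE => /eqP->; rewrite ?eqxx //=.
        by rewrite /upd /= (base_0 B).
      by rewrite /upd /= (base_0 B).
    + move=> v; rewrite /= /upd /= (base_0 B) (base_1 B) A8 inE.
      by rewrite -(inj_eq val_inj) /=; case: eqP.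
    + by [].
    + by [].
    + by move=> v v0; rewrite inE; apply/eqP/ord_inj.
  apply: runs_assign => //; apply: runs_assign => //; exists [::]; split=> //.
  by move=> v; have := ltn_ord v; lia.
- lia.
Qed.

Lemma search_order_rcons n (E : digraph n) A o u w t : search_order E A o ->
  u \in o -> w \notin o -> edge_rel E u w -> t = size o ->
  (forall v : 'I_n, v \in o -> A 8 v = 1) ->
  search_order E (upd (upd (upd A 8 (upd (A 8) w 1)) 9 (upd (A 9) t w)) 10
                   (upd (A 10) w u)) (rcons o w).
Proof.
move=> [uo o9 o0 op] uin win uw -> _.
have neq v : v \in o -> (v : nat) == w = false.
  by move=> vo; apply/negP=> /eqP/ord_inj vw; rewrite -vw vo in win.
have ilt v : v \in o -> index v o < size o by rewrite index_mem.
have s0 : 0 < size o by case: (o) uin.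
split.
- by rewrite rcons_uniq win.
- move=> v; rewrite mem_rcons inE /upd /= => /orP[/eqP->|vo].
    by rewrite index_rconsr ?eqxx.
  by rewrite index_rconsl // o9 // ltn_eqF // ilt.
- move=> v; rewrite mem_rcons inE /upd /= => /orP[/eqP->|vo].
    by rewrite index_rconsr // => s0'; rewrite s0' in s0.
  by rewrite index_rconsl // neq //; apply: o0.
- move=> v; rewrite mem_rcons inE /upd /= => /orP[/eqP->|vo].
    by exists u; rewrite eqxx index_rconsr // index_rconsl // mem_rcons inE uin orbT ilt.
  rewrite index_rconsl // => /(op v vo)[p [vp po lt pv]].
  by exists p; rewrite neq // mem_rcons inE po orbT index_rconsl.
Qed.

Lemma runs_scan_successors W n (E : digraph n) s k (u : 'I_n) :
  base n W s -> mat (arr s 0) (edge_rel E) -> searching E k s ->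
  k < reg s 31 -> reg s 32 = u -> arr s 9 k = u ->
  runs W scan_successors s (40 * n + 40)
    (fun s' => searching E k.+1 (set_reg s' 30 k.+1)).
Proof.
move=> B ME [o0 [so0 vis0 ex0 [s30 s31 ko0] root0]] lt_k s32 s9.
have nW := base_nnW B; have nW' := base_nW B.
pose Inv q s' := exists o : seq 'I_n,
  [/\ search_order E (arr s') o, visited (arr s') o, explored E o k,
      [/\ reg s' 31 = size o, k < size o, u \in o & index u o = k] &
      (forall v : 'I_n, v = 0 :> nat -> v \in o) /\
      forall w : 'I_n, w < q -> edge_rel E u w -> w \in o].
eapply (@runs_le _ _ _ _ _ (Inv n)).
- eapply runs_for; try by_base B.
  + exact: ltnW.
  + have [v vo vk] : exists2 v, v \in o0 & index v o0 = k.
      by apply: index_surj; [case: so0 | rewrite -s31].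
    have vu : v = u by apply: ord_inj; rewrite -s9 -vk; case: so0 => _ ->.
    by exists o0; split=> //; rewrite -vu -s31; split.
  move=> q s' qn s'q fr [o [so vis ex [s'31 ko uo uk] [root scanned]]].
  have B' := base_frame fr isT B.
  have s'32 : reg s' 32 = u by rewrite fr.1.
  have s'0 : mat (arr s' 0) (edge_rel E) by rewrite fr.2.
  pose w := Ordinal qn; have s'w : reg s' 11 = w by [].
  have skip (s2 : state) : arr s2 = arr s' -> reg s2 31 = reg s' 31 ->
      (edge_rel E u w -> w \in o) -> Inv q.+1 (set_reg s2 11 q.+1).
    move=> s2A s2r hw; exists o; rewrite /= s2A /upd /= s2r; split=> //; split=> // v.
    rewrite ltnS leq_eqVlt => /orP[/eqP vq|]; last exact: scanned.
    by have -> : v = w by apply: ord_inj.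
  eapply runs_test; try by_base B'.
    move=> uw; apply: runs_seq; apply: runs_assign; rewrite /= /upd /= s'q (vis w).
      by case: (w \in o) => //; lia.
    apply: runs_if; rewrite /= /upd /= (base_1 B') => wo; last first.
      by apply: runs_skip; apply: skip => //; move: wo; case: (w \in o).
    have win : w \notin o by move: wo; case: (w \in o).
    apply/runs_seq/runs_write; apply/runs_seq/runs_write; apply/runs_seq/runs_write.
    have szo : size (rcons o w) <= n.
      by apply: size_uniq_ord; rewrite rcons_uniq win; case: so.
    rewrite size_rcons in szo.
    apply: runs_assign; rewrite /= /upd /= (base_1 B') s'31 addn1; first lia.
    exists (rcons o w); rewrite /= s'q s'32 ?s'31; split.
    + apply: (search_order_rcons (t := size o) so uo win uw) => // v vo.
      by rewrite vis vo.
    + move=> v; rewrite /= /upd /= mem_rcons inE -(inj_eq val_inj) /=.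
      by case: eqP => //= _; rewrite vis.
    + move=> v x; rewrite mem_rcons inE => /orP[/eqP->|vo].
        by rewrite index_rconsr // ltnNge ltnW.
      by rewrite index_rconsl // => vk vx; rewrite mem_rcons inE (ex v) ?orbT.
    + by rewrite /upd /= size_rcons mem_rcons inE uo orbT index_rconsl //; split=> //; apply: ltnW.
    + split=> v; first by move=> /root vo; rewrite mem_rcons inE vo orbT.
      rewrite ltnS leq_eqVlt mem_rcons inE => /orP[/eqP vq|vq uv].
        by move=> _; apply/orP; left; apply/eqP/ord_inj.
      by rewrite (scanned v) ?orbT.
  by move=> Nuw; apply: runs_skip; apply: skip => //; rewrite (negPf Nuw).
- move=> s' [o [so vis ex [s'31 ko uo uk] [root scanned]]].
  exists o; split=> //= v w vo; rewrite ltnS leq_eqVlt => /orP[/eqP vk|]; last exact: ex.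
  have -> : v = u by rewrite -(nth_index u vo) vk -uk nth_index.
  by move=> uw; apply: scanned.
- lia.
Qed.

(** Each round takes a new position of a repetition-free order, so there are at most n rounds. *)
Lemma runs_visit_all W n (E : digraph n) s :
  base n W s -> mat (arr s 0) (edge_rel E) -> strongly_connected E -> searching E 0 s ->
  runs W visit_all s (40 * (n * n) + 100 * n + 20)
    (fun s' => exists2 o : seq 'I_n, search_order E (arr s') o & forall v, v \in o).
Proof.
move=> B ME scE I0.
pose I k s' := [/\ searching E k s', base n W s' & mat (arr s' 0) (edge_rel E)].
eapply (@runs_le _ _ _ _ _ (fun s' => reg s' 31 <= reg s' 30 /\
  exists2 k, k <= n & I k s')).
- eapply (@runs_while _ _ _ _ _ 0 n); [by []| |by split].
  move=> k s' kn [Is' B' ME'] lt.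
  have [o [so vis ex [s'30 s'31 ko] root]] := Is'.
  have [uo o9 _ _] := so; rewrite s'30 s'31 in lt.
  have [u uin uk] := index_surj uo lt; have kn' := leq_trans lt (size_uniq_ord uo).
  have nW := base_nW B.
  have s'9 : arr s' 9 k = u by rewrite -uk o9.
  split=> //; apply: runs_seq; apply: runs_assign; rewrite /= s'30 s'9.
    by have := ltn_ord u; lia.
  set s2 := set_reg s' 32 u; have B2 : base n W s2 by case: B'; split.
  have I2 : searching E k s2 by exists o.
  have run3 := runs_frame (runs_scan_successors (u := u) B2 ME' I2
    ltac:(by rewrite /= /upd /= s'31) ltac:(by rewrite /= /upd) s'9).
  apply: runs_seq; apply: (runs_le run3) (leqnn _) => s3 [Is3 fr3].
  have B3 := base_frame fr3 isT B2.
  have val : value s3 (Add 30 6) = k.+1.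
    by rewrite /= (base_1 B3) fr3.1 //= /upd /= s'30 addn1.
  apply: runs_assign; rewrite val; first by lia.
  split=> //; first by case: B3; split.
  by rewrite /= fr3.2.
- move=> s' [le [k kn [[o [so vis ex [s'30 s'31 ko] root]] _ _]]].
  exists o => // v; have kE : k = size o by lia.
  have r_lt : 0 < n by apply: leq_ltn_trans (ltn_ord v).
  (* The fully explored order contains the root and is closed under successors, hence contains every
     vertex reachable from the root. *)
  have /connectP[p pE ->] := scE (Ordinal r_lt) v.
  elim: p (Ordinal r_lt) (root (Ordinal r_lt) erefl) pE => //= w p IHp x xo /andP[xw].
  by apply: IHp; apply: (ex x) xw => //; rewrite kE index_mem.
- rewrite subn0; nia.
Qed.

Definition returns_listed n (E : digraph n) (A : nat -> nat -> nat) (c : 'I_n) :=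
  exists p z : 'I_n,
    [/\ A 10 c = p, entry A c p c, entry A (n + c) c z, entry A (n + c + n) z p &
        edge_rel E c z /\ edge_rel E z p \/
        z = p /\ forall q, edge_rel E c q -> edge_rel E q p -> False].

Lemma runs_list_returns W n (E : digraph n) s o :
  base n W s -> mat (arr s 0) (edge_rel E) ->
  search_order E (arr s) o -> (forall v, v \in o) ->
  runs W list_returns s (20 * (n * n) + 60 * n + 20)
    (fun s' => forall c : 'I_n, returns_listed E (arr s') c).
Proof.
move=> B ME [uo o9 root par] oT; have nW := base_nW B; have nW3 := base_3nW B.
pose Inv k s' := forall c : 'I_n, c < k -> returns_listed E (arr s') c.
eapply (@runs_le _ _ _ _ _ (Inv n)).
- eapply runs_for; try by_base B.
  + exact: ltnW.
  move=> k s' kn s'k fr Is'; have B' := base_frame fr isT B.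
  have ME' : mat (arr s' 0) (edge_rel E) by rewrite fr.2.
  pose c := Ordinal kn.
  have [p s'p] : exists p : 'I_n, arr s' 10 c = p.
    rewrite fr.2 //; have [i0|] := posnP (index c o); last first.
      by case/(par c (oT c)) => p [-> _ _ _]; exists p.
    by have [c0 ->] := root c (oT c) i0; exists c; rewrite c0.
  have pn := ltn_ord p.
  apply: runs_seq; apply: runs_seq; apply: runs_assign;
    rewrite /= s'k (base_0 B') addn0; first lia.
  apply: runs_seq; apply: runs_assign; rewrite /= /upd /= s'k s'p; first lia.
  apply: runs_seq; apply: runs_assign; rewrite /= /upd /= (base_0 B') (base_n B') addn0; first lia.
  apply: runs_assign; rewrite /= /upd /= (base_0 B') addn0; first lia.
  set s1 := set_reg _ _ _; have B1 : base n W s1 by case: B'; split.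
  have ME1 : mat (arr s1 0) (edge_rel E) by [].
  have run2 := runs_frame (@runs_middle W n 0 0 s1 c p n p _ _ B1 erefl erefl erefl erefl ME1 ME1).
  apply: runs_seq; apply: (runs_le run2) (leqnn _) => s2 [mid fr2].
  have [z s2z alt] : exists2 z : 'I_n, reg s2 23 = z & edge_rel E c z /\ edge_rel E z p \/
        z = p /\ forall q, edge_rel E c q -> edge_rel E q p -> False.
    case: mid => [[q [cq qp _ ->]]|[none ->]]; first by exists q; auto.
    exists p => //; right; split=> // q cq qp.
    by have := none q cq qp; have := ltn_ord q; lia.
  have [s2k s2p s2n] : [/\ reg s2 10 = k, reg s2 21 = p & reg s2 0 = n].
    by rewrite !fr2.1 //= /upd /= s'k (base_n B').
  have s2A a : arr s2 a = arr s' a by rewrite fr2.2.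
  apply: runs_seq; apply/runs_seq/runs_write/runs_write.
  rewrite /= s2k s2p.
  apply: runs_seq; apply: runs_seq; apply: runs_assign; rewrite /= s2k s2n; first lia.
  apply/runs_seq/runs_write/runs_write; rewrite /= /upd /= s2z s2k.
  apply: runs_seq; apply: runs_assign; rewrite /= /upd /= s2n; first lia.
  apply/runs_seq/runs_write/runs_write => d; rewrite ltnS leq_eqVlt /= /upd /= s2z s2p.
  have dn := ltn_ord d; case: (eqVneq (d : nat) k) => [dk _|Ndk /= /Is'].
    have -> : d = c by apply: ord_inj.
    exists p, z; rewrite /entry /= !s2A s'p; split=> //; rewrite /c /=;
      by do ?[case: eqP => //; try lia].
  case=> p' [z' [d10 [e1 e2] [e3 e4] [e5 e6] alt']]; exists p', z'; rewrite /entry /= !s2A.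
  split=> //; by do ?[case: eqP => //; try lia].
- by move=> s' Is' c; apply: Is'.
- nia.
Qed.

Lemma listing_returns n (E : digraph n) A :
  (forall c : 'I_n, returns_listed E A c) -> listing n A.
Proof.
move=> ret k lt_k; have [kn|nk] := ltnP k n.
  by have [p [z [_ e _ _ _]]] := ret (Ordinal kn); exists p, (Ordinal kn).
have [kn|nk2] := ltnP k (n + n).
  have lt : k - n < n by lia.
  have [p [z [_ _ e _ _]]] := ret (Ordinal lt); exists (Ordinal lt), z.
  by move: e => /=; rewrite subnKC.
have lt : k - (n + n) < n by lia.
have [p [z [_ _ _ e _]]] := ret (Ordinal lt); exists z, p.
by move: e => /=; have -> : n + (k - (n + n)) + n = k by lia.
Qed.

(** By induction along the search order, every vertex is connected with the root in both directions:
    the tree edge comes from an earlier vertex, and the listed return path leads back to it. *)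
Lemma listed_returns_sc n (E : digraph n) A o :
  cycles_at_most 3 E -> loopless E -> strongly_connected E ->
  search_order E A o -> (forall v, v \in o) ->
  (forall c : 'I_n, returns_listed E A c) -> strongly_connected (listed A E).
Proof.
move=> short noloop scE [uo o9 root par] oT ret u v.
have n_gt0 : 0 < n by apply: leq_ltn_trans (ltn_ord u).
pose r := Ordinal n_gt0; set e := edge_rel (listed A E).
suff rw w : connect e r w /\ connect e w r.
  by apply: connect_trans (proj2 (rw u)) (proj1 (rw v)).
have [m le_m] := ubnP (index w o); elim: m w le_m => // m IHm w.
rewrite ltnS => le_m; have [i0|i_gt0] := posnP (index w o).
  have -> : w = r by apply: ord_inj; case: (root w (oT w) i0).
  by split; apply: connect0.
have [p [wp _ lt pw]] := par w (oT w) i_gt0.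
have [rp pr] := IHm p (leq_trans lt le_m).
have [p' [z [wp' e1 e2 e3 alt]]] := ret w.
have {p' wp' e1 e2 e3 alt} [e1 e2 e3 alt] : [/\ entry A w p w, entry A (n + w) w z,
    entry A (n + w + n) z p &
    edge_rel E w z /\ edge_rel E z p \/
        z = p /\ forall q, edge_rel E w q -> edge_rel E q p -> False].
  by have pp : p' = p by [apply: ord_inj; rewrite -wp' wp]; rewrite -pp.
have wn := ltn_ord w.
split.
  apply: connect_trans rp (connect1 _); apply/listedP; split=> //.
  by exists w => //; lia.
apply: connect_trans pr.
have Lwz : edge_rel E w z -> e w z.
  by move=> wz; apply/listedP; split=> //; exists (n + w) => //; lia.
have Lzp : edge_rel E z p -> e z p.
  by move=> zp; apply/listedP; split=> //; exists (n + w + n) => //; lia.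
case: alt => [[/Lwz wz /Lzp zp]|[zp none]]; first exact: connect_trans (connect1 wz) (connect1 zp).
(* With no return path of two edges the direct edge exists, and it is listed because [z] equals
   [p]. *)
case: (return_path short noloop (subxx E) pw (scE w p)) => [wp'|[q [wq qp _ _]]].
  by apply: connect1; rewrite -{1}zp Lwz ?zp.
by case: (none q).
Qed.

Definition search_result n (E : digraph n) A := exists o : seq 'I_n,
  [/\ search_order E A o, forall v, v \in o, listing n A & strongly_connected (listed A E)].

Lemma runs_search W n (E : digraph n) s :
  base n W s -> mat (arr s 0) (edge_rel E) ->
  cycles_at_most 3 E -> loopless E -> strongly_connected E ->
  runs W search s (60 * (n * n) + 200 * n + 100) (fun s' => search_result E (arr s')).
Proof.
move=> B ME short noloop scE.
eapply (@runs_le _ _ _ _ _ (fun s' => search_result E (arr s'))); [|by []|].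
- apply: runs_seq; apply: (runs_le (runs_frame (runs_clear_visited B))) (leqnn _).
  move=> s1 [vis1 fr1]; have B1 := base_frame fr1 isT B.
  apply: runs_seq; apply: (runs_le (runs_frame (runs_start_search E B1 vis1))) (leqnn _).
  move=> s2 [I2 fr2]; have B2 := base_frame fr2 isT B1.
  have ME2 : mat (arr s2 0) (edge_rel E) by rewrite fr2.2 // fr1.2.
  apply: runs_seq; apply: (runs_le (runs_frame (runs_visit_all B2 ME2 scE I2))) (leqnn _).
  move=> s3 [[o so oT] fr3]; have B3 := base_frame fr3 isT B2.
  have ME3 : mat (arr s3 0) (edge_rel E) by rewrite fr3.2.
  apply: (runs_le (runs_frame (runs_list_returns B3 ME3 so oT))) (leqnn _).
  move=> s4 [ret fr4]; exists o.
  have so4 : search_order E (arr s4) o.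
    have [uo o9 root par] := so; split=> // v vo; rewrite !fr4.2 //.
    - exact: o9.
    - exact: root.
    - exact: par.
  split=> //; first exact: listing_returns ret.
  exact: listed_returns_sc so4 oT ret.
- lia.
Qed.

(** * Marking edges and computing the potential *)

(** Adding register 5, which holds 0, copies a register. Register 0 as [c] excludes no vertex, since
    n is not one; as [r] it makes the value n signal failure. *)
Definition ask a b x y c r :=
  Seq (Assign 20 (Add x 5)) (Seq (Assign 21 (Add y 5)) (Seq (Assign 22 (Add c 5))
    (Seq (Assign 23 (Add r 5)) (middle a b)))).

Lemma runs_ask W n a b rx ry rc rr s (x y : 'I_n) c r P Q :
  base n W s -> reg s rx = x -> reg s ry = y -> reg s rc = c -> reg s rr = r ->
  [&& ry != 20, rc != 20, rc != 21, rr != 20, rr != 21 & rr != 22] ->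
  c <= n -> r <= n ->
  mat (arr s a) P -> mat (arr s b) Q ->
  runs W (ask a b rx ry rc rr) s (20 * n + 30)
    (fun s' => middle_spec P Q x y c r s' /\ frame (ask a b rx ry rc rr) s s').
Proof.
move=> B sx sy sc sr /and5P[y20 c20 c21 r20 /andP[r21 r22]] cn rn sa sb.
have nW := base_nW B; have xn := ltn_ord x; have yn := ltn_ord y.
apply: runs_frame.
eapply (@runs_le _ _ _ _ _ (middle_spec P Q x y c r)); [|by []|].
- apply: runs_seq; apply: runs_assign; rewrite /= (base_0 B) sx addn0; first lia.
  apply: runs_seq; apply: runs_assign; rewrite /= /upd (negPf y20) (base_0 B) sy addn0; first lia.
  apply: runs_seq; apply: runs_assign;
    rewrite /= /upd (negPf c20) (negPf c21) (base_0 B) sc addn0; first lia.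
  apply: runs_seq; apply: runs_assign;
    rewrite /= /upd (negPf r20) (negPf r21) (negPf r22) (base_0 B) sr addn0; first lia.
  by apply: runs_middle => //; case: B; split.
- lia.
Qed.

(** Only listed pairs are ever marked, so all pairs in [P] must be listed. For necessary edges and
    stars this holds because the listed edges form an SCSS. *)
Lemma runs_mark_edges W n c a s T (P : rel 'I_n) :
  base n W s -> listing n (arr s) ->
  all (fun x => x \notin regs_written c) [:: 6; 9; 10] ->
  all (fun a => a \notin arrs_written c) [:: 11; 12] ->
  (forall u v : 'I_n, arr s a (cell u v) = 0) ->
  (forall u v, P u v -> exists2 k, k < 3 * n & entry (arr s) k u v) ->
  (forall s' (x y : 'I_n), reg s' 12 = x -> reg s' 13 = y -> frame (each_edge c) s s' ->
     runs W c s' T (fun s'' =>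
       arr s'' a = if P x y then upd (arr s' a) (cell x y) 1 else arr s' a)) ->
  runs W (each_edge c) s (3 * n * (T + 4) + 2) (fun s' => mat (arr s' a) P).
Proof.
move=> B ls c1 c2 a0 Pls step.
pose Inv k (A : nat -> nat -> nat) (_ : nat) :=
  (forall u v : 'I_n, A a (cell u v) = 0 \/ P u v /\ A a (cell u v) = 1) /\
  (forall j x y, j < k -> entry (arr s) j x y -> P x y -> A a (cell x y) = 1).
eapply (@runs_le _ _ _ _ _ (fun s' => Inv (3 * n) (arr s') (reg s' 3))).
- eapply (@runs_each_edge _ _ _ _ _ Inv B ls) => //.
    by split=> // u v; left.
  move=> k s' x y lt_k exy s'x s'y fr [I1 I2].
  apply: (runs_le (step s' x y s'x s'y fr)) (leqnn _) => s2 s2a; rewrite /Inv s2a.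
  have upd_same (u v : 'I_n) : cell u v = cell x y -> u = x /\ v = y by apply: cell_inj.
  split=> [u v|j u v].
    case: ifP => Pxy; last exact: I1.
    rewrite /upd; case: eqP => [/upd_same[-> ->]|_]; [by right | exact: I1].
  rewrite ltnS leq_eqVlt => /orP[/eqP->|jk] euv Puv.
    case: exy euv => ex ey [eu ev].
    have ux : u = x by apply: ord_inj; rewrite -eu ex.
    have vy : v = y by apply: ord_inj; rewrite -ev ey.
    by rewrite -ux -vy Puv /upd eqxx.
  by case: ifP => Pxy; rewrite /upd; [case: eqP => // _|]; apply: (I2 j).
- move=> s' [I1 I2] u v; case: (I1 u v) => [z|[-> ->] //].
  case Puv: (P u v) => //; have [k lt_k e] := Pls u v Puv.
  by rewrite (I2 k u v).
- exact: leqnn.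
Qed.

(** Register 27 keeps the one third vertex that is tested; by [redundant_unique] no other candidate
    has to be tried. *)
Definition clear_if_redundant :=
  Seq (ask 0 0 13 12 0 0) (Seq (Assign 27 (Add 23 5))
    (IfLt 27 0
       (Seq (ask 0 0 12 27 13 0)
          (IfLt 23 0
             (Seq (ask 0 0 27 13 12 0)
                (IfLt 23 0 (Assign 26 (Const 0)) Skip))
             Skip))
       Skip)).

Definition mark_necessary :=
  each_edge (test 0 12 13
    (Seq (Assign 26 (Const 1))
       (Seq clear_if_redundant (IfLt 5 26 (put 5 12 13 6) Skip)))
    Skip).

Lemma middle_detour n (E : digraph n) x y c s :
  middle_spec (edge_rel E) (edge_rel E) x y (c : 'I_n) n s ->
  (reg s 23 < n) = detour E x y c.
Proof.
case=> [[q [xq qy Nqc ->]]|[none ->]].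
  by rewrite ltn_ord; apply/esym/existsP; exists q; rewrite xq qy.
rewrite ltnn; apply/esym/negbTE/negP=> /existsP[q /and3P[xq qy /negP[]]].
by apply/eqP/ord_inj/none.
Qed.

Lemma runs_clear_if_redundant W n s (E : digraph n) (x y : 'I_n) :
  base n W s -> mat (arr s 0) (edge_rel E) ->
  cycles_at_most 3 E -> loopless E -> chordless E ->
  reg s 12 = x -> reg s 13 = y -> reg s 26 = 1 -> edge_rel E x y ->
  runs W clear_if_redundant s (60 * n + 100)
    (fun s' => reg s' 26 = ~~ redundant E x y).
Proof.
move=> B ME short noloop nochord sx sy sf xy.
have nW := base_nnW B; have nW' := base_nW B.
have [xn yn] := (ltn_ord x, ltn_ord y).
eapply (@runs_le _ _ _ _ _ (fun s' => reg s' 26 = ~~ redundant E x y)).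
- apply: runs_seq.
  eapply runs_le; [eapply (@runs_ask W n 0 0 13 12 0 0 s y x n n);
    by [|exact: base_n B] | | exact: leqnn].
  move=> s3 [mid3 fr3]; have B3 := base_frame fr3 isT B.
  have s3_23 : reg s3 23 <= n.
    by case: mid3 => [[q [_ _ _ ->]]|[_ ->]] //; apply: ltnW.
  have [s3x s3y s3f] : [/\ reg s3 12 = x, reg s3 13 = y & reg s3 26 = 1].
    by rewrite !fr3.1.
  apply: runs_seq; apply: runs_assign; rewrite /= (base_0 B3) addn0; first lia.
  apply: runs_if; rewrite /= /upd /= (base_n B3) => zn; last first.
    apply: runs_skip; rewrite /= /upd /= s3f.
    case red: (redundant E x y) => //; case/andP: red => _ /existsP[z /and4P[yz zx _ _]].
    case: mid3 => [[q [_ _ _ q23]]|[none _]]; first by have := ltn_ord q; lia.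
    by have := none z yz zx; have := ltn_ord z; lia.
  have [z [yz zx s3z]] : exists z : 'I_n, [/\ edge_rel E y z, edge_rel E z x & reg s3 23 = z].
    by case: mid3 => [[q [yq qx _ ->]]|[_ e]]; [exists q | lia].
  set s4 := set_reg _ _ _; have B4 : base n W s4 by case: B3; split.
  have ME4 : mat (arr s4 0) (edge_rel E) by rewrite /= fr3.2.
  have redE : redundant E x y = detour E x z y && detour E z y x.
    rewrite /redundant xy; apply/existsP/idP => [[z' /and4P[yz' z'x d1 d2]]|/andP[d1 d2]].
      have red : redundant E x y.
        by rewrite /redundant xy; apply/existsP; exists z'; apply/and4P.
      by rewrite -(redundant_unique short noloop nochord red yz' z'x yz zx) d1.
    by exists z; apply/and4P.
  apply: runs_seq; eapply runs_le; [eapply (@runs_ask W n 0 0 12 27 13 0 s4 x z y n);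
    by [|exact: base_n B4|exact: ltnW] | | exact: leqnn].
  move=> s5 [mid5 fr5]; have B5 := base_frame fr5 isT B4.
  have d5 := middle_detour mid5.
  have [s5x s5y s5f s5z] : [/\ reg s5 12 = x, reg s5 13 = y, reg s5 26 = 1 & reg s5 27 = z].
    by rewrite !fr5.1 //= /upd.
  apply: runs_if; rewrite (base_n B5) => d5'; last first.
    by apply: runs_skip; rewrite s5f redE -d5 ltnNge d5'.
  rewrite d5' in d5.
  have ME5 : mat (arr s5 0) (edge_rel E) by rewrite fr5.2.
  apply: runs_seq; eapply runs_le; [eapply (@runs_ask W n 0 0 27 13 12 0 s5 z y x n);
    by [|exact: base_n B5|exact: ltnW] | | exact: leqnn].
  move=> s6 [mid6 fr6]; have B6 := base_frame fr6 isT B5.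
  have d6 := middle_detour mid6.
  apply: runs_if; rewrite (base_n B6) => d6'.
    by apply: runs_assign => //; rewrite /= /upd /= redE -d5 -d6 d6'.
  by apply: runs_skip; rewrite fr6.1 // s5f redE -d6 ltnNge d6' andbF.
- by [].
- lia.
Qed.

Lemma runs_mark_necessary W n s (E : digraph n) :
  base n W s -> mat (arr s 0) (edge_rel E) -> search_result E (arr s) ->
  (forall u v : 'I_n, arr s 5 (cell u v) = 0) ->
  cycles_at_most 3 E -> loopless E -> chordless E ->
  runs W mark_necessary s (200 * (n * n) + 400 * n + 2)
    (fun s' => mat (arr s' 5) (edge_rel (necessary E))).
Proof.
move=> B ME [o [so oT ls scL]] A5 short noloop nochord.
have nW := base_nnW B; have nW' := base_nW B.
eapply (@runs_le _ _ _ _ _ (fun s' => mat (arr s' 5) (edge_rel (necessary E)))).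
- eapply (@runs_mark_edges _ _ _ _ _ _ _ B ls) => //.
    move=> u v Nuv.
    suff: edge_rel (listed (arr s) E) u v by case/listedP.
    by apply: necessary_scss Nuv => //; split=> //; apply: listed_sub.
  move=> s1 x y s1x s1y fr1; have B1 := base_frame fr1 isT B.
  have ME1 : mat (arr s1 0) (edge_rel E) by rewrite fr1.2.
  have [xn yn] := (ltn_ord x, ltn_ord y).
  eapply runs_test; try by_base B1.
    move=> xy; apply: runs_seq; apply: runs_assign; rewrite /=; first lia.
    set s2 := set_reg _ _ _; have B2 : base n W s2 by case: B1; split.
    have run3 := runs_frame (runs_clear_if_redundant B2 ME1 short noloop nochord s1x s1y erefl xy).
    apply: runs_seq; apply: (runs_le run3) (leqnn _) => s3 [s3f fr3].
    have B3 := base_frame fr3 isT B2.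
    have [s3x s3y s3A] : [/\ reg s3 12 = x, reg s3 13 = y & arr s3 5 = arr s1 5].
      by rewrite !fr3.1 ?fr3.2.
    apply: runs_if; rewrite (base_0 B3) s3f => red.
      eapply runs_put; try by_base B3.
      rewrite /= /upd /= s3A necessaryE xy /=.
      by case: (redundant E x y) red.
    apply: runs_skip; rewrite s3A necessaryE xy /=.
    by case: (redundant E x y) red.
  by move=> /negPf Nxy; apply: runs_skip; rewrite necessaryE Nxy.
- by [].
- nia.
Qed.

Definition mark_stars :=
  each_edge (test 5 12 13
    (test 0 13 12 Skip (Seq (ask 5 5 13 12 0 0) (IfLt 23 0 Skip (put 6 12 13 6))))
    Skip).

Lemma runs_mark_stars W n s (E : digraph n) :
  base n W s -> mat (arr s 0) (edge_rel E) -> search_result E (arr s) ->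
  mat (arr s 5) (edge_rel (necessary E)) ->
  (forall u v : 'I_n, arr s 6 (cell u v) = 0) ->
  cycles_at_most 3 E -> loopless E -> chordless E ->
  runs W mark_stars s (200 * (n * n) + 400 * n + 2)
    (fun s' => mat (arr s' 6) (star E)).
Proof.
move=> B ME [o [so oT ls scL]] NE A6 short noloop nochord.
have nW := base_nnW B; have nW' := base_nW B.
eapply (@runs_le _ _ _ _ _ (fun s' => mat (arr s' 6) (star E))).
- eapply (@runs_mark_edges _ _ _ _ _ _ _ B ls) => //.
    move=> u v /star_necessary Nuv.
    suff: edge_rel (listed (arr s) E) u v by case/listedP.
    by apply: necessary_scss Nuv => //; split=> //; apply: listed_sub.
  move=> s1 x y s1x s1y fr1; have B1 := base_frame fr1 isT B.
  have ME1 : mat (arr s1 0) (edge_rel E) by rewrite fr1.2.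
  have NE1 : mat (arr s1 5) (edge_rel (necessary E)) by rewrite fr1.2.
  have [xn yn] := (ltn_ord x, ltn_ord y).
  eapply runs_test; try by_base B1.
    move=> xy; eapply runs_test; rewrite /probe /= /upd /=; try by_base B1.
      by move=> yx; apply: runs_skip; rewrite /star yx andbF.
    move=> Nyx; set s2 := set_reg _ _ _; have B2 : base n W s2 by case: B1; split.
    have NE2 : mat (arr s2 5) (edge_rel (necessary E)) by [].
    apply: runs_seq; eapply runs_le; [eapply (@runs_ask W n 5 5 13 12 0 0 s2 y x n n);
          by [|exact: base_n B2] | | exact: leqnn].
    move=> s3 [mid3 fr3]; have B3 := base_frame fr3 isT B2.
    have [s3x s3y] : reg s3 12 = x /\ reg s3 13 = y by rewrite !fr3.1.
    have s3A : arr s3 6 = arr s1 6 by rewrite fr3.2.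
    apply: runs_if; rewrite (base_n B3) => zn.
      apply: runs_skip; rewrite s3A /star xy Nyx /=.
      case: mid3 => [[q [yq qx _ _]]|[_ e]]; last by lia.
      by rewrite (introT existsP) //; exists q; rewrite yq.
    eapply runs_put; try by_base B3.
    rewrite /= /upd /= s3A /star xy Nyx /=.
    rewrite (introF existsP) // => -[q /andP[yq qx]].
    case: mid3 => [[z [_ _ _ z23]]|[none _]]; first by have := ltn_ord z; lia.
    by have := none q yq qx; have := ltn_ord q; lia.
  by move=> /negPf Nxy; apply: runs_skip; rewrite /star Nxy.
- by [].
- nia.
Qed.

Definition weigh :=
  test 5 13 12 (get 28 6 13 12)
    (Seq (ask 0 0 12 13 0 5) (Seq (Assign 27 (Add 23 5))
       (Seq (get 28 6 12 27) (Seq (get 29 6 27 13) (Assign 28 (Add 28 29)))))).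

(** Vertices come in search order, so the value at the parent is known. That value plus the result
    of [weigh] is at most 3, and one conditional subtraction of 2 reduces it to a bit. *)
Definition set_parity :=
  for_loop 10 0 (Seq (Assign 12 (Read 9 10))
    (IfLt 5 10
       (Seq (Assign 13 (Read 10 12))
       (Seq weigh
       (Seq (Assign 14 (Read 7 13))
       (Seq (Assign 28 (Add 28 14))
       (Seq (IfLt 6 28 (Assign 28 (Defs.Sub 28 25)) Skip)
          (Write 7 12 28))))))
       (Write 7 12 5))).

Lemma runs_weigh W n s (E : digraph n) (p c : 'I_n) :
  base n W s -> mat (arr s 0) (edge_rel E) ->
  mat (arr s 5) (edge_rel (necessary E)) -> mat (arr s 6) (star E) ->
  cycles_at_most 3 E -> loopless E -> chordless E ->
  reg s 13 = p -> reg s 12 = c -> edge_rel E p c ->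
  runs W weigh s (20 * n + 60)
    (fun s' => reg s' 28 <= 2 /\ odd (reg s' 28) = weight E p c).
Proof.
move=> B ME NE SE short noloop nochord sp sc pc.
have nW := base_nnW B; have nW' := base_nW B; have cn := ltn_ord c.
eapply (@runs_le _ _ _ _ _ (fun s' => reg s' 28 <= 2 /\ odd (reg s' 28) = weight E p c)).
- eapply runs_test; try by_base B.
    move=> Npc; eapply runs_get; rewrite /probe /= /upd /=; try by_base B.
    by rewrite weight_necessary //; case: (star E p c).
  move=> Npc; set s2 := probe _ _ _ _; have B2 : base n W s2 by case: B; split.
  have ME2 : mat (arr s2 0) (edge_rel E) by [].
  apply: runs_seq; eapply runs_le; [eapply (@runs_ask W n 0 0 12 13 0 5 s2 c p n 0);
    by [|exact: base_n B2|exact: base_0 B2] | | exact: leqnn].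
  move=> s3 [mid3 fr3]; have B3 := base_frame fr3 isT B2.
  have red := necessary_or_redundant pc Npc.
  have [z [cz zp s3z]] : exists z : 'I_n, [/\ edge_rel E c z, edge_rel E z p & reg s3 23 = z].
    case: mid3 => [[z [cz zp _ s3z]]|[none _]]; first by exists z.
    have [_ /existsP[z /and4P[cz zp _ _]]] := andP red.
    by have := none z cz zp; have := ltn_ord z; lia.
  have zn := ltn_ord z.
  have [s3p s3c] : reg s3 13 = p /\ reg s3 12 = c by rewrite !fr3.1.
  have SE3 : mat (arr s3 6) (star E) by rewrite fr3.2.
  apply: runs_seq; apply: runs_assign; rewrite /= (base_0 B3) addn0 s3z; first lia.
  apply: runs_seq; eapply runs_get; rewrite /= /upd /=; try by_base B3.
  apply: runs_seq; eapply runs_get; rewrite /= /upd /=; try by_base B3.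
  apply: runs_assign; rewrite /= /upd /=; first by case: (star E c z); case: (star E z p); lia.
  rewrite (weight_redundant short noloop nochord red cz zp).
  by case: (star E c z); case: (star E z p).
- by [].
- lia.
Qed.

Lemma runs_set_parity W n s (E : digraph n) :
  base n W s -> mat (arr s 0) (edge_rel E) -> search_result E (arr s) ->
  mat (arr s 5) (edge_rel (necessary E)) -> mat (arr s 6) (star E) ->
  cycles_at_most 3 E -> loopless E -> chordless E -> strongly_connected E ->
  runs W set_parity s (20 * (n * n) + 100 * n + 2)
    (fun s' => exists2 phi, is_potential E phi & forall v : 'I_n, arr s' 7 v = phi v).
Proof.
move=> B ME [o [[uo o9 root par] oT _ _]] NE SE short noloop nochord scE.
have nW := base_nnW B; have nW' := base_nW B.
have so : size o = n by rewrite -(card_uniqP uo) (eq_card oT) card_ord.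
(* Quantifying over [r] names the root without assuming n > 0. The value at [v] is the weight of
   some walk from the root, as [walks_potential] requires. *)
pose good (A : nat -> nat -> nat) (v : 'I_n) := forall r : 'I_n, r = 0 :> nat -> exists p,
  [/\ path (edge_rel E) r p, last r p = v & A 7 v = walk_weight E r p :> nat].
pose Inv k s' := forall v : 'I_n, index v o < k -> good (arr s') v.
eapply (@runs_le _ _ _ _ _ (Inv n)).
- eapply runs_for; try by_base B.
  + exact: ltnW.
  move=> k s' kn s'k fr Is'; have B' := base_frame fr isT B.
  have [c _ ck] : exists2 c, c \in o & index c o = k by apply: index_surj; rewrite ?so.
  have cn := ltn_ord c.
  have other A x w : x = c -> (forall v : 'I_n, index v o < k -> good (arr s') v) ->
      A 7 = upd (arr s' 7) x w ->
      good (fun=> upd (arr s' 7) x w) c -> forall v : 'I_n, index v o < (index c o).+1 -> good A v.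
    move=> -> old A7 goodc v; rewrite ck ltnS leq_eqVlt => /orP[/eqP vk|lt].
      have -> : v = c by rewrite -(nth_index c (oT v)) vk -ck nth_index.
      by move=> r r0; have [p [? ? ?]] := goodc r r0; exists p; rewrite A7.
    move=> r r0; have [p [pE lp pv]] := old v lt r r0; exists p; split=> //.
    by rewrite A7 /upd; case: eqP => // /ord_inj vc; rewrite vc ck ltnn in lt.
  apply: runs_seq; apply: runs_assign; rewrite /= s'k fr.2 // -ck o9 //; first lia.
  apply: runs_if; rewrite /= /upd /= (base_0 B') s'k => k0.
    have [p [cp _ lt_pc pc]] : exists u : 'I_n, [/\ arr s 10 c = u, u \in o, index u o < index c o & edge_rel E u c].
      by apply: par => //; rewrite ck.
    have pn := ltn_ord p.
    apply: runs_seq; apply: runs_assign; rewrite /= /upd /= fr.2 // cp; first lia.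
    set s2 := set_reg _ _ _; have B2 : base n W s2 by case: B'; split.
    have [ME2 NE2 SE2] : [/\ mat (arr s2 0) (edge_rel E), mat (arr s2 5) (edge_rel (necessary E))
        & mat (arr s2 6) (star E)] by rewrite /= !fr.2.
    apply: runs_seq.
    apply: (runs_le (runs_frame (runs_weigh B2 ME2 NE2 SE2 short noloop nochord erefl erefl pc))) (leqnn _).
    move=> s3 [[d2 dw] fr3]; have B3 := base_frame fr3 isT B2.
    have [s3p s3c] : reg s3 13 = p /\ reg s3 12 = c by rewrite !fr3.1.
    have s37 : arr s3 7 = arr s' 7 by rewrite fr3.2.
    have p01 : arr s' 7 p <= 1.
      have r_lt : 0 < n by lia.
      have lt_pk : index p o < k by rewrite -ck.
      by have [q [_ _ ->]] := Is' p lt_pk (Ordinal r_lt) erefl; case: (walk_weight _ _ _).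
    apply: runs_seq; apply: runs_assign; rewrite /= s3p s37; first lia.
    apply: runs_seq; apply: runs_assign; rewrite /= /upd /=; first lia.
    pose m := reg s3 28 + arr s' 7 p.
    have goodc w : w <= 1 -> odd w = odd m -> good (fun=> upd (arr s' 7) c w) c.
      move=> w1 wm r r0; have lt_pk : index p o < k by rewrite -ck.
      have [q [qE lq pq]] := Is' p lt_pk r r0; exists (rcons q c).
      rewrite rcons_path last_rcons qE lq pc /upd eqxx; split=> //.
      rewrite -cats1 walk_weight_cat lq /= addbF -dw.
      have -> : w = odd w by case: (w) w1 => [|[|?]].
      by rewrite wm oddD pq addbC; case: (walk_weight _ _ _).
    apply: runs_seq; apply: runs_if; rewrite /= /upd /= (base_1 B3) => m1.
      apply: runs_assign; rewrite /= /upd /= (base_2 B3); first lia.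
      apply: runs_write; rewrite /Inv /= /upd /= s3c.
      apply: (other _ _ _ erefl Is') => /=; first by rewrite s37.
      apply: goodc; first lia.
      by rewrite oddB ?addbF //; lia.
    apply: runs_skip; apply: runs_write; rewrite /Inv /= /upd /= s3c.
    apply: (other _ _ _ erefl Is') => /=; first by rewrite s37.
    exact: goodc.
  apply: runs_write; rewrite /Inv /= /upd /= (base_0 B').
  apply: (other _ _ _ erefl Is') => //= r r0; exists [::]; split=> //=; last by rewrite /upd eqxx.
  apply: ord_inj; have [|-> _] := root c (oT c); last by [].
  by rewrite ck; lia.
- move=> s' Is'.
  have lt_io v : index v o < n by apply: (@leq_trans (size o)); rewrite ?index_mem ?so.
  exists (fun v => odd (arr s' 7 v)).
    move=> x y xy; have r_lt : 0 < n by have := ltn_ord x; lia.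
    pose r := Ordinal r_lt;
    refine (@walks_potential _ E short noloop nochord r (fun v => odd (arr s' 7 v))
      scE _ x y xy) => v.
    have [|p [pE lp pv]] := Is' v _ r erefl; first exact: lt_io.
    by exists p; rewrite pv; case: (walk_weight _ _ _).
  move=> v; have r_lt : 0 < n by have := ltn_ord v; lia.
  have [|p [pE lp ->]] := Is' v _ (Ordinal r_lt) erefl; first exact: lt_io.
  by case: (walk_weight _ _ _).
- nia.
Qed.

(** * Writing the cover instance *)

(* Appends the edge (register 33, register 34) unless it is already listed, and
   records the cell to select for it (register 35, shifted by one) in array 13. *)
Definition link l r f :=
  Seq (Seq (Assign 33 (Add l 5)) (Seq (Assign 34 (Add r 5)) (Assign 35 (Add f 5))))
  (Seq (Seq (Assign 14 (Mul 33 1)) (Seq (Assign 14 (Add 14 34)) (Assign 16 (Read 13 14))))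
  (Seq (IfLt 5 16 Skip
          (Seq (Write 1 3 33) (Seq (Write 2 3 34) (Assign 3 (Add 3 6)))))
       (Seq (Assign 16 (Add 35 6)) (Write 13 14 16)))).

(** A star occupies one side only, so its twin needs one pendant edge; every other cell needs one on
    each side. The last two links belong to the index n^2 + 1, held in register 7. *)
Definition isolate_unused :=
  Seq (for_loop 10 0 (for_loop 11 0
    (Seq (Seq (Assign 14 (Mul 10 0)) (Assign 36 (Add 14 11)))
       (test 6 10 11
          (Seq (Assign 16 (Read 7 10)) (IfLt 5 16 (link 36 8 8) (link 8 36 8)))
          (Seq (link 36 8 8) (link 8 36 8))))))
  (Seq (link 7 8 8) (link 8 7 8)).

Definition cell_of dst x y := Seq (Assign 14 (Mul x 0)) (Assign dst (Add 14 y)).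

Definition link_star :=
  Seq (Seq (Assign 16 (Read 6 37)) (IfLt 5 16 Skip (Assign 37 (Add 8 5))))
    (Seq (cell_of 38 12 13)
       (Seq (Assign 16 (Read 7 12)) (IfLt 5 16 (link 37 38 36) (link 38 37 36)))).

(** Of the return path y -> q -> x of a star, exactly one edge is redundant. Its cell goes to
    register 36, that of the necessary edge to register 37. *)
Definition join_step :=
  Seq (test 5 11 12
         (Seq (cell_of 36 13 11) (cell_of 37 11 12))
         (Seq (cell_of 36 11 12) (cell_of 37 13 11)))
    link_star.

Definition join_stars :=
  each_edge (test 6 12 13
    (for_loop 11 0 (test 0 13 11 (test 0 11 12 join_step Skip) Skip))
    Skip).

Section Edges.

Variables (n W : nat) (E : digraph n) (phi : 'I_n -> bool).

Local Notation dummy := (n * n).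
Local Notation K := (n * n + 2).

Definition addr l r := l * K + r.

Lemma addr_inj l r l' r' : r < K -> r' < K -> addr l r = addr l' r' -> l = l' /\ r = r'.
Proof.
move=> rK r'K e; have K_gt0 : 0 < K by apply: leq_ltn_trans rK.
split.
  have := congr1 (divn^~ K) e.
  by rewrite /addr !divnMDl // !divn_small // !addn0.
by have := congr1 (modn^~ K) e; rewrite /addr !modnMDl !modn_small.
Qed.

Definition hit (A : nat -> nat -> nat) l r := 0 < A 13 (addr l r).

Definition selects l r f :=
  forced E phi l r /\ f = dummy \/ exists u v : 'I_n, joins E phi u v (l, r) /\ f = cell u v.

Definition edge_list (A : nat -> nat -> nat) m (es : seq (nat * nat)) :=
  [/\ uniq es, size es = m, forall c, c \in es -> c.1 < K /\ c.2 < K,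
      forall k, k < m -> A 1 k = (nth (0, 0) es k).1 /\ A 2 k = (nth (0, 0) es k).2 &
      forall l r, l < K -> r < K -> hit A l r = ((l, r) \in es)].

Definition table A m :=
  (exists es, edge_list A m es) /\
  forall l r, l < K -> r < K -> hit A l r -> selects l r (A 13 (addr l r)).-1.

Lemma selects_lt l r f : selects l r f -> f <= dummy.
Proof. by case=> [[_ ->]//|[u [v [_ ->]]]]; apply/ltnW/cell_lt. Qed.

Lemma addr_bound l r : l < K -> r < K -> (n * n + 3) * (n * n + 3) <= W -> addr l r <= W.
Proof.
rewrite /addr => lK rK; apply: leq_trans.
apply: (@leq_trans (l.+1 * K)); first by rewrite mulSn addnC leq_add2r ltnW.
by apply: leq_mul; lia.
Qed.

Lemma dummy_bound : (n * n + 3) * (n * n + 3) <= W -> 6 * dummy + 9 <= W.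
Proof. by apply: leq_trans; nia. Qed.

(** For a pair already listed only the recorded choice is overwritten; this is sound because the new
    choice satisfies [selects] too. *)
Lemma runs_link rl rr rf s l r f :
  base n W s -> reg s 3 < W -> reg s rl = l -> reg s rr = r -> reg s rf = f ->
  [&& rr != 33, rf != 33 & rf != 34] -> l < K -> r < K ->
  selects l r f -> table (arr s) (reg s 3) ->
  runs W (link rl rr rf) s 30
    (fun s' => [/\ table (arr s') (reg s' 3), reg s' 3 <= (reg s 3).+1,
       hit (arr s') l r & forall l' r', hit (arr s) l' r' -> hit (arr s') l' r']).
Proof.
move=> B s3W sl sr sf /and3P[r33 f33 f34] lK rK sel [[es [ues szes esK esA hites]] sound].
have dW := dummy_bound (base_W B); have f_le := selects_lt sel.
have addr_le := addr_bound lK rK (base_W B).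
set v0 := arr s 13 (addr l r).
have v0W : v0 <= W.
  have [h|] := boolP (hit (arr s) l r); last by rewrite /hit -leqNgt -/v0; lia.
  by have := selects_lt (sound l r lK rK h); rewrite -/v0; lia.
set Post := (fun s' => [/\ table (arr s') (reg s' 3), reg s' 3 <= (reg s 3).+1,
       hit (arr s') l r & forall l' r', hit (arr s) l' r' -> hit (arr s') l' r']).
eapply (@runs_le _ _ _ _ _ Post).
- apply: runs_seq; apply: runs_seq; apply: runs_assign; rewrite /= (base_0 B) sl addn0; first lia.
  apply: runs_seq; apply: runs_assign; rewrite /= /upd (negPf r33) (base_0 B) sr addn0; first lia.
  apply: runs_assign; rewrite /= /upd (negPf f33) (negPf f34) (base_0 B) sf addn0; first lia.
  apply: runs_seq; apply: runs_seq; apply: runs_assign; rewrite /= /upd /= (base_K B).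
    by apply: leq_trans addr_le; rewrite leq_addr.
  apply: runs_seq; apply: runs_assign; rewrite /= /upd /= -/(addr l r) //.
  apply: runs_assign; rewrite /= /upd /= -/v0 //.
  have finish A m es' : edge_list A m es' ->
      A 13 = upd (arr s 13) (addr l r) f.+1 -> m <= (reg s 3).+1 ->
      [/\ table A m, m <= (reg s 3).+1, hit A l r & forall l' r', hit (arr s) l' r' -> hit A l' r'].
    move=> elA A13 m_le; split=> //.
    + split; first by exists es'.
      move=> l' r' l'K r'K; rewrite /hit A13 /upd; case: eqP => [/(addr_inj r'K rK)[-> ->]|_] //.
      exact: sound.
    + by rewrite /hit A13 /upd eqxx.
    + by move=> l' r'; rewrite /hit A13 /upd; case: eqP.
  have hit_upd (A : nat -> nat -> nat) l' r' : r' < K ->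
      A 13 = upd (arr s 13) (addr l r) f.+1 ->
      hit A l' r' = ((l', r') == (l, r)) || hit (arr s) l' r'.
    move=> r'K A13; rewrite /hit A13 /upd; case: eqP => [/(addr_inj r'K rK)[-> ->]|Na].
      by rewrite eqxx.
    by case: eqP => // -[ll rr']; case: Na; rewrite ll rr'.
  apply: runs_seq; apply: runs_if; rewrite /= /upd /= (base_0 B) => v0_0.
    apply: runs_skip; apply: runs_seq; apply: runs_assign; rewrite /= /upd /= (base_1 B) addn1; first lia.
    apply: runs_write; apply: (finish _ _ es) => //=.
    split=> // l' r' l'K r'K; rewrite (hit_upd _ _ _ r'K) //= hites //.
    by case: eqP => // -[-> ->]; rewrite -hites.
  apply/runs_seq/runs_write; apply/runs_seq/runs_write.
  apply: runs_assign; rewrite /= /upd /= (base_1 B) addn1 //.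
  apply: runs_seq; apply: runs_assign; rewrite /= /upd /= (base_1 B) addn1; first lia.
  apply: runs_write; apply: (finish _ _ (rcons es (l, r))) => //=.
  have new : (l, r) \notin es by rewrite -hites // /hit -leqNgt.
  split.
  + by rewrite rcons_uniq new.
  + by rewrite size_rcons szes.
  + by move=> c; rewrite mem_rcons inE => /orP[/eqP->|/esK].
  + move=> k; rewrite ltnS leq_eqVlt /upd /= nth_rcons szes.
    case: (eqVneq k (reg s 3)) => [->|Nk /= lt]; first by rewrite ltnn.
    by rewrite lt; apply: esA.
  + move=> l' r' l'K r'K; rewrite (hit_upd _ _ _ r'K) //= hites //.
    by rewrite mem_rcons inE.
- by [].
- lia.
Qed.

Lemma usedE b x y : used E phi b (cell x y) = star E x y && (phi x == b).
Proof.
apply/existsP/andP=> [[u /existsP[v /and3P[/eqP/cell_inj[-> ->] st ph]]]|[st ph]] //.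
by exists x; apply/existsP; exists y; rewrite eqxx st ph.
Qed.

Lemma forced_left (x y : 'I_n) : forced E phi (cell x y) dummy = ~~ (star E x y && ~~ phi x).
Proof.
have := cell_lt x y; rewrite /forced eqxx /= usedE eqbF_neg => lt.
by rewrite neq_ltn lt andbF orbF.
Qed.

Lemma forced_right (x y : 'I_n) : forced E phi dummy (cell x y) = ~~ (star E x y && phi x).
Proof.
have := cell_lt x y; rewrite /forced eqxx /= usedE eqb_id => lt.
by rewrite neq_ltn lt andbF.
Qed.

Lemma forced_extra : forced E phi dummy.+1 dummy /\ forced E phi dummy dummy.+1.
Proof.
have Nu b : ~~ used E phi b dummy.+1.
  apply/existsP=> -[x /existsP[y /and3P[/eqP e _ _]]].
  by have := cell_lt x y; rewrite -e; lia.
by rewrite /forced !eqxx !Nu !neq_ltn ltnSn !orbT.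
Qed.

Lemma forcedP l r (P : nat -> nat -> Prop) :
  (forall x y : 'I_n, forced E phi (cell x y) dummy -> P (cell x y) dummy) ->
  (forall x y : 'I_n, forced E phi dummy (cell x y) -> P dummy (cell x y)) ->
  P dummy.+1 dummy -> P dummy dummy.+1 ->
  l < K -> r < K -> forced E phi l r -> P l r.
Proof.
move=> P1 P2 P3 P4 lK rK fo.
have cellP i : i < K -> i != dummy -> i = dummy.+1 \/ exists x y : 'I_n, i = cell x y.
  move=> iK Ni; have [->|Ni'] := eqVneq i dummy.+1; first by left.
  have lt : i < dummy by lia.
  have n_gt0 : 0 < n by case: (n) lt.
  have x_lt : i %/ n < n by rewrite ltn_divLR.
  by right; exists (Ordinal x_lt), (Ordinal (ltn_pmod i n_gt0)); rewrite /cell /= -divn_eq.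
case/orP: (fo) => /and3P[/eqP e Nd _].
  rewrite e in fo *.
  by case: (cellP _ lK Nd) fo => [->//|[x [y ->]]]; apply: P1.
rewrite e in fo *.
by case: (cellP _ rK Nd) fo => [->//|[x [y ->]]]; apply: P2.
Qed.

Definition isolated_at A (x y : 'I_n) :=
  (forced E phi (cell x y) dummy -> hit A (cell x y) dummy) /\
  (forced E phi dummy (cell x y) -> hit A dummy (cell x y)).

(** The pair (k, q) is the lexicographic progress of the two nested loops, and each cell contributes
    at most two edges. *)
Definition isolated A m k q :=
  [/\ table A m, m <= 2 * (k * n + q) &
      forall x y : 'I_n, (x < k) || (x == k :> nat) && (y < q) -> isolated_at A x y].

Definition isolate_step :=
  Seq (Seq (Assign 14 (Mul 10 0)) (Assign 36 (Add 14 11)))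
    (test 6 10 11
       (Seq (Assign 16 (Read 7 10)) (IfLt 5 16 (link 36 8 8) (link 8 36 8)))
       (Seq (link 36 8 8) (link 8 36 8))).

Lemma isolated_step A A' m m' (x y : 'I_n) : isolated A m x y ->
  table A' m' -> m' <= m.+2 -> (forall l r, hit A l r -> hit A' l r) ->
  isolated_at A' x y -> isolated A' m' x y.+1.
Proof.
move=> [T2 le2 iso2] T4 le4 mono iso4; split=> //; first lia.
move=> x' y'; rewrite ltnS [y' <= y]leq_eqVlt => h.
have old : (x' < x) || (x' == x :> nat) && (y' < y) -> isolated_at A' x' y'.
  by move=> /iso2[h1 h2]; split=> [/h1|/h2]; apply: mono.
case: (ltnP x' x) h old => /= [_ _ old|_]; first exact: old.
case: eqP => // xx /= h old; case/orP: h => [/eqP yy|]; last exact: old.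
have -> : x' = x by apply: ord_inj.
by have -> : y' = y by apply: ord_inj.
Qed.

Lemma runs_isolate_step s (x y : 'I_n) :
  base n W s -> mat (arr s 6) (star E) -> (forall v : 'I_n, arr s 7 v = phi v) ->
  reg s 10 = x -> reg s 11 = y -> isolated (arr s) (reg s 3) x y ->
  runs W isolate_step s 150 (fun s' => isolated (arr s') (reg s' 3) x y.+1).
Proof.
move=> B SE PH sx sy iso; have [T le _] := iso.
have nW := base_nnW B; have nW' := base_nW B; have dW := dummy_bound (base_W B).
have clt := cell_lt x y; have le3 : reg s 3 <= 2 * (n * n).
  by apply: leq_trans le _; rewrite leq_mul2l ltnW.
have [clK dK] : cell x y < K /\ dummy < K by lia.
eapply (@runs_le _ _ _ _ _ (fun s' => isolated (arr s') (reg s' 3) x y.+1)).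
- apply: runs_seq; apply: runs_seq; apply: runs_assign; rewrite /= sx (base_n B).
    by apply: (@leq_trans (cell x y)); [rewrite leq_addr | lia].
  apply: runs_assign; rewrite /= /upd /= sy -/(cell x y); first lia.
  set s3 := set_reg _ _ _; have B3 : base n W s3 by case: B; split.
  have s3W : reg s3 3 < W by rewrite /= /upd /=; lia.
  have T3 : table (arr s3) (reg s3 3) by [].
  eapply runs_test; try by_base B3.
    move=> st; apply: runs_seq; apply: runs_assign; rewrite /= /upd /= sx PH.
      by case: (phi x); lia.
    set s4 := set_reg _ _ _; have B4 : base n W s4 by case: B3; split.
    apply: runs_if; rewrite /= /upd /= (base_0 B) => ph.
      have fo : forced E phi (cell x y) dummy by rewrite forced_left st; case: (phi x) ph.
      have run := @runs_link 36 8 8 s4 (cell x y) dummy dummy B4 s3W erefl (base_d B4)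
        (base_d B4) isT clK dK (or_introl (conj fo erefl)) T3.
      apply: (runs_le run) (leqnn _) => s5 [T5 le5 hit5 mono5].
      apply: isolated_step iso T5 (leqW le5) mono5 _.
      by split=> //; rewrite forced_right st; case: (phi x) ph.
    have fo : forced E phi dummy (cell x y) by rewrite forced_right st; case: (phi x) ph.
    have run := @runs_link 8 36 8 s4 dummy (cell x y) dummy B4 s3W (base_d B4) erefl
      (base_d B4) isT dK clK (or_introl (conj fo erefl)) T3.
    apply: (runs_le run) (leqnn _) => s5 [T5 le5 hit5 mono5].
    apply: isolated_step iso T5 (leqW le5) mono5 _.
    by split=> //; rewrite forced_left st; case: (phi x) ph.
  move=> Nst; set s4 := probe _ _ _ _; have B4 : base n W s4 by case: B3; split.
  have fo1 : forced E phi (cell x y) dummy by rewrite forced_left (negPf Nst).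
  have fo2 : forced E phi dummy (cell x y) by rewrite forced_right (negPf Nst).
  have run := runs_frame (@runs_link 36 8 8 s4 (cell x y) dummy dummy B4 s3W erefl
    (base_d B4) (base_d B4) isT clK dK (or_introl (conj fo1 erefl)) T3).
  apply: runs_seq; apply: (runs_le run) (leqnn _) => s5 [[T5 le5 hit5 mono5] fr5].
  have B5 := base_frame fr5 isT B4.
  have le5' : reg s5 3 <= (reg s 3).+1 by [].
  have s5W : reg s5 3 < W by lia.
  have s5c : reg s5 36 = cell x y by rewrite fr5.1.
  have run6 := @runs_link 8 36 8 s5 dummy (cell x y) dummy B5 s5W (base_d B5) s5c
    (base_d B5) isT dK clK (or_introl (conj fo2 erefl)) T5.
  apply: (runs_le run6) (leqnn _) => s6 [T6 le6 hit6 mono6].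
  apply: (isolated_step iso T6); first lia.
    by move=> l r h; apply/mono6/mono5.
  by split=> // _; apply: mono6.
- by [].
- lia.
Qed.

Lemma runs_isolate_unused s :
  base n W s -> mat (arr s 6) (star E) -> (forall v : 'I_n, arr s 7 v = phi v) ->
  table (arr s) 0 -> reg s 3 = 0 ->
  runs W isolate_unused s (200 * (n * n) + 200 * n + 200)
    (fun s' => [/\ table (arr s') (reg s' 3), reg s' 3 <= 2 * (n * n) + 2 &
       forall l r, l < K -> r < K -> forced E phi l r -> hit (arr s') l r]).
Proof.
move=> B SE PH T0 s0; have nW := base_nnW B; have nW' := base_nW B.
have dW := dummy_bound (base_W B).
set Post := (fun s' => [/\ table (arr s') (reg s' 3), reg s' 3 <= 2 * (n * n) + 2 &
       forall l r, l < K -> r < K -> forced E phi l r -> hit (arr s') l r]).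
have run0 : runs W (for_loop 10 0 (for_loop 11 0 isolate_step)) s (n * (n * 152 + 2).+2 + 2)
    (fun s' => isolated (arr s') (reg s' 3) n 0).
  eapply runs_le; [| |exact: leqnn].
    eapply (@runs_for _ _ _ _ _ _ _ (fun k s' => isolated (arr s') (reg s' 3) k 0));
      try by_base B.
    + exact: ltnW.
    + by split; rewrite /= /upd /= ?s0 // => x y; rewrite andbF.
    move=> k s1 kn s1k fr1 I1; have B1 := base_frame fr1 isT B.
    pose x := Ordinal kn.
    eapply (@runs_le _ _ _ _ _ (fun s' => isolated (arr s') (reg s' 3) k n));
      last exact: leqnn.
      eapply (@runs_for _ _ _ _ _ _ _ (fun q s' => isolated (arr s') (reg s' 3) k q));
        try by_base B1.
        exact: ltnW.
      move=> q s2 qn s2q fr2 I2; have B2 := base_frame fr2 isT B1.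
      pose y := Ordinal qn; have s2x : reg s2 10 = x by rewrite fr2.1.
      have [SE2 PH2] : mat (arr s2 6) (star E) /\ forall v : 'I_n, arr s2 7 v = phi v.
        by rewrite !fr2.2 // !fr1.2.
      exact: (@runs_isolate_step s2 x y B2 SE2 PH2 s2x s2q I2).
    move=> s2 [T2 le2 iso2]; split=> //; first by move: le2; rewrite /= /upd /= mulSn; lia.
    move=> x' y'; rewrite andbF orbF ltnS leq_eqVlt => h; apply: iso2.
    by rewrite ltn_ord andbT orbC.
  by [].
eapply (@runs_le _ _ _ _ _ Post).
- apply: runs_seq; apply: (runs_le (runs_frame run0)) (leqnn _) => s1 [[T1 le1 iso1] fr1].
  have B1 := base_frame fr1 isT B; have [fo1 fo2] := forced_extra.
  have [d1K dK] : dummy.+1 < K /\ dummy < K by lia.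
  have s1W : reg s1 3 < W by lia.
  have run := runs_frame (@runs_link 7 8 8 s1 _ _ _ B1 s1W (base_d1 B1) (base_d B1)
    (base_d B1) isT d1K dK (or_introl (conj fo1 erefl)) T1).
  apply: runs_seq; apply: (runs_le run) (leqnn _) => s2 [[T2 le2 hit2 mono2] fr2].
  have B2 := base_frame fr2 isT B1.
  have s2W : reg s2 3 < W by lia.
  have run3 := @runs_link 8 7 8 s2 _ _ _ B2 s2W (base_d B2) (base_d1 B2) (base_d B2) isT
    dK d1K (or_introl (conj fo2 erefl)) T2.
  apply: (runs_le run3) (leqnn _) => s3 [T3 le3 hit3 mono3].
  split=> //; first lia.
  move=> l r lK rK fo; apply: (@forcedP l r (hit (arr s3))) => //; last exact: mono3.
    move=> x y h; apply/mono3/mono2; have [|h1 _] := iso1 x y; [by rewrite ltn_ord|exact: h1].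
  move=> x y h; apply/mono3/mono2; have [|_ h2] := iso1 x y; [by rewrite ltn_ord|exact: h2].
- by [].
- lia.
Qed.

End Edges.

(** * Instance edges that come from redundant edges *)

Section Joins.

Variables (n W : nat) (E : digraph n) (phi : 'I_n -> bool).

Local Notation dummy := (n * n).
Local Notation K := (n * n + 2).
Local Notation N := (necessary E).
Local Notation table := (table E phi).

Lemma runs_cell_of dst rx ry s (x y : 'I_n) Post :
  base n W s -> reg s rx = x -> reg s ry = y -> ry != 14 ->
  Post (set_reg (set_reg s 14 (x * n)) dst (cell x y)) ->
  runs W (cell_of dst rx ry) s 2 Post.
Proof.
move=> B sx sy y14 Ps; have clt := cell_lt x y; have nW := base_nnW B.
apply: (@runs_seq _ _ _ _ 1 1); apply: runs_assign; rewrite /= sx (base_n B).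
  by apply: (@leq_trans (cell x y)); [rewrite leq_addr | lia].
apply: runs_assign; rewrite /= /upd eqxx (negPf y14) sy // -/(cell x y); lia.
Qed.

Lemma slot_bound (a b : 'I_n) : slot E a b < K.
Proof. by rewrite /slot; have := cell_lt a b; case: ifP; lia. Qed.

Definition grows A m A' m' (c : nat * nat) :=
  [/\ table A' m', m' <= m.+1, hit n A' c.1 c.2
    & forall l r, hit n A l r -> hit n A' l r].

Lemma runs_link_star s (x y u v a b : 'I_n) :
  base n W s -> mat (arr s 6) (star E) -> (forall v : 'I_n, arr s 7 v = phi v) ->
  table (arr s) (reg s 3) -> reg s 3 < W ->
  reg s 12 = x -> reg s 13 = y -> reg s 36 = cell u v -> reg s 37 = cell a b ->
  joins E phi u v (orient (phi x) (cell x y) (slot E a b)) ->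
  runs W link_star s 100 (fun s' => grows (arr s) (reg s 3) (arr s') (reg s' 3)
     (orient (phi x) (cell x y) (slot E a b))).
Proof.
move=> B SE PH T sW sx sy suv sab jo.
have dW := dummy_bound (base_W B); have clt := cell_lt x y.
have cK : cell x y < K by lia.
set Post := (fun s' => grows (arr s) (reg s 3) (arr s') (reg s' 3) _).
eapply (@runs_le _ _ _ _ _ Post).
- apply: runs_seq.
  eapply (@runs_le _ _ _ _ _ (fun s1 => [/\ base n W s1, arr s1 = arr s, reg s1 3 = reg s 3 &
      [/\ reg s1 12 = x, reg s1 13 = y, reg s1 36 = cell u v & reg s1 37 = slot E a b]]));
    last exact: leqnn.
    apply: runs_seq; apply: runs_assign; rewrite /= sab SE; first by case: (star E a b); lia.
    apply: runs_if; rewrite /= /upd /= (base_0 B) => st.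
      apply: runs_skip; split=> //; first by case: B; split.
      by rewrite /= /upd /= /slot; case: (star E a b) st.
    apply: runs_assign; rewrite /= /upd /= (base_0 B) (base_d B) addn0; first lia.
    split=> //; first by case: B; split.
    by rewrite /= /upd /= /slot; case: (star E a b) st.
  move=> s1 [B1 s1A s13 [s1x s1y s1uv s1ab]].
  apply: runs_seq; apply: (@runs_cell_of _ _ _ _ x y) => //.
  apply: runs_seq; apply: runs_assign; rewrite /= /upd /= s1x s1A PH; first by case: (phi x); lia.
  set s2 := set_reg _ _ _; have B2 : base n W s2 by case: B1; split.
  have s2W : reg s2 3 < W by rewrite /= /upd /= s13.
  have s2T : table (arr s2) (reg s2 3) by rewrite /= /upd /= s13 s1A.
  apply: runs_if; rewrite /= /upd /= (base_0 B1) => ph.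
    have phx : phi x by case: (phi x) ph.
    rewrite phx in jo *.
    have sel : selects E phi (slot E a b) (cell x y) (cell u v) by right; exists u, v.
    have run := @runs_link n W E phi 37 38 36 s2 _ _ _ B2 s2W s1ab erefl s1uv isT (slot_bound a b) cK sel s2T.
    apply: (runs_le run) (leqnn _) => s3 [T3 le3 hit3 mono3].
    rewrite /Post phx; split=> //=; first by rewrite -s13.
    by move=> l r h; apply: mono3; rewrite /= s1A.
  have phx : phi x = false by case: (phi x) ph.
  rewrite phx in jo *.
  have sel : selects E phi (cell x y) (slot E a b) (cell u v) by right; exists u, v.
  have run := @runs_link n W E phi 38 37 36 s2 _ _ _ B2 s2W erefl s1ab s1uv isT cK (slot_bound a b) sel s2T.
  apply: (runs_le run) (leqnn _) => s3 [T3 le3 hit3 mono3].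
  rewrite /Post phx; split=> //=; first by rewrite -s13.
  by move=> l r h; apply: mono3; rewrite /= s1A.
- by [].
- lia.
Qed.

Definition join_cell (x y q : 'I_n) :=
  orient (phi x) (cell x y) (if edge_rel N q x then slot E q x else slot E y q).

Lemma runs_join_step s (x y q : 'I_n) :
  base n W s -> mat (arr s 5) (edge_rel N) ->
  mat (arr s 6) (star E) -> (forall v : 'I_n, arr s 7 v = phi v) ->
  table (arr s) (reg s 3) -> reg s 3 < W ->
  reg s 12 = x -> reg s 13 = y -> reg s 11 = q -> star E x y -> triangle E x y q ->
  runs W join_step s 150
    (fun s' => grows (arr s) (reg s 3) (arr s') (reg s' 3) (join_cell x y q)).
Proof.
move=> B NE SE PH T sW sx sy sq st tr; have nW := base_nnW B.
eapply (@runs_le _ _ _ _ _ (fun s' => grows (arr s) (reg s 3) (arr s') (reg s' 3) (join_cell x y q))).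
- apply: runs_seq; eapply runs_test; try by_base B.
    move=> Nqx; set s1 := probe _ _ _ _; have B1 : base n W s1 by case: B; split.
    apply: runs_seq; apply: (@runs_cell_of _ _ _ s1 y q) => //.
    set s2 := set_reg _ _ _; have B2 : base n W s2 by case: B1; split.
    apply: (@runs_cell_of _ _ _ s2 q x) => //.
    set s3 := set_reg _ _ _; have B3 : base n W s3 by case: B2; split.
    rewrite /join_cell Nqx.
    apply: (@runs_link_star s3 x y y q q x B3 SE PH T sW sx sy erefl erefl).
    apply/existsP; exists x; apply/existsP; exists y; apply/existsP; exists q.
    by rewrite st tr Nqx !eqxx.
  move=> Nqx; set s1 := probe _ _ _ _; have B1 : base n W s1 by case: B; split.
  apply: runs_seq; apply: (@runs_cell_of _ _ _ s1 q x) => //.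
  set s2 := set_reg _ _ _; have B2 : base n W s2 by case: B1; split.
  apply: (@runs_cell_of _ _ _ s2 y q) => //.
  set s3 := set_reg _ _ _; have B3 : base n W s3 by case: B2; split.
  rewrite /join_cell (negPf Nqx).
  apply: (@runs_link_star s3 x y q x y q B3 SE PH T sW sx sy erefl erefl).
  apply/existsP; exists x; apply/existsP; exists y; apply/existsP; exists q.
  by rewrite st tr (negPf Nqx) !eqxx.
- by [].
- lia.
Qed.

Definition joined A (x y q : 'I_n) :=
  star E x y -> triangle E x y q -> hit n A (join_cell x y q).1 (join_cell x y q).2.

(** Every star is listed, so 3n rounds of n candidates find all pairs to join; the bound 5n^2 + 2
    adds these 3n^2 links to the 2n^2 + 2 pendant edges. *)
Lemma runs_join_stars s :
  base n W s -> listing n (arr s) -> mat (arr s 0) (edge_rel E) ->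
  mat (arr s 5) (edge_rel N) ->
  mat (arr s 6) (star E) -> (forall v : 'I_n, arr s 7 v = phi v) ->
  (forall x y, star E x y -> exists2 k, k < 3 * n & entry (arr s) k x y) ->
  table (arr s) (reg s 3) -> reg s 3 <= 2 * (n * n) + 2 ->
  runs W join_stars s (1000 * (n * n) + 1000 * n + 1000)
    (fun s' => [/\ table (arr s') (reg s' 3), reg s' 3 <= 5 * (n * n) + 2,
       forall l r, hit n (arr s) l r -> hit n (arr s') l r &
       forall x y q, joined (arr s') x y q]).
Proof.
move=> B ls ME NE SE PH stars T0 le0; have nW := base_nnW B; have nW' := base_nW B.
have dW := dummy_bound (base_W B).
pose Inv k A m := [/\ table A m, m <= 2 * (n * n) + 2 + k * n,
  forall l r, hit n (arr s) l r -> hit n A l r &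
  forall j x y q, j < k -> entry (arr s) j x y -> joined A x y q].
eapply (@runs_le _ _ _ _ _ (fun s' => Inv (3 * n) (arr s') (reg s' 3))).
- eapply (@runs_each_edge _ _ _ _ _ Inv B ls) => //.
    by split=> //; rewrite addn0.
  move=> k s1 x y lt_k exy s1x s1y fr1 [T1 le1 mono1 jo1]; have B1 := base_frame fr1 isT B.
  have [ME1 NE1 SE1] : [/\ mat (arr s1 0) (edge_rel E), mat (arr s1 5) (edge_rel N)
      & mat (arr s1 6) (star E)] by rewrite !fr1.2.
  have kn_le : k.+1 * n <= 3 * (n * n).
    by rewrite mulnA leq_mul2r lt_k orbT.
  rewrite mulSn in kn_le.
  pose Inv' q s2 := [/\ table (arr s2) (reg s2 3), reg s2 3 <= 2 * (n * n) + 2 + k * n + q,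
    forall l r, hit n (arr s1) l r -> hit n (arr s2) l r &
    forall z : 'I_n, z < q -> joined (arr s2) x y z].
  have conclude s2 : Inv' n s2 -> Inv k.+1 (arr s2) (reg s2 3).
    move=> [T2 le2 mono2 jo2]; split=> //.
    + by rewrite mulSn; lia.
    + by move=> l r h; apply/mono2/mono1.
    move=> j x' y' q; rewrite ltnS leq_eqVlt => /orP[/eqP->|jk] e.
      case: exy e => ex ey [ex' ey'].
      have -> : x' = x by apply: ord_inj; rewrite -ex' ex.
      have -> : y' = y by apply: ord_inj; rewrite -ey' ey.
      exact: jo2.
    by move=> st tr; apply: mono2; apply: (jo1 j).
  eapply runs_test; try by_base B1.
    move=> st; set s2 := probe _ _ _ _; have B2 : base n W s2 by case: B1; split.
    eapply (@runs_le _ _ _ _ _ (Inv' n)); [|exact: conclude|exact: leqnn].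
    eapply runs_for; try by_base B2.
    + exact: ltnW.
    + by split; rewrite /= /upd /= ?addn0.
    move=> q s3 qn s3q fr3 [T3 le3 mono3 jo3]; have B3 := base_frame fr3 isT B2.
    have [ME3 NE3 SE3 PH3] : [/\ mat (arr s3 0) (edge_rel E), mat (arr s3 5) (edge_rel N),
       mat (arr s3 6) (star E) & forall v : 'I_n, arr s3 7 v = phi v].
      by rewrite !fr3.2 //= !fr1.2.
    pose z := Ordinal qn; have [s3x s3y] : reg s3 12 = x /\ reg s3 13 = y by rewrite !fr3.1.
    have s3z : reg s3 11 = z by [].
    have skip (s4 : state) : arr s4 = arr s3 -> reg s4 3 = reg s3 3 -> ~~ triangle E x y z ->
        Inv' q.+1 (set_reg s4 11 q.+1).
      move=> s4A s43 Ntr; split; rewrite /= ?s4A /upd /= ?s43 //; first by rewrite addnS ltnW.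
      move=> z'; rewrite ltnS leq_eqVlt => /orP[/eqP zq|]; last exact: jo3.
      have -> : z' = z by apply: ord_inj.
      by move=> _; rewrite (negPf Ntr).
    eapply runs_test; try by_base B3.
      move=> yz; set s4 := probe _ _ _ _; have B4 : base n W s4 by case: B3; split.
      have ME4 : mat (arr s4 0) (edge_rel E) by [].
      eapply (@runs_test _ n _ _ _ _ _ s4 z x); try by_base B4.
        move=> zx; set s5 := probe _ _ _ _; have B5 : base n W s5 by case: B4; split.
        have tr : triangle E x y z.
          apply/and3P; split=> //; apply: (subsetP (necessary_sub E)).
          by case/and3P: st.
        have s5W : reg s5 3 < W by rewrite /= /upd /=; lia.
        have run := @runs_join_step s5 x y z B5 NE3 SE3 PH3 T3 s5W s3x s3y s3z st tr.
        apply: (runs_le run) (leqnn _) => s6 [T6 le6 hit6 mono6].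
        have le6' : reg s6 3 <= (reg s3 3).+1 by [].
        split=> //.
        - by rewrite /= /upd /=; lia.
        - by move=> l r h; apply/mono6/mono3.
        move=> z'; rewrite ltnS leq_eqVlt => /orP[/eqP zq|zq].
          by have -> : z' = z by apply: ord_inj.
        by move=> st' tr'; apply/mono6/jo3.
      by move=> Nzx; apply: runs_skip; apply: skip => //; rewrite /triangle (negPf Nzx) !andbF.
    by move=> Nyz; apply: runs_skip; apply: skip => //; rewrite /triangle (negPf Nyz) andbF.
  move=> Nst; apply: runs_skip; split; rewrite /= /upd /= //.
    by rewrite mulSn; lia.
  move=> j x' y' q; rewrite ltnS leq_eqVlt => /orP[/eqP->|jk] e; last exact: (jo1 j).
  case: exy e => ex ey [ex' ey'].
  have -> : x' = x by apply: ord_inj; rewrite -ex' ex.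
  have -> : y' = y by apply: ord_inj; rewrite -ey' ey.
  by rewrite /joined (negPf Nst).
- move=> s' [T' le' mono jo]; split=> //; first by move: le'; rewrite -mulnA; lia.
  move=> x y q st; have [k lt_k e] := stars x y st.
  exact: jo lt_k e st.
- nia.
Qed.

Lemma table_encodes A m :
  table A m -> (forall l r, l < K -> r < K -> forced E phi l r -> hit n A l r) ->
  (forall x y q, joined A x y q) -> encodes E phi (fun l r => A 13 (addr n l r)).
Proof.
move=> [_ sound] fo jo l r lK rK; split.
- move=> h; have e : A 13 (addr n l r) = (A 13 (addr n l r)).-1.+1 by rewrite prednK.
  case: (sound l r lK rK h) => [[fo' f]|[u [v [jo' f]]]]; [left | right; exists u, v];
    by split=> //; rewrite e f.
- exact: fo.
move=> u v /existsP[x /existsP[y /existsP[q /and3P[st tr]]]].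
have := jo x y q st tr; rewrite /join_cell.
by case: ifP => _ h /andP[_ /eqP e]; move: h; rewrite -e.
Qed.

End Joins.

(** * The reduction *)

Definition set_constants :=
  Seq (Assign 6 (Const 1)) (Seq (Assign 25 (Const 2)) (Seq (Assign 8 (Mul 0 0))
  (Seq (Assign 7 (Add 8 6)) (Seq (Assign 1 (Add 8 25)) (Seq (Assign 2 (Add 8 25))
  (Seq (Assign 9 (Add 0 0)) (Assign 9 (Add 9 0)))))))).

Definition reduction :=
  Seq set_constants (Seq remove_loops (Seq search (Seq unchord (Seq search
    (Seq mark_necessary (Seq mark_stars (Seq set_parity
      (Seq isolate_unused join_stars)))))))).

(** Array 5 already holds the necessary edges. A pendant edge carries n^2 + 1, so its write goes to
    address n^2, just outside the output matrix. *)
Definition read_cover :=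
  for_loop 10 4
    (Seq (Assign 33 (Read 3 10)) (Seq (Assign 34 (Read 4 10))
    (Seq (Assign 14 (Mul 33 1)) (Seq (Assign 14 (Add 14 34))
    (Seq (Assign 16 (Read 13 14)) (Seq (Assign 16 (Defs.Sub 16 6)) (Write 5 16 6))))))).

(** Large enough for the addresses [addr n l r], which stay below (n^2 + 2)^2. *)
Definition word_bound n := (n * n + 3) * (n * n + 3).

Definition time_bound n := 3000 * (n * n) + 3000 * n + 3000.

Lemma adj_matrix_mat n (E : digraph n) : mat (adj_matrix E) (edge_rel E).
Proof.
move=> u v; rewrite /adj_matrix /edge_rel; congr nat_of_bool.
apply/existsP/idP => [[u' /existsP[v' /andP[/eqP/cell_inj[<- <-]]]]//|uv].
by exists u; apply/existsP; exists v; rewrite eqxx.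
Qed.

Lemma runs_set_constants n (E : digraph n) :
  runs (word_bound n) set_constants (init_state E) 10 (base n (word_bound n)).
Proof.
have dW := dummy_bound (leqnn (word_bound n)).
have nW : 3 * n <= word_bound n by rewrite /word_bound; nia.
eapply (@runs_le _ _ _ _ _ (base n (word_bound n))); [|by []|].
- do 7!(apply: runs_seq; apply: runs_assign; rewrite /= /upd /=; first lia).
  apply: runs_assign; rewrite /= /upd /=; first lia.
  by split; rewrite /= /upd /= ?addn1 //; lia.
- by [].
Qed.

Record reduced n (E : digraph n) (s : state) : Prop := Reduced {
  red_base : base n (word_bound n) s;
  red_cover : exists (E' : digraph n) (phi : 'I_n -> bool),
    [/\ reduces E E', [/\ cycles_at_most 3 E', loopless E', chordless E' & strongly_connected E'],
        is_potential E' phi, mat (arr s 5) (edge_rel (necessary E')) &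
        [/\ encodes E' phi (fun l r => arr s 13 (addr n l r)), table E' phi (arr s) (reg s 3)
          & reg s 3 <= 5 * (n * n) + 2]] }.

Lemma runs_reduction n (E : digraph n) :
  strongly_connected E -> cycles_at_most 3 E ->
  runs (word_bound n) reduction (init_state E) (time_bound n) (reduced E).
Proof.
move=> scE shortE; set W := word_bound n.
set E0 := E :\: [set e | e.1 == e.2]; have red0 : reduces E E0 := reduces_noloop E.
have scE0 := reduces_sc scE red0; have short0 := cycles_at_most_sub red0.1 shortE.
have noloop0 : loopless E0 by move=> u; rewrite /edge_rel !inE eqxx.
eapply (@runs_le _ _ _ _ _ (reduced E)); [|by []|].
- apply: runs_seq; apply: (runs_le (runs_frame (runs_set_constants E))) (leqnn _) => s1 [B1 fr1].
  have M1 : mat (arr s1 0) (edge_rel E) by rewrite fr1.2 //; apply: adj_matrix_mat.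
  apply: runs_seq; apply: (runs_le (runs_frame (runs_remove_loops B1 M1))) (leqnn _) => s2 [M2 fr2].
  have B2 := base_frame fr2 isT B1.
  apply: runs_seq; apply: (runs_le (runs_frame (runs_search B2 M2 short0 noloop0 scE0))) (leqnn _).
  move=> s3 [[o3 [so3 oT3 ls3 sc3]] fr3]; have B3 := base_frame fr3 isT B2.
  have M3 : mat (arr s3 0) (edge_rel E0) by rewrite fr3.2.
  apply: runs_seq.
  apply: (runs_le (runs_frame (runs_unchord B3 ls3 M3 short0 noloop0 sc3))) (leqnn _).
  move=> s4 [[E' [M4 red4 nochord]] fr4]; have B4 := base_frame fr4 isT B3.
  have scE' := reduces_sc scE0 red4; have short := cycles_at_most_sub red4.1 short0.
  have noloop := loopless_sub red4.1 noloop0; have red := reduces_trans red0 red4.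
  (* The first list may contain deleted edges, so a second one is made for the chordless digraph. *)
  apply: runs_seq; apply: (runs_le (runs_frame (runs_search B4 M4 short noloop scE'))) (leqnn _).
  move=> s5 [res5 fr5]; have B5 := base_frame fr5 isT B4.
  have M5 : mat (arr s5 0) (edge_rel E') by rewrite fr5.2.
  have zero a : a \notin [:: 0; 8; 9; 10; 11; 12] -> arr s5 a = fun=> 0.
    rewrite !inE !negb_or => /and5P[a0 a8 a9 a10 /andP[a11 a12]].
    rewrite fr5.2 ?fr4.2 ?fr3.2 ?fr2.2 ?fr1.2 //= ?inE ?negb_or ?a0 ?a8 ?a9 ?a10 ?a11 ?a12 //.
    by rewrite /upd (negPf a0).
  have z5 (u v : 'I_n) : arr s5 5 (cell u v) = 0 by rewrite zero.
  apply: runs_seq.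
  apply: (runs_le (runs_frame (runs_mark_necessary B5 M5 res5 z5 short noloop nochord))) (leqnn _).
  move=> s6 [N6 fr6]; have B6 := base_frame fr6 isT B5.
  have M6 : mat (arr s6 0) (edge_rel E') by rewrite fr6.2.
  have res_frame (s' : state) : arr s' 8 = arr s5 8 -> arr s' 9 = arr s5 9 -> arr s' 10 = arr s5 10 ->
      arr s' 11 = arr s5 11 -> arr s' 12 = arr s5 12 -> search_result E' (arr s').
    move=> e8 e9 e10 e11 e12; have [o [[uo o9 root par] oT ls sc]] := res5.
    exists o; split=> //.
    + split=> // v vo; rewrite ?e9 ?e10; [exact: o9 | exact: root | exact: par].
    + by move=> k /ls[x [y]]; rewrite /entry -e11 -e12; exists x, y.
    + by move: sc; rewrite /listed e11 e12.
  have res6 : search_result E' (arr s6) by apply: res_frame; rewrite fr6.2.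
  have z6 (u v : 'I_n) : arr s6 6 (cell u v) = 0 by rewrite fr6.2 // zero.
  apply: runs_seq.
  apply: (runs_le (runs_frame (runs_mark_stars B6 M6 res6 N6 z6 short noloop nochord))) (leqnn _).
  move=> s7 [S7 fr7]; have B7 := base_frame fr7 isT B6.
  have [M7 N7] : mat (arr s7 0) (edge_rel E') /\ mat (arr s7 5) (edge_rel (necessary E')).
    by rewrite !fr7.2.
  have res7 : search_result E' (arr s7) by apply: res_frame; rewrite fr7.2 // fr6.2.
  apply: runs_seq.
  apply: (runs_le (runs_frame (runs_set_parity B7 M7 res7 N7 S7 short noloop nochord scE'))) (leqnn _).
  move=> s8 [[phi pot P8] fr8]; have B8 := base_frame fr8 isT B7.
  have S8 : mat (arr s8 6) (star E') by rewrite fr8.2.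
  have r8 : reg s8 3 = 0.
    by rewrite fr8.1 // fr7.1 // fr6.1 // fr5.1 // fr4.1 // fr3.1 // fr2.1 // fr1.1.
  have T8 : table E' phi (arr s8) 0.
    (* The table has too many addresses to be cleared in quadratic time; its zeros come from the
       initial memory. *)
    have z13 : arr s8 13 = fun=> 0 by rewrite fr8.2 // fr7.2 // fr6.2 // zero.
    split; last by move=> l r _ _; rewrite /hit z13.
    by exists [::]; split=> // l r _ _; rewrite /hit z13.
  apply: runs_seq; apply: (runs_le (runs_frame (runs_isolate_unused B8 S8 P8 T8 r8))) (leqnn _).
  move=> s9 [[T9 le9 fo9] fr9]; have B9 := base_frame fr9 isT B8.
  have [M9 N9 S9] : [/\ mat (arr s9 0) (edge_rel E'), mat (arr s9 5) (edge_rel (necessary E'))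
      & mat (arr s9 6) (star E')] by rewrite !fr9.2 // fr8.2 // fr8.2.
  have P9 (v : 'I_n) : arr s9 7 v = phi v by rewrite fr9.2.
  have [o [so oT ls9 sc9]] : search_result E' (arr s9).
    by apply: res_frame; rewrite fr9.2 // fr8.2 // fr7.2 // fr6.2.
  have stars x y : star E' x y -> exists2 k, k < 3 * n & entry (arr s9) k x y.
    move=> /star_necessary Nxy.
    suff: edge_rel (listed (arr s9) E') x y by case/listedP.
    by apply: (necessary_scss short noloop nochord) Nxy; split=> //; apply: listed_sub.
  apply: (runs_le (runs_frame (runs_join_stars B9 ls9 M9 N9 S9 P9 stars T9 le9))) (leqnn _).
  move=> s10 [[T10 le10 mono jo] fr10]; split; first exact: base_frame fr10 isT B9.
  exists E', phi; split=> //; first by rewrite fr10.2.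
  split=> //; apply: table_encodes T10 _ jo => l r lK rK fo.
  exact/mono/fo9.
- rewrite /time_bound; lia.
Qed.

Lemma ord_pairs k (es : seq (nat * nat)) :
  (forall c, c \in es -> c.1 < k /\ c.2 < k) ->
  exists es' : seq ('I_k * 'I_k), es = [seq (val e.1, val e.2) | e <- es'].
Proof.
elim: es => [|[a b] es IHes] lt; first by exists [::].
have [c ces|es' ->] := IHes; first by apply: lt; rewrite inE ces orbT.
have [ak bk] := lt (a, b) (mem_head _ _).
by exists ((Ordinal ak, Ordinal bk) :: es').
Qed.

Lemma table_bigraph n (E : digraph n) phi s W :
  base n W s -> table E phi (arr s) (reg s 3) ->
  holds_bigraph s (cover_graph n (fun l r => arr s 13 (addr n l r))) /\
  #|bedges (cover_graph n (fun l r => arr s 13 (addr n l r)))| = reg s 3.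
Proof.
move=> B [[es [ues szes esK esA hites]] _]; have [es' esE] := ord_pairs esK.
have inj : injective (fun e : 'I_(n * n + 2) * 'I_(n * n + 2) => (val e.1, val e.2)).
  by move=> [a b] [c d] /= [/ord_inj-> /ord_inj->].
have ues' : uniq es' by move: ues; rewrite esE map_inj_uniq.
have mem : es' =i [set e : 'I_(n * n + 2) * 'I_(n * n + 2) | 0 < arr s 13 (addr n e.1 e.2)].
  by move=> [l r]; rewrite inE -/(hit n (arr s) l r) hites // esE (mem_map inj es' (l, r)).
have nthE k e : onth es' k = Some e -> k < reg s 3 /\ nth (0, 0) es k = (val e.1, val e.2).
  move=> ek; have kn : k < size es' by rewrite -onthTE ek.
  by rewrite -szes esE size_map (nth_map e) // (@onth_nth _ e e es' k ek).
split; last first.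
  by rewrite -szes esE size_map /= -(card_uniqP ues') (eq_card mem).
split; [exact: base_K B | exact: base_K' B | exists es'; split=> //].
- by rewrite -szes esE size_map.
- by move=> k e /nthE[kn eE]; have [-> _] := esA k kn; rewrite eE.
- by move=> k e /nthE[kn eE]; have [_ ->] := esA k kn; rewrite eE.
Qed.

Lemma runs_read_cover n (E' : digraph n) phi s (C : {set 'I_(n * n + 2) * 'I_(n * n + 2)}) cs :
  let F l r := arr s 13 (addr n l r) in
  base n (word_bound n) s -> table E' phi (arr s) (reg s 3) ->
  mat (arr s 5) (edge_rel (necessary E')) -> reg s 3 <= 5 * (n * n) + 2 ->
  C \subset bedges (cover_graph n F) -> uniq cs -> cs =i C ->
  runs (word_bound n) read_cover (load_cover cs s) (time_bound n)
    (fun s' => holds_output s' (selected E' F C)).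
Proof.
move=> F B T NE le3 CH ucs csC; set s0 := load_cover cs s.
have B0 : base n (word_bound n) s0 by case: B; split.
have dW := dummy_bound (base_W B).
(* A cover listed without repetition is no longer than the list of instance edges, which makes the
   decoding quadratic. *)
have szcs : size cs <= 5 * (n * n) + 2.
  have [_ card_H] := table_bigraph B T; apply: leq_trans le3; rewrite -card_H.
  by rewrite -(card_uniqP ucs) (eq_card csC) subset_leq_card.
have [_ sound] := T.
pose Inv k s' := forall u v : 'I_n, arr s' 5 (cell u v) =
  edge_rel (necessary E') u v ||
  has (fun c : 'I_(n * n + 2) * 'I_(n * n + 2) => F c.1 c.2 == (cell u v).+1) (take k cs).
eapply (@runs_le _ _ _ _ _ (Inv (size cs))).
- eapply runs_for; try exact: base_1 B0; try by [].
  + lia.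
  + by move=> u v; rewrite take0 orbF; apply: NE.
  move=> k s' kn s'k fr Is'; have B' := base_frame fr isT B0.
  have [c0 _] : exists c, c \in cs by case: (cs) kn => // c ? _; exists c; rewrite mem_head.
  have c_in : nth c0 cs k \in C by rewrite -csC mem_nth.
  have s'3 : arr s' 3 k = (nth c0 cs k).1.
    by rewrite fr.2 //= /upd /= (nth_map c0).
  have s'4 : arr s' 4 k = (nth c0 cs k).2.
    by rewrite fr.2 //= /upd /= (nth_map c0).
  have s'13 : arr s' 13 = arr s 13 by rewrite fr.2.
  move: (nth c0 cs k) c_in s'3 s'4 (take_nth c0 kn) => [l r] lrC /= s'3 s'4 tk.
  have hlr : hit n (arr s) l r by have := subsetP CH _ lrC; rewrite inE.
  have addr_le := addr_bound (ltn_ord l) (ltn_ord r) (base_W B).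
  have := sound l r (ltn_ord l) (ltn_ord r) hlr => /selects_lt le_v.
  have lK := ltn_ord l; have rK := ltn_ord r.
  have Fpos : (F l r).-1.+1 = F l r by rewrite prednK.
  apply: runs_seq; apply: runs_assign; rewrite /= s'k s'3; first lia.
  apply: runs_seq; apply: runs_assign; rewrite /= /upd /= s'k s'4; first lia.
  apply: runs_seq; apply: runs_assign; rewrite /= /upd /= (base_K B').
    by apply: leq_trans addr_le; rewrite leq_addr.
  apply: runs_seq; apply: runs_assign; rewrite /= /upd /= -/(addr n l r) //.
  apply: runs_seq; apply: runs_assign; rewrite /= /upd /= s'13 -/(F l r).
    by rewrite -Fpos; move: le_v; rewrite -/(F l r); lia.
  apply: runs_seq; apply: runs_assign; rewrite /= /upd /= (base_1 B') -Fpos subn1 /=.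
    by move: le_v; rewrite -/(F l r); lia.
  apply: runs_write => u v; rewrite /= /upd /= (base_1 B') tk has_rcons /= -Fpos eqSS.
  by rewrite Is' eq_sym; case: eqP => //= _; rewrite orbT.
- move=> s' Is' u v; rewrite [u * n + v]/(cell u v) Is' in_setU; congr nat_of_bool.
  rewrite take_size; congr (_ || _); rewrite inE.
  apply/hasP/existsP=> [[c ccs Fc]|[c /andP[cC Fc]]]; exists c => //.
    by rewrite -csC ccs.
  by rewrite csC.
- rewrite /time_bound; lia.
Qed.

Theorem theorem1 :
  exists (P Q : cmd) (T W : nat -> nat) (k : nat),
    [/\ bigO T (fun n => n ^ 2),
        bigO W (fun n => n ^ k) &
        forall (n : nat) (E : digraph n),
          strongly_connected E -> cycles_at_most 3 E ->
          exists (H : bigraph) (t1 : nat) (s1 : state),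
            [/\ exec (W n) P (init_state E) t1 s1,
                t1 <= T n,
                holds_bigraph s1 H,
                (exists C : {set 'I_(nleft H) * 'I_(nright H)},
                   edge_cover C) &
                forall (C : {set 'I_(nleft H) * 'I_(nright H)})
                       (cs : seq ('I_(nleft H) * 'I_(nright H))),
                  min_edge_cover C -> uniq cs -> cs =i C ->
                  exists (t2 : nat) (s2 : state) (S : digraph n),
                    [/\ exec (W n) Q (load_cover cs s1) t2 s2,
                        t2 <= T n,
                        holds_output s2 S &
                        min_scss E S]]].
Proof.
exists reduction, read_cover, time_bound, word_bound, 4; split.
(* From n = 3 on, the linear term costs at most 1000 n^2 and the constant less than 500 n^2. *)
- exists 4500, 3 => n n_ge3 /=; rewrite /time_bound -[n ^ 2]mulnn.
  have n_le : 3 * n <= n * n by rewrite leq_mul2r n_ge3 orbT.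
  by lia.
(* For n > 0 each factor n^2 + 3 is at most 4 n^2. *)
- exists 16, 1 => n n_gt0 /=; rewrite /word_bound.
  have -> : 16 * n ^ 4 = (4 * (n * n)) * (4 * (n * n)) by rewrite !expnS expn0; lia.
  have nn_gt0 : 0 < n * n by rewrite muln_gt0 n_gt0.
  by apply: leq_mul; lia.
move=> n E scE shortE.
have [t1 [s1 [ex1 le1 [B [E' [phi [red [short noloop nochord scE'] pot NE [enc T le3]]]]]]]] :=
  runs_reduction scE shortE.
exists (cover_graph n (fun l r => arr s1 13 (addr n l r))), t1, s1; split=> //.
- by case: (table_bigraph B T).
- exact: (cover_exists short noloop nochord scE' enc).
move=> C cs minC ucs csC; have [[CH _] _] := minC.
have [t2 [s2 [ex2 le2 out]]] := runs_read_cover B T NE le3 CH ucs csC.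
exists t2, s2, (selected E' (fun l r => arr s1 13 (addr n l r)) C); split=> //.
apply: reduces_min red _; exact: (selected_min short noloop nochord scE' pot enc minC).
Qed.
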